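(* The triple $(\rho,\psi,\mu)$ is an isomorphism of short exact sequences of $\mathfrak{S}$-modules from $$0\to\mathrm{CycPreLie}\xrightarrow{\iota}\mathrm{Perm}\odot\mathrm{CycPreLie}\xrightarrow{p}\mathrm{Refl}\odot\mathrm{CycPreLie}\to0$$ to $$0\to\mathrm{Rela}_{v=1}\xrightarrow{\delta}\mathrm{PreLie}_{v=1}\xrightarrow{\pi}\mathrm{Indec}_{\geq2}\to0 .$$
   Context: All vector spaces are over $\mathbb{Q}$. An $\mathfrak{S}$-module is a functor from the groupoid of finite sets (and bijections) to $\mathbb{Q}$-vector spaces. $(P\otimes Q)(I)=\bigoplus_{I=J\sqcup K}P(J)\otimes Q(K)$, $\Lambda^k$ denotes exterior powers for this symmetric tensor product (usual flip, no extra signs), and $(P\odot Q)(I)=P(I)\otimes Q(I)$. $\mathrm{PreLie}$ is the operad of pre-Lie algebras (product $\triangleleft$ with $(x\triangleleft y)\triangleleft z-x\triangleleft(y\triangleleft z)=(x\triangleleft z)\triangleleft y-x\triangleleft(z\triangleleft y)$). $\mathrm{PreLie}(I)$ has as basis the rooted trees with vertex set $I$ (edges oriented towards the root). The partial composition $S\circ_i T$ is the sum of all rooted trees obtained from the disjoint union of $S\setminus\{i\}$ and $T$ by reconnecting the edges of $S$ incident to $i$: each edge incoming at $i$ keeps its start and ends at some vertex of $T$ (all choices), and the outgoing edge at $i$ (if any) keeps its end and starts at the root of $T$. $S\triangleleft T$ is the sum of all rooted trees obtained from $S\sqcup T$ by adding an edge from the root of $T$ to a vertex of $S$, rooted at the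 root of $S$. An index $i$ also denotes the one-vertex tree on $\{i\}$. $\mathrm{CycPreLie}$ is the right $\mathrm{PreLie}$-module $\Lambda^2\mathrm{PreLie}/K_P$, where $K_P$ is the sub-right-$\mathrm{PreLie}$-module generated by the relations (writing $\langle r,s\rangle$ for the class of $r\wedge s$) $\langle x,y\triangleleft z\rangle=-\langle z,y\triangleleft x\rangle$ and $\langle x,y\triangleleft z\rangle=\langle y,x\triangleleft z-z\triangleleft x\rangle$. Known fact: for every $t\in\mathrm{CycPreLie}(I)$ and $i\in I$ there is a unique $\Gamma_i(t)\in\mathrm{PreLie}(I\setminus\{i\})$ with $t=\langle i,\Gamma_i(t)\rangle$. Top row: $\mathrm{Comm}(I)=\mathbb{Q}$, $\mathrm{Perm}(I)=\mathbb{Q}I$ (basis $I$), $\mathrm{Comm}\to\mathrm{Perm}$ sends $1$ to $\sum_{i\in I}i$, and $\mathrm{Refl}=\mathrm{Perm}/\mathrm{Comm}$. The top row is obtained from $0\to\mathrm{Comm}\to\mathrm{Perm}\to\mathrm{Refl}\to0$ by the product $\odot$ with $\mathrm{CycPreLie}$; thus $\iota(t)=\sum_{i\in I}i\otimes t$ and $p$ is the projection. Bottom row: with $[x,y]=x\triangleleft y-y\triangleleft x$, $\mathrm{PreLie}$ is a Lie algebra in $\mathfrak{S}$-modules, with Chevalley–Eilenberg differentials $\delta(s\wedge t)=[s,t]$ and $\delta(r\wedge s\wedge t)=[r,s]\wedge t+[s,t]\wedge r-[r,t]\wedge s$. $\mathrm{Rela}$ is the quotient of $\Lambda^2\mathrm{PreLie}$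 by the image of $\delta:\Lambda^3\mathrm{PreLie}\to\Lambda^2\mathrm{PreLie}$, and $\pi:\mathrm{PreLie}\to\mathrm{Indec}$ is the cokernel of $\delta:\Lambda^2\mathrm{PreLie}\to\mathrm{PreLie}$. Since $\mathrm{PreLie}$ is known to be a free Lie algebra in $\mathfrak{S}$-modules, $0\to\mathrm{Rela}\xrightarrow{\delta}\mathrm{PreLie}\xrightarrow{\pi}\mathrm{Indec}\to0$ is exact. $\mathrm{PreLie}_{v=1}$ is the sub-$\mathfrak{S}$-module of $\mathrm{PreLie}$ spanned by rooted trees whose root is adjacent to exactly one edge, $\mathrm{Rela}_{v=1}$ is the subspace of $\mathrm{Rela}$ mapped by $\delta$ into $\mathrm{PreLie}_{v=1}$, and $\mathrm{Indec}_{\geq2}$ is $\mathrm{Indec}$ with its degree $1$ component removed. The bottom row is exact, because every rooted tree with at least two vertices is equivalent modulo $\delta(\Lambda^2\mathrm{PreLie})$ to a combination of trees of root-valence $1$. Vertical maps: $\psi(a\otimes t)=a\triangleleft\Gamma_a(t)$ for $t\in\mathrm{CycPreLie}(I)$, $a\in I$; $\rho:\mathrm{CycPreLie}\to\mathrm{Rela}_{v=1}$ is the unique morphism of $\mathfrak{S}$-modules with $\delta\rho=\psi\iota$, i.e. $\delta(\rho(x))=\sum_{i\in I}i\triangleleft\Gamma_i(x)$ (its existence and uniqueness is established in the paper); $\mu:\mathrm{Refl}\odot\mathrm{CycPreLie}\to\mathrm{Indec}_{\geq2}$ is the induced quotient morphism, determined by $\mu p=\pi\psi$. *)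

(* Defs.v *)
From HB Require Import structures.
From mathcomp Require Import all_boot all_order all_fingroup all_algebra.
From mathcomp Require Import boolp ring.

Set Implicit Arguments.
Unset Strict Implicit.
Unset Printing Implicit Defensive.

Import GRing.Theory VectorInternalTheory.
Local Open Scope ring_scope.

(* The S-modules of the statement are finite-dimensional in each degree, so
   their values are taken in [vectType rat]. *)

(* The linear map from the free space {ffun B -> rat^o} sending the basis
   vector b to g b. *)
Section LinearExtension.
Variables (B : finType) (V : vectType rat) (g : B -> V).

Definition linext_fun (x : {ffun B -> rat^o}) : V := \sum_b x b *: g b.

Lemma linext_fun_linear : linear linext_fun.
Proof.
move=> a x y; rewrite /linext_fun scaler_sumr -big_split /=.
by apply: eq_bigr => b _; rewrite !ffunE scalerDl scalerA.
Qed.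

HB.instance Definition _ :=
  GRing.isLinear.Build rat {ffun B -> rat^o} V _ linext_fun linext_fun_linear.

Definition linext : 'Hom({ffun B -> rat^o}, V) := linfun linext_fun.

Lemma linextE x : linext x = \sum_b x b *: g b.
Proof. by rewrite lfunE. Qed.

End LinearExtension.

(* V / W, realized on the chosen complement of W; qproj is surjective with
   kernel W. *)
Section Quotient.
Variables (V : vectType rat).
Implicit Types W : {vspace V}.

Definition quo W : vectType rat := subvs_of (W^C)%VS.

Definition qproj W : 'Hom(V, quo W) :=
  (linfun (vsproj (W^C)%VS) \o (\1 - projv W))%VF.

Definition qsec W : 'Hom(quo W, V) := linfun (@vsval _ _ (W^C)%VS).

Lemma qprojE W v : vsval (qproj W v) = v - projv W v.
Proof.
rewrite /qproj comp_lfunE lfunE /= vsprojK add_lfunE id_lfunE opp_lfunE //.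
exact: memv_projC.
Qed.

Lemma qsecE W x : qsec W x = vsval x.
Proof. by rewrite /qsec lfunE. Qed.

Lemma qsecK W x : qproj W (qsec W x) = x.
Proof.
apply: val_inj; rewrite [LHS]qprojE qsecE.
have: vsval x \in lker (projv W) by rewrite lker_proj subvsP.
by rewrite memv_ker => /eqP ->; rewrite subr0.
Qed.

Lemma qprojK W v : v - qsec W (qproj W v) \in W.
Proof. by rewrite qsecE qprojE opprB addrCA subrr addr0 memv_proj. Qed.

Lemma limg_qproj W : limg (qproj W) = fullv.
Proof.
apply/vspaceP => x; rewrite memvf; apply/memv_imgP.
by exists (qsec W x); rewrite ?memvf ?qsecK.
Qed.

Lemma lker_qproj W : lker (qproj W) = W.
Proof.
apply/vspaceP => v; rewrite memv_ker; apply/eqP/idP => [v0|Wv].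
  by have := qprojK W v; rewrite v0 linear0 subr0.
by apply: val_inj; rewrite [LHS]qprojE projv_id // subrr.
Qed.

Lemma qproj_eq0 W v : (qproj W v == 0) = (v \in W).
Proof. by rewrite -memv_ker lker_qproj. Qed.

End Quotient.

(* The map V / W -> U induced by f; only meaningful when f vanishes on W. *)
Definition qlift (V U : vectType rat) (W : {vspace V}) (f : 'Hom(V, U)) :
  'Hom(quo W, U) := (f \o qsec W)%VF.

(* The map V / W -> V' / W' induced by f; only meaningful when f W <= W'. *)
Definition qmap (V V' : vectType rat) (W : {vspace V}) (W' : {vspace V'})
  (f : 'Hom(V, V')) : 'Hom(quo W, quo W') := qlift W (qproj W' \o f)%VF.

Lemma qliftE (V U : vectType rat) (W : {vspace V}) (f : 'Hom(V, U)) v :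
  (f @: W <= 0)%VS -> qlift W f (qproj W v) = f v.
Proof.
move=> fW; rewrite comp_lfunE; apply/eqP; rewrite eq_sym -subr_eq0 -linearB /=.
by rewrite -memv0 (subvP fW) // memv_img // qprojK.
Qed.

Lemma qmapE (V V' : vectType rat) (W : {vspace V}) (W' : {vspace V'})
    (f : 'Hom(V, V')) v :
  (f @: W <= W')%VS -> qmap W W' f (qproj W v) = qproj W' (f v).
Proof.
move=> fW; rewrite /qmap qliftE ?comp_lfunE //.
by rewrite limg_comp subv0 -lkerE lker_qproj.
Qed.

(* The map U -> U' between subspaces obtained from f; only meaningful when
   f U <= U'. *)
Definition restr (V V' : vectType rat) (U : {vspace V}) (U' : {vspace V'})
  (f : 'Hom(V, V')) : 'Hom(subvs_of U, subvs_of U') :=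
  (linfun (vsproj U') \o f \o linfun (@vsval _ _ U))%VF.

Lemma restrE (V V' : vectType rat) (U : {vspace V}) (U' : {vspace V'})
    (f : 'Hom(V, V')) x :
  (f @: U <= U')%VS -> vsval (restr U U' f x) = f (vsval x).
Proof.
move=> fU; rewrite !comp_lfunE !lfunE /= vsprojK //.
by rewrite (subvP fU) // memv_img // subvsP.
Qed.

(* The tensor product V (x) W, as matrices in the coordinates of V and W. *)
Section Tensor.
Variables V W : vectType rat.

Definition tensor : vectType rat := 'M[rat]_(dim V, dim W).

Definition tens (v : V) (w : W) : tensor := (v2r v)^T *m v2r w.

Variable U : vectType rat.

Definition tlift_fun (b : V -> W -> U) (x : tensor) : U :=
  \sum_i \sum_j x i j *: b (r2v (delta_mx 0 i)) (r2v (delta_mx 0 j)).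

Lemma tlift_fun_linear b : linear (tlift_fun b).
Proof.
move=> a x y; rewrite /tlift_fun scaler_sumr -big_split /=.
apply: eq_bigr => i _; rewrite scaler_sumr -big_split /=.
by apply: eq_bigr => j _; rewrite !mxE scalerDl scalerA.
Qed.

HB.instance Definition _ b :=
  GRing.isLinear.Build rat tensor U _ (tlift_fun b) (tlift_fun_linear b).

(* The linear map induced by the bilinear map b. *)
Definition tlift (b : V -> W -> U) : 'Hom(tensor, U) := linfun (tlift_fun b).

Lemma tliftE b v w :
  (forall w, linear (b^~ w)) -> (forall v, linear (b v)) ->
  tlift b (tens v w) = b v w.
Proof.
move=> bl br; rewrite lfunE /= /tlift_fun.
pose bv w := HB.pack_for {linear V -> U} (b^~ w)
  (GRing.isLinear.Build rat V U _ (b^~ w) (bl w)).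
pose bw v := HB.pack_for {linear W -> U} (b v)
  (GRing.isLinear.Build rat W U _ (b v) (br v)).
have dec (X : vectType rat) (x : X) :
    x = \sum_i (v2r x) 0 i *: r2v (delta_mx 0 i).
  rewrite -[LHS]v2rK {1}[v2r x]row_sum_delta linear_sum.
  by apply: eq_bigr => i _; rewrite linearZ.
transitivity (bv w (\sum_i v2r v 0 i *: r2v (delta_mx 0 i))); last by rewrite -dec.
rewrite linear_sum; apply: eq_bigr => i _; rewrite linearZ /=.
set x := r2v _; transitivity (v2r v 0 i *:
  bw x (\sum_j v2r w 0 j *: r2v (delta_mx 0 j))); last by rewrite -dec.
rewrite linear_sum scaler_sumr; apply: eq_bigr => j _; rewrite linearZ /= scalerA.
by rewrite !mxE big_ord1 !mxE.
Qed.

Lemma tens_span (f g : 'Hom(tensor, U)) :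
  (forall v w, f (tens v w) = g (tens v w)) -> f = g.
Proof.
move=> fg; apply/lfunP => x; rewrite (matrix_sum_delta x) !linear_sum.
apply: eq_bigr => i _; rewrite !linear_sum; apply: eq_bigr => j _.
rewrite !linearZ /=; congr (_ *: _).
have := fg (r2v (delta_mx 0 i)) (r2v (delta_mx 0 j)).
by rewrite /tens !r2vK trmx_delta mul_delta_mx.
Qed.

End Tensor.

Lemma tens_linl (V W : vectType rat) (w : W) : linear ((@tens V W)^~ w).
Proof.
by move=> a x y; rewrite /tens linearP /= linearP /= mulmxDl -scalemxAl.
Qed.

Lemma tens_linr (V W : vectType rat) (v : V) : linear (@tens V W v).
Proof. by move=> a x y; rewrite /tens linearP /= mulmxDr -scalemxAr. Qed.

HB.instance Definition _ (V W : vectType rat) (v : V) :=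
  GRing.isLinear.Build rat W (tensor V W) _ (@tens V W v) (tens_linr v).

Definition tmap (V V' W W' : vectType rat) (f : 'Hom(V, V')) (g : 'Hom(W, W')) :
  'Hom(tensor V W, tensor V' W') := tlift (fun v w => tens (f v) (g w)).

Lemma tmapE (V V' W W' : vectType rat) (f : 'Hom(V, V')) (g : 'Hom(W, W')) v w :
  tmap f g (tens v w) = tens (f v) (g w).
Proof.
rewrite /tmap tliftE // => [{}w|{}v] a x y.
  by rewrite linearP tens_linl.
by rewrite linearP tens_linr.
Qed.

Lemma pspan_ex (V : vectType rat) (P : V -> Prop) :
  {U : {vspace V} | (forall v, P v -> v \in U) /\
    exists s : seq V, (forall v, v \in s -> P v) /\ U = <<s>>%VS}.
Proof.
apply: cid.
pose Q n := `[< exists s : seq V, (forall v, v \in s -> P v) /\ \dim <<s>> = n >].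
have Q0 : exists n, Q n.
  by exists 0%N; apply/asboolP; exists [::]; split=> //; rewrite span_nil dimv0.
have Qb n : Q n -> (n <= dim V)%N.
  by move=> /asboolP[s [_ <-]]; rewrite -dimvf dimvS ?subvf.
case: (ex_maxnP Q0 Qb) => n /asboolP[s [sP sn]] nmax.
exists <<s>>%VS; split=> [v Pv|]; last by exists s.
have sv : (<<s>> <= <<v :: s>>)%VS by rewrite span_cons addvSr.
have: Q (\dim <<v :: s>>).
  apply/asboolP; exists (v :: s); split=> // u.
  by rewrite inE => /predU1P[->//|/sP].
move/nmax; rewrite -sn => dle.
have /eqP -> : (<<s>> == <<v :: s>>)%VS by rewrite eqEdim sv.
by apply: memv_span; rewrite inE eqxx.
Qed.

Definition pspan (V : vectType rat) (P : V -> Prop) : {vspace V} :=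
  sval (pspan_ex P).

Lemma pspan_mem (V : vectType rat) (P : V -> Prop) v : P v -> v \in pspan P.
Proof. by rewrite /pspan; case: pspan_ex => U /= [h _]; apply: h. Qed.

Lemma pspan_min (V : vectType rat) (P : V -> Prop) (U : {vspace V}) :
  (forall v, P v -> v \in U) -> (pspan P <= U)%VS.
Proof.
rewrite /pspan; case: pspan_ex => U0 /= [_ [s [sP ->]]] PU.
by apply/span_subvP => v /sP /PU.
Qed.

Lemma pspan_closed (V : vectType rat) (P : V -> Prop) v :
  P 0 -> (forall a u w, P u -> P w -> P (a *: u + w)) ->
  v \in pspan P -> P v.
Proof.
rewrite /pspan; case: pspan_ex => U0 /= [_ [s [sP ->]]] P0 PL.
rewrite -[s]/(tval (in_tuple s)) => /coord_span ->.
elim/big_ind: _ => // [x y Px Py|i _]; first by rewrite -[x]scale1r; apply: PL.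
by rewrite -[X in P X]addr0; apply: PL => //; apply: sP; apply: mem_nth.
Qed.

Record bij (I J : finType) := Bij {
  bfun :> I -> J;
  binv : J -> I;
  bfunK : cancel bfun binv;
  binvK : cancel binv bfun }.

Definition bij_id (I : finType) : bij I I :=
  @Bij I I id id (fun=> erefl) (fun=> erefl).

Definition bij_comp (I J K : finType) (t : bij J K) (s : bij I J) : bij I K :=
  Bij (can_comp (bfunK t) (bfunK s)) (can_comp (binvK s) (binvK t)).

Record smod := SMod {
  scar :> finType -> vectType rat;
  sact : forall I J, bij I J -> 'Hom(scar I, scar J);
  sact_id : forall I, sact (bij_id I) = \1%VF;
  sact_comp : forall I J K (t : bij J K) (s : bij I J),
    sact (bij_comp t s) = (sact t \o sact s)%VF }.

Definition smap (P Q : smod) := forall I, 'Hom(P I, Q I).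

Definition is_mor (P Q : smod) (f : smap P Q) : Prop :=
  forall I J (s : bij I J), (f J \o sact P s)%VF = (sact Q s \o f I)%VF.

Definition stable (P : smod) (U : forall I, {vspace P I}) : Prop :=
  forall I J (s : bij I J), (sact P s @: U I <= U J)%VS.

Lemma limg_stable (P Q : smod) (f : smap P Q) :
  is_mor f -> stable (fun I => limg (f I)).
Proof. by move=> fm I J s; rewrite -limg_comp -fm limg_comp limgS ?subvf. Qed.

Lemma lpreim_stable (P Q : smod) (f : smap P Q) (U : forall I, {vspace Q I}) :
  is_mor f -> stable U -> stable (fun I => (f I @^-1: U I)%VS).
Proof.
move=> fm Us I J s; apply/subvP => _ /memv_imgP[x xU ->].
rewrite -memv_preim -comp_lfunE fm comp_lfunE (subvP (Us _ _ s)) //.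
by rewrite memv_img // memv_preim.
Qed.

Section SubQuotient.
Variables (P : smod) (U : forall I, {vspace P I}) (Us : stable U).

Definition sub_act I J (s : bij I J) : 'Hom(subvs_of (U I), subvs_of (U J)) :=
  restr (U I) (U J) (sact P s).

Lemma sub_act_id I : sub_act (bij_id I) = \1%VF.
Proof.
apply/lfunP => x; apply: subvs_inj.
by rewrite /= restrE ?Us // sact_id !id_lfunE.
Qed.

Lemma sub_act_comp I J K (t : bij J K) (s : bij I J) :
  sub_act (bij_comp t s) = (sub_act t \o sub_act s)%VF.
Proof.
apply/lfunP => x; apply: subvs_inj; rewrite comp_lfunE /=.
by rewrite !restrE ?Us // sact_comp comp_lfunE.
Qed.

Definition sub_smod : smod :=
  @SMod (fun I => subvs_of (U I)) sub_act sub_act_id sub_act_comp.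

Definition quo_act I J (s : bij I J) : 'Hom(quo (U I), quo (U J)) :=
  qmap (U I) (U J) (sact P s).

Lemma quo_act_id I : quo_act (bij_id I) = \1%VF.
Proof.
apply/lfunP => x; rewrite -[x]qsecK /quo_act qmapE ?Us //.
by rewrite sact_id !id_lfunE.
Qed.

Lemma quo_act_comp I J K (t : bij J K) (s : bij I J) :
  quo_act (bij_comp t s) = (quo_act t \o quo_act s)%VF.
Proof.
apply/lfunP => x; rewrite -[x]qsecK comp_lfunE /quo_act !qmapE ?Us //.
by rewrite sact_comp [in LHS](comp_lfunE (sact P t)).
Qed.

Definition quo_smod : smod :=
  @SMod (fun I => quo (U I)) quo_act quo_act_id quo_act_comp.

End SubQuotient.

Section Hadamard.
Variables P Q : smod.

Definition odot_act I J (s : bij I J) :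
  'Hom(tensor (P I) (Q I), tensor (P J) (Q J)) := tmap (sact P s) (sact Q s).

Lemma odot_act_id I : odot_act (bij_id I) = \1%VF.
Proof.
by apply: tens_span => v w; rewrite /odot_act tmapE !sact_id !id_lfunE.
Qed.

Lemma odot_act_comp I J K (t : bij J K) (s : bij I J) :
  odot_act (bij_comp t s) = (odot_act t \o odot_act s)%VF.
Proof.
apply: tens_span => v w.
by rewrite /odot_act comp_lfunE !tmapE !sact_comp !comp_lfunE.
Qed.

Definition odot : smod :=
  @SMod (fun I => tensor (P I) (Q I)) odot_act odot_act_id odot_act_comp.

End Hadamard.

Definition short_exact (A B C : smod) (f : smap A B) (g : smap B C) : Prop :=
  [/\ is_mor f, is_mor g & forall I,
    [/\ lker (f I) = 0%VS, limg (f I) = lker (g I) & limg (g I) = fullv]].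

Definition is_iso (P Q : smod) (f : smap P Q) : Prop :=
  is_mor f /\ forall I, bijective (f I).

Definition square (A B A' B' : smod) (f : smap A B) (f' : smap A' B')
    (a : smap A A') (b : smap B B') : Prop :=
  forall I, (f' I \o a I)%VF = (b I \o f I)%VF.

Definition short_exact_iso (A B C A' B' C' : smod)
    (f : smap A B) (g : smap B C) (f' : smap A' B') (g' : smap B' C')
    (a : smap A A') (b : smap B B') (c : smap C C') : Prop :=
  [/\ short_exact f g, short_exact f' g',
      [/\ is_iso a, is_iso b & is_iso c] &
      square f f' a b /\ square g g' b c].

(* PreLie(J) has a basis of rooted trees, so the k-fold tensor power of PreLie
   evaluated at I has as basis the k-tuples of rooted trees whose vertex sets
   partition I.  Such a tuple is encoded by a pair (f, r): f sends each vertex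
   to the end of its outgoing edge (None for the roots) and the k-tuple r
   lists the roots, hence the trees, in order. *)
Section Forest.
Variable I : finType.

Definition edge (f : {ffun I -> option I}) : rel I :=
  [rel x y | f x == Some y].

Definition raw_forest (k : nat) : finType :=
  ({ffun I -> option I} * k.-tuple I)%type.

Definition is_forest k (F : raw_forest k) : bool :=
  [&& uniq F.2, [forall x, (F.1 x == None) == (x \in F.2)]
    & [forall x, [exists r in F.2, connect (edge F.1) x r]]].

Definition forest k : finType := {F : raw_forest k | is_forest F}.

Definition tpow k : vectType rat := {ffun forest k -> rat^o}.

(* The basis vector of F, with value 0 when F is not a forest. *)
Definition bas k (F : raw_forest k) : tpow k :=
  [ffun G : forest k => (val G == F)%:R].

Definition tpow_ext k (V : vectType rat) (g : raw_forest k -> V) :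
  'Hom(tpow k, V) := linext (fun F : forest k => g (val F)).

Lemma bas_out k (F : raw_forest k) : ~~ is_forest F -> bas F = 0.
Proof.
move=> nF; apply/ffunP => G; rewrite !ffunE.
by case: eqP => // GF; rewrite -GF (valP G) in nF.
Qed.

Lemma tpow_extE k (V : vectType rat) (g : raw_forest k -> V) F :
  is_forest F -> tpow_ext g (bas F) = g F.
Proof.
move=> iF; rewrite linextE (bigD1 (Sub F iF : forest k)) //= big1 => [|G GF].
  by rewrite addr0 !ffunE SubK eqxx scale1r.
by rewrite ffunE -(inj_eq val_inj) SubK in GF *; rewrite (negPf GF) scale0r.
Qed.

Lemma tpow_dec k (x : tpow k) : x = \sum_(F : forest k) x F *: bas (val F).
Proof.
apply/ffunP => G; rewrite sum_ffunE (bigD1 G) //= big1 => [|H HG].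
  by rewrite !ffunE eqxx addr0 [RHS]mulr1.
by rewrite !ffunE (inj_eq val_inj) eq_sym (negPf HG) [LHS]mulr0.
Qed.

Lemma tpow_hom_eq k (V : vectType rat) (g h : 'Hom(tpow k, V)) :
  (forall F, is_forest F -> g (bas F) = h (bas F)) -> g = h.
Proof.
move=> gh; apply/lfunP => x; rewrite (tpow_dec x) !linear_sum.
by apply: eq_bigr => F _; rewrite !linearZ /= gh ?(valP F).
Qed.

Definition graft (f : {ffun I -> option I}) (s v : I) : {ffun I -> option I} :=
  [ffun x => if x == s then Some v else f x].

(* With T_r the tree of f rooted at r: (T_r <| T_s) (x) rest. *)
Definition tri_at k (f : {ffun I -> option I}) (r s : I) (rest : k.-tuple I) :
    tpow k.+1 :=
  \sum_(v | connect (edge f) v r) bas (graft f s v, [tuple of r :: rest]).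

(* [T_r, T_s] (x) rest. *)
Definition lie_at k (f : {ffun I -> option I}) (r s : I) (rest : k.-tuple I) :
    tpow k.+1 :=
  tri_at f r s rest - tri_at f s r rest.

Definition tri : 'Hom(tpow 2, tpow 1) :=
  tpow_ext (fun F => tri_at F.1 (tnth F.2 0) (tnth F.2 1) [tuple]).

Definition d2 : 'Hom(tpow 2, tpow 1) :=
  tpow_ext (fun F => lie_at F.1 (tnth F.2 0) (tnth F.2 1) [tuple]).

Definition d3 : 'Hom(tpow 3, tpow 2) :=
  tpow_ext (fun F =>
    let r := tnth F.2 0 in let s := tnth F.2 1 in let t := tnth F.2 2%:R in
    lie_at F.1 r s [tuple t] + lie_at F.1 s t [tuple r]
    - lie_at F.1 r t [tuple s]).

Definition swap_raw k (i j : 'I_k) (F : raw_forest k) : raw_forest k :=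
  (F.1, [tuple tnth F.2 (tperm i j l) | l < k]).

Definition swap k (i j : 'I_k) : 'Hom(tpow k, tpow k) :=
  tpow_ext (fun F => bas (swap_raw i j F)).

(* The k-th exterior power of PreLie (Lam k below) is the quotient of tpow k by
   this subspace: exchanging two tensor factors changes the sign. *)
Definition asym k : {vspace tpow k} :=
  (\sum_(i : 'I_k) \sum_(j : 'I_k | i != j) limg (swap i j + \1%VF)%R)%VS.

End Forest.

Arguments bas {I k}.
Arguments swap {I k}.
Arguments swap_raw {I k}.
Arguments asym : clear implicits.
Arguments tri : clear implicits.
Arguments d2 : clear implicits.
Arguments d3 : clear implicits.

Definition act_raw I J (s : bij I J) k (F : raw_forest I k) : raw_forest J k :=
  ([ffun y => omap s (F.1 (binv s y))], map_tuple s F.2).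

Definition tact k I J (s : bij I J) : 'Hom(tpow I k, tpow J k) :=
  tpow_ext (fun F => bas (act_raw s F)).

Lemma connect_homo (T U : finType) (e : rel T) (e' : rel U) (h : T -> U) x y :
  (forall x y, e x y -> e' (h x) (h y)) ->
  connect e x y -> connect e' (h x) (h y).
Proof.
move=> he /connectP[p pe ->]; apply/connectP; exists (map h p).
  elim: p x pe => //= z p IHp x /andP[/he -> /=]; exact: IHp.
by rewrite last_map.
Qed.

Section Action.
Variables (I J : finType) (s : bij I J).

Definition bij_inv : bij J I := Bij (binvK s) (bfunK s).

Lemma bij_inj : injective s. Proof. exact: can_inj (bfunK s). Qed.

Lemma edge_act k (F : raw_forest I k) x y :
  edge (act_raw s F).1 (s x) (s y) = edge F.1 x y.
Proof.
rewrite /edge /= ffunE bfunK; case: (F.1 x) => [z|] //=.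
by apply/eqP/eqP => [[/bij_inj ->]|[->]].
Qed.

Lemma connect_act k (F : raw_forest I k) x y :
  connect (edge (act_raw s F).1) (s x) (s y) = connect (edge F.1) x y.
Proof.
apply/idP/idP; last first.
  by apply: connect_homo => {}x {}y; rewrite edge_act.
rewrite -{2}[x](bfunK s) -{2}[y](bfunK s); apply: connect_homo => {}x {}y.
by rewrite -{1}[x](binvK s) -{1}[y](binvK s) edge_act.
Qed.

Lemma is_forest_act k (F : raw_forest I k) :
  is_forest F -> is_forest (act_raw s F).
Proof.
case/and3P => u /forallP n /forallP c; apply/and3P; split.
- by rewrite map_inj_uniq //; apply: bij_inj.
- apply/forallP => y; rewrite -[y](binvK s) /= mem_map; last exact: bij_inj.
  by rewrite -(eqP (n (binv s y))) ffunE bfunK; case: (F.1 _).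
apply/forallP => y; rewrite -[y](binvK s).
have /existsP[r /andP[rF cr]] := c (binv s y).
apply/existsP; exists (s r); rewrite connect_act cr andbT.
by rewrite /= mem_map //; apply: bij_inj.
Qed.

End Action.

Lemma act_raw_id I k (F : raw_forest I k) : act_raw (bij_id I) F = F.
Proof.
case: F => f r; congr (_, _).
  by apply/ffunP => x; rewrite ffunE /=; case: (f x).
by apply: val_inj; rewrite /= map_id.
Qed.

Lemma act_raw_comp I J K (t : bij J K) (s : bij I J) k (F : raw_forest I k) :
  act_raw (bij_comp t s) F = act_raw t (act_raw s F).
Proof.
case: F => f r; congr (_, _).
  by apply/ffunP => x; rewrite !ffunE /=; case: (f _).
by apply: val_inj; rewrite /= map_comp.
Qed.

Lemma act_rawK I J (s : bij I J) k :
  cancel (@act_raw I J s k) (@act_raw J I (bij_inv s) k).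
Proof.
case=> f r; congr (_, _).
  by apply/ffunP => x; rewrite !ffunE /= bfunK; case: (f _) => //= y; rewrite bfunK.
by apply: val_inj; rewrite /= mapK //; apply: bfunK.
Qed.

Lemma tactE I J (s : bij I J) k (F : raw_forest I k) :
  tact k s (bas F) = bas (act_raw s F).
Proof.
have [iF|nF] := boolP (is_forest F); first by rewrite /tact tpow_extE.
rewrite (bas_out nF) linear0 bas_out //; apply: contra nF => /is_forest_act.
by move=> /(_ _ (bij_inv s)); rewrite act_rawK.
Qed.

Lemma tact_id k I : tact k (bij_id I) = \1%VF.
Proof. by apply: tpow_hom_eq => F _; rewrite tactE act_raw_id id_lfunE. Qed.

Lemma tact_comp k I J K (t : bij J K) (s : bij I J) :
  tact k (bij_comp t s) = (tact k t \o tact k s)%VF.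
Proof. by apply: tpow_hom_eq => F _; rewrite comp_lfunE !tactE act_raw_comp. Qed.

Definition Tpow (k : nat) : smod :=
  @SMod (fun I => tpow I k) (tact k) (tact_id k) (@tact_comp k).

Definition PreLie : smod := Tpow 1.



Lemma is_forest_perm (I : finType) k (f : {ffun I -> option I}) (r r' : k.-tuple I) :
  perm_eq r r' -> is_forest (f, r) -> is_forest (f, r').
Proof.
move=> rr' /and3P[u n c]; apply/and3P; split; first by rewrite -(perm_uniq rr').
  by apply/forallP => x; rewrite -(perm_mem rr'); have /forallP/(_ x) := n.
apply/forallP => x; have /forallP/(_ x)/existsP[a /andP[ar ca]] := c.
by apply/existsP; exists a; rewrite -(perm_mem rr') ca andbT.
Qed.

Lemma swap_forest I k (i j : 'I_k) (F : raw_forest I k) :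
  is_forest F -> is_forest (swap_raw i j F).
Proof.
case: F => f r; apply: is_forest_perm; rewrite perm_sym; apply/tuple_permP.
by exists (tperm i j).
Qed.

Lemma swapE I k (i j : 'I_k) (F : raw_forest I k) :
  swap i j (bas F) = bas (swap_raw i j F).
Proof.
have sK : involutive (@swap_raw I k i j).
  case=> f r; congr (_, _); apply: eq_from_tnth => l.
  by rewrite !tnth_mktuple tpermK.
have [iF|nF] := boolP (is_forest F); first by rewrite /swap tpow_extE.
rewrite (bas_out nF) linear0 bas_out //; apply: contra nF => /(swap_forest i j).
by rewrite sK.
Qed.

Lemma swap_mor k (i j : 'I_k) : is_mor (fun I => swap i j : 'Hom(Tpow k I, Tpow k I)).
Proof.
move=> I J s; apply: tpow_hom_eq => F _.
rewrite !comp_lfunE /= tactE !swapE tactE; congr (bas (_, _)).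
by apply: eq_from_tnth => l; rewrite !(tnth_map, tnth_ord_tuple).
Qed.

Lemma asym_stable k : @stable (Tpow k) (fun I => asym I k).
Proof.
move=> I J s; rewrite limg_sum; apply/subv_sumP => i _.
rewrite limg_sum; apply/subv_sumP => j ij.
apply: (subv_trans _ (sumv_sup i _ (sumv_sup j ij _))) => //.
rewrite -limg_comp comp_lfunDr comp_lfun1r -swap_mor.
by rewrite -[X in (_ + X)%R]comp_lfun1l -comp_lfunDl limg_comp limgS ?subvf.
Qed.

Definition Lam (k : nat) : smod := quo_smod (@asym_stable k).

Lemma swap_asym I k (i j : 'I_k) (F : raw_forest I k) :
  i != j -> bas (swap_raw i j F) + bas F \in asym I k.
Proof.
move=> ij; rewrite -swapE.
have -> : swap i j (bas F) + bas F = (swap i j + \1%VF) (bas F).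
  by rewrite add_lfunE id_lfunE.
suff sub : (limg (swap i j + \1%VF)%R <= asym I k)%VS.
  by rewrite (subvP sub) // memv_img ?memvf.
by apply: (sumv_sup i) => //; apply: (sumv_sup j).
Qed.

Lemma asym_le I k (V : vectType rat) (f : 'Hom(tpow I k, V)) (U : {vspace V}) :
  (forall F i j, is_forest F -> i != j -> f (bas (swap_raw i j F)) + f (bas F) \in U) ->
  (f @: asym I k <= U)%VS.
Proof.
move=> fU; rewrite limg_sum; apply/subv_sumP => i _.
rewrite limg_sum; apply/subv_sumP => j ij; rewrite -limg_comp.
apply/subvP => _ /memv_imgP[x _ ->]; rewrite (tpow_dec x) linear_sum memv_suml //= => F _.
rewrite linearZ memvZ //= comp_lfunE add_lfunE id_lfunE linearD swapE.
exact: fU (valP F) ij.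
Qed.

Section Equivariance.
Variables (I J : finType) (s : bij I J).

Lemma tri_at_act k (f : {ffun I -> option I}) (r t : I) (rest : k.-tuple I) :
  tact _ s (tri_at f r t rest) =
  tri_at (act_raw s (f, rest)).1 (s r) (s t) (map_tuple s rest).
Proof.
rewrite /tri_at linear_sum (reindex (bfun s)) /=; last first.
  by exists (binv s) => x _; rewrite ?bfunK ?binvK.
apply: eq_big => [v|v _]; first by rewrite (connect_act s (f, rest)).
rewrite tactE; congr (bas (_, _)); last by apply: val_inj.
apply/ffunP => x; rewrite !ffunE /= -(inj_eq (@bij_inj _ _ s)) binvK.
by case: eqP.
Qed.

End Equivariance.

Lemma tpow_mor k l (g : forall I, raw_forest I k -> tpow I l) :
  (forall I J (s : bij I J) F, g J (act_raw s F) = tact l s (g I F)) ->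
  @is_mor (Tpow k) (Tpow l) (fun I => tpow_ext (g I)).
Proof.
move=> gs I J s; apply: tpow_hom_eq => F iF.
by rewrite !comp_lfunE /= tactE !tpow_extE ?gs //; apply: is_forest_act.
Qed.

Lemma lie_at_act I J (s : bij I J) k (f : {ffun I -> option I}) (r t : I)
    (rest : k.-tuple I) :
  tact _ s (lie_at f r t rest) =
  lie_at (act_raw s (f, rest)).1 (s r) (s t) (map_tuple s rest).
Proof. by rewrite /lie_at linearB /= !tri_at_act. Qed.

Lemma tri_mor : @is_mor (Tpow 2) (Tpow 1) tri.
Proof.
apply: tpow_mor => I J s F; rewrite tri_at_act !tnth_map.
by congr tri_at; apply: val_inj.
Qed.

Lemma d2_mor : @is_mor (Tpow 2) (Tpow 1) d2.
Proof.
apply: tpow_mor => I J s F; rewrite lie_at_act !tnth_map.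
by congr lie_at; apply: val_inj.
Qed.

Lemma d3_mor : @is_mor (Tpow 3) (Tpow 2) d3.
Proof.
apply: tpow_mor => I J s F; rewrite linearB linearD /= !lie_at_act !tnth_map.
by congr (_ + _ - _); congr lie_at; apply: val_inj.
Qed.

Lemma lie_atC (I : finType) k (f : {ffun I -> option I}) (r t : I) (rest : k.-tuple I) :
  lie_at f r t rest = - lie_at f t r rest.
Proof. by rewrite /lie_at opprB. Qed.

Lemma tnth_swap I k (i j l : 'I_k) (F : raw_forest I k) :
  tnth (swap_raw i j F).2 l =
  tnth F.2 (if l == i then j else if l == j then i else l).
Proof. by rewrite tnth_mktuple permE. Qed.

Lemma d2_asym I : (d2 I @: asym I 2 <= 0)%VS.
Proof.
apply: asym_le => F i j iF ij; rewrite memv0 /d2 !tpow_extE ?swap_forest //.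
rewrite !tnth_swap lie_atC; have [x0] : inhabited I by split; exact: tnth F.2 0.
case: i j ij => [[|[|//]] ?] [[|[|//]] ?] //= _;
  by rewrite !(tnth_nth x0) /= addNr.
Qed.

Lemma d3_asym I : (d3 I @: asym I 3 <= 0)%VS.
Proof.
apply: asym_le => F i j iF ij; rewrite memv0 /d3 !tpow_extE ?swap_forest //=.
rewrite !tnth_swap; have [x0] : inhabited I by split; exact: tnth F.2 0.
have e1 : (1 %% 3 = 1)%N by []; have e2 : ((1 + 1) %% 3 = 2)%N by [].
case: i j ij => [[|[|[|//]]] ?] [[|[|[|//]]] ?] //= _;
  rewrite !(tnth_nth x0) /= !e1 e2.
all: move: (nth x0 F.2 0) (nth x0 F.2 1) (nth x0 F.2 2) => r s t.
all: rewrite ?(lie_atC _ s r) ?(lie_atC _ t r) ?(lie_atC _ t s).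
all: move: (lie_at _ r s _) (lie_at _ r t _) (lie_at _ s t _) => X Y Z.
all: by apply/eqP/ffunP => U; rewrite !ffunE; ring.
Qed.

Section Jacobi.
Variable I : finType.
Implicit Types (f : {ffun I -> option I}) (r s t u v w x : I).

Lemma root_uniq f a b x :
  f a = None -> f b = None -> connect (edge f) x a -> connect (edge f) x b ->
  a = b.
Proof.
move=> fa fb /connectP[p pp pa] /connectP[q pq qb].
elim: p x q pp pa pq qb => [|y p IHp] x [|z q] //=.
- by move=> _ <- _ ->.
- by move=> _ <-; rewrite {1}/edge /= fa.
- by move=> /andP[xy _] _ _ bx; rewrite -bx /edge /= fb in xy.
case/andP=> /eqP xy pp pa /andP[/eqP xz pq] qb.
by apply: (IHp y q) => //; move: xz pq qb; rewrite xy => -[<-].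
Qed.

Lemma graft_sub f s v x t : f s = None ->
  connect (edge f) x t -> connect (edge (graft f s v)) x t.
Proof.
move=> fs; apply: (@connect_homo _ _ _ _ id) => {}x y.
by rewrite /edge /= ffunE; case: (x =P s) => // ->; rewrite fs.
Qed.

Section Graft.
Variables (k : nat) (f : {ffun I -> option I}) (r s : I) (rest : k.-tuple I).
Hypothesis fF : is_forest (f, [tuple of r :: s :: rest]).
Variable v : I.
Hypothesis vr : connect (edge f) v r.

Lemma forest_root x : (f x == None) = (x \in r :: s :: rest).
Proof. by case/and3P: fF => _ /forallP/(_ x)/eqP. Qed.

Lemma forest_conn x :
  exists2 u, u \in r :: s :: rest & connect (edge f) x u.
Proof.
by case/and3P: fF => _ _ /forallP/(_ x)/existsP[u /andP[? ?]]; exists u.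
Qed.

Lemma rs_neq : r != s.
Proof. by case/and3P: fF => /= /andP[]; rewrite inE negb_or => /andP[]. Qed.

Lemma graft_root x : (graft f s v x == None) = (x \in r :: rest).
Proof.
rewrite ffunE; case: (x =P s) => [->|/eqP/negPf xs]; last first.
  by rewrite forest_root !inE xs.
case/and3P: fF => /= /and3P[]; rewrite !inE negb_or => /andP[rs _] sr _ _ _.
by rewrite [s == r]eq_sym (negPf rs) (negPf sr).
Qed.

Lemma graft_conn_s x : connect (edge f) x s -> connect (edge (graft f s v)) x r.
Proof.
have fs : f s = None by apply/eqP; rewrite forest_root !inE eqxx orbT.
move=> xs; apply: (connect_trans (graft_sub v fs xs)).
apply: (connect_trans _ (graft_sub v fs vr)).
by apply: connect1; rewrite /edge /= ffunE eqxx.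
Qed.

Lemma graft_forest : is_forest (graft f s v, [tuple of r :: rest]).
Proof.
have fs : f s = None by apply/eqP; rewrite forest_root !inE eqxx orbT.
apply/and3P; split.
- case/and3P: fF => /= /and3P[]; rewrite inE negb_or => /andP[_ rr] _ ur _ _.
  by rewrite rr.
- by apply/forallP => x; rewrite graft_root.
apply/forallP => x; have [u uF xu] := forest_conn x; apply/existsP.
have [us|us] := eqVneq u s.
  by exists r; rewrite /= inE eqxx graft_conn_s -?us.
exists u; rewrite graft_sub // andbT; move: uF.
by rewrite /= !inE (negPf us).
Qed.

Lemma graft_conn x t : t \in r :: rest ->
  connect (edge (graft f s v)) x t =
  connect (edge f) x t || (t == r) && connect (edge f) x s.
Proof.
have fs : f s = None by apply/eqP; rewrite forest_root !inE eqxx orbT.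
move=> tr; apply/idP/idP; last first.
  by case/orP => [|/andP[/eqP ->]]; [apply: graft_sub | apply: graft_conn_s].
have gt : graft f s v t = None by apply/eqP; rewrite graft_root.
have gr : graft f s v r = None by apply/eqP; rewrite graft_root inE eqxx.
move=> xt; have [u uF xu] := forest_conn x.
have [us|us] := eqVneq u s.
  rewrite us in xu; rewrite (root_uniq gt gr xt (graft_conn_s xu)).
  by rewrite eqxx xu orbT.
suff -> : t = u by rewrite xu.
apply: (root_uniq gt _ xt (graft_sub v fs xu)).
by apply/eqP; rewrite graft_root; move: uF; rewrite !inE (negPf us).
Qed.

End Graft.

Lemma graftC f s t v w : s != t ->
  graft (graft f s v) t w = graft (graft f t w) s v.
Proof.
move=> st; apply/ffunP => x; rewrite !ffunE.
by case: (x =P t) => // ->; rewrite eq_sym (negPf st).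
Qed.

Let A f r s t : tpow I 1 :=
  \sum_(v | connect (edge f) v r) \sum_(w | connect (edge f) w r)
     bas (graft (graft f s v) t w, [tuple r]).

Let B f r s t : tpow I 1 :=
  \sum_(v | connect (edge f) v r) \sum_(w | connect (edge f) w s)
     bas (graft (graft f s v) t w, [tuple r]).

Lemma A_sym f r s t : s != t -> A f r s t = A f r t s.
Proof.
move=> st; rewrite /A exchange_big; apply: eq_bigr => v _.
by apply: eq_bigr => w _; rewrite graftC.
Qed.

Lemma d2_tri_at f r s t : is_forest (f, [tuple r; s; t]) ->
  d2 I (tri_at f r s [tuple t]) = A f r s t + B f r s t - B f t r s.
Proof.
move=> fF0; have fF : is_forest (f, [tuple of r :: s :: [tuple t]]).
  by apply: is_forest_perm fF0.
have := fF; case/and3P => /= /and3P[]; rewrite !inE negb_or.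
case/andP=> rs rt st _ rts _.
have fN u : u \in [:: r; s; t] -> f u = None.
  by move=> uF; apply/eqP; move/forallP/(_ u)/eqP: rts => /= ->.
transitivity (\sum_(v | connect (edge f) v r)
  (\sum_(w | connect (edge f) w r) bas (graft (graft f s v) t w, [tuple r])
   + \sum_(w | connect (edge f) w s) bas (graft (graft f s v) t w, [tuple r])
   - \sum_(w | connect (edge f) w t) bas (graft (graft f r w) s v, [tuple t]))).
  rewrite /tri_at linear_sum; apply: eq_bigr => v vr.
  rewrite /= /d2 tpow_extE ?(graft_forest fF vr) // !(tnth_nth r) /= /lie_at /tri_at.
  congr (_ - _); last first.
    apply: eq_big => [w|w _].
      rewrite (graft_conn fF vr) ?inE ?eqxx ?orbT //.
      by rewrite eq_sym (negPf rt) orbF.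
    by rewrite graftC 1?eq_sym //; congr (bas (_, _)); apply: val_inj.
  rewrite (bigID (fun w => connect (edge f) w r)) /=; congr (_ + _).
    apply: eq_big => [w|w _]; last by congr (bas (_, _)); apply: val_inj.
    rewrite (graft_conn fF vr) ?inE ?eqxx //=.
    by case: (connect (edge f) w r); rewrite ?andbF.
  apply: eq_big => [w|w _]; last by congr (bas (_, _)); apply: val_inj.
  rewrite (graft_conn fF vr) ?inE ?eqxx //=.
  case wr: (connect (edge f) w r); rewrite /= ?andbT ?andbF //.
  apply/esym/negP => ws; case/eqP: rs.
  by apply: (root_uniq _ _ wr ws); apply: fN; rewrite !inE eqxx ?orbT.
rewrite sumrB big_split /= /A /B; congr (_ - _).
by rewrite exchange_big.
Qed.

Lemma d2_d3 : (d2 I \o d3 I)%VF = 0.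
Proof.
apply: tpow_hom_eq => -[f R] F; rewrite zero_lfunE comp_lfunE /d3 tpow_extE //.
have [x0] : inhabited I by split; exact: tnth R 0.
have e1 : (1 %% 3 = 1)%N by []; have e2 : ((1 + 1) %% 3 = 2)%N by [].
rewrite !(tnth_nth x0) /= !e1 e2.
have RE : R = [tuple nth x0 R 0; nth x0 R 1; nth x0 R 2].
  by apply: val_inj; case: R {F} => [[|a [|b [|c [|//]]]]].
rewrite RE in F; move: F.
move: (nth x0 R 0) (nth x0 R 1) (nth x0 R 2) => r s t F.
have /and3P[/= /and3P[]] := F; rewrite !inE negb_or => /andP[rs rt] st _ _ _.
have e (a b c : I) : perm_eq [:: r; s; t] [:: a; b; c] ->
    is_forest (f, [tuple a; b; c]).
  by move=> h; apply: is_forest_perm F.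
have p1 : perm_eq [:: r; s; t] [:: s; r; t].
  by rewrite (perm_catCA [:: r] [:: s] [:: t]).
have p2 : perm_eq [:: r; s; t] [:: s; t; r]
  by rewrite perm_sym (perm_catC [:: s; t] [:: r]).
have p3 : perm_eq [:: r; s; t] [:: t; r; s] by rewrite (perm_catC [:: r; s] [:: t]).
have p4 : perm_eq [:: r; s; t] [:: r; t; s]
  by rewrite perm_cons (perm_catC [:: s] [:: t]).
have p5 : perm_eq [:: r; s; t] [:: t; s; r].
  by apply: (perm_trans p3); rewrite perm_cons (perm_catC [:: r] [:: s]).
rewrite !(linearB, linearD) /= !d2_tri_at ?e //.
rewrite (A_sym _ s rt) (A_sym _ r st) (A_sym _ t rs).
move: (A _ _ _ _) (A _ _ _ _) (A _ _ _ _) => A1 A2 A3.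
move: (B f r s t) (B f s t r) (B f t r s) (B f s r t) (B f r t s) (B f t s r).
by move=> B1 B2 B3 B4 B5 B6; apply/ffunP => U; rewrite !ffunE; ring.
Qed.

End Jacobi.

Definition delta2 : smap (Lam 2) PreLie :=
  fun I => qlift (asym I 2) (d2 I).

Definition delta3 : smap (Lam 3) (Lam 2) :=
  fun I => qmap (asym I 3) (asym I 2) (d3 I).

Lemma delta2E I x : delta2 I (qproj (asym I 2) x) = d2 I x.
Proof. by rewrite /delta2 qliftE ?d2_asym. Qed.

Lemma delta3E I x :
  delta3 I (qproj (asym I 3) x) = qproj (asym I 2) (d3 I x).
Proof. by rewrite /delta3 qmapE // (subv_trans (d3_asym I)) ?sub0v. Qed.

Lemma quo_homP (V U : vectType rat) (W : {vspace V}) (f g : 'Hom(quo W, U)) :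
  (forall v, f (qproj W v) = g (qproj W v)) -> f = g.
Proof. by move=> fg; apply/lfunP => x; rewrite -[x]qsecK fg. Qed.

Lemma quo_actE (P : smod) (U : forall I, {vspace P I}) (Us : stable U)
    I J (s : bij I J) v :
  sact (quo_smod Us) s (qproj (U I) v) = qproj (U J) (sact P s v).
Proof. by rewrite /= /quo_act qmapE ?Us. Qed.

Lemma qlift_mor (P Q : smod) (U : forall I, {vspace P I}) (Us : stable U)
    (f : smap P Q) :
  is_mor f -> (forall I, (f I @: U I <= 0)%VS) ->
  @is_mor (quo_smod Us) Q (fun I => qlift (U I) (f I)).
Proof.
move=> fm f0 I J s; apply: quo_homP => v.
apply: etrans (comp_lfunE _ (sact (quo_smod Us) s) _) _.
apply: esym; apply: etrans (comp_lfunE _ _ _) _.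
by rewrite quo_actE !qliftE // -!comp_lfunE fm.
Qed.

Lemma delta2_mor : is_mor delta2.
Proof. exact: qlift_mor d2_mor d2_asym. Qed.

Lemma delta3_mor : is_mor delta3.
Proof.
move=> I J s; apply: quo_homP => v.
apply: etrans (comp_lfunE _ (sact (Lam 3) s) _) _.
apply: esym; apply: etrans (comp_lfunE _ _ _) _.
rewrite delta3E !quo_actE delta3E; apply: esym; congr (qproj _ _).
by have /lfunP/(_ v) := d3_mor s; rewrite !comp_lfunE.
Qed.

Lemma delta2_delta3 I : (delta2 I \o delta3 I)%VF = 0.
Proof.
apply: quo_homP => v; apply: etrans (comp_lfunE _ _ _) _.
by rewrite delta3E delta2E -comp_lfunE d2_d3 !zero_lfunE.
Qed.

Definition Rela : smod := quo_smod (limg_stable delta3_mor).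

Definition deltaR : smap Rela PreLie :=
  fun I => qlift (limg (delta3 I)) (delta2 I).

Lemma delta2_limg I : (delta2 I @: limg (delta3 I) <= 0)%VS.
Proof. by rewrite -limg_comp delta2_delta3 lim0g. Qed.

Lemma deltaR_mor : is_mor deltaR.
Proof. exact: qlift_mor delta2_mor delta2_limg. Qed.

Definition Indec : smod := quo_smod (limg_stable delta2_mor).

Definition pi_indec : smap PreLie Indec := fun I => qproj (limg (delta2 I)).

Definition root_valence I (T : raw_forest I 1) : nat :=
  #|[set x | T.1 x == Some (thead T.2)]|.

Definition v1 I : {vspace PreLie I} :=
  (\sum_(T : forest I 1 | root_valence (val T) == 1%N) <[bas (val T)]>)%VS.

Lemma root_valence_act I J (s : bij I J) (T : raw_forest I 1) :
  root_valence (act_raw s T) = root_valence T.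
Proof.
rewrite /root_valence -(card_imset _ (@bij_inj _ _ s)).
apply: eq_card => y; rewrite -[y](binvK s) mem_imset; last exact: bij_inj.
rewrite !inE -[X in Some X](_ : s (thead T.2) = _); last first.
  by rewrite /thead tnth_map.
exact: (edge_act s T).
Qed.

Lemma v1_stable : stable v1.
Proof.
move=> I J s; rewrite limg_sum; apply/subv_sumP => T T1.
rewrite limg_line /= tactE.
apply: (sumv_sup (Sub (act_raw s (val T)) (is_forest_act s (valP T)))) => //=.
by rewrite root_valence_act.
Qed.

Definition PreLie_v1 : smod := sub_smod v1_stable.

Definition Rela_v1 : smod := sub_smod (lpreim_stable deltaR_mor v1_stable).

Definition Indec_ge2_sub I : {vspace Indec I} :=
  if (2 <= #|I|)%N then fullv else 0%VS.

Lemma Indec_ge2_stable : stable Indec_ge2_sub.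
Proof.
move=> I J s; rewrite /Indec_ge2_sub.
rewrite (bij_eq_card (Bijective (bfunK s) (binvK s))).
by case: ifP => _; [apply: subvf | rewrite limg0 sub0v].
Qed.

Definition Indec_ge2 : smod := sub_smod Indec_ge2_stable.

Definition delta_v1 : smap Rela_v1 PreLie_v1 :=
  fun I => restr (deltaR I @^-1: v1 I) (v1 I) (deltaR I).

Definition pi_v1 : smap PreLie_v1 Indec_ge2 :=
  fun I => restr (v1 I) (Indec_ge2_sub I) (pi_indec I).

Lemma delta_v1E I x : vsval (delta_v1 I x) = deltaR I (vsval x).
Proof.
rewrite /delta_v1 restrE //; apply/subvP => _ /memv_imgP[y yU ->].
by rewrite memv_preim.
Qed.

Lemma pi_v1E I x : vsval (pi_v1 I x) = pi_indec I (vsval x).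
Proof.
rewrite /pi_v1 restrE // /Indec_ge2_sub; case: ltnP => [_|I1]; first exact: subvf.
suff -> : v1 I = 0%VS by rewrite limg0.
rewrite /v1 big1 // => -[T FT] /= T1; exfalso; move: T1.
have /and3P[_ /forallP rt _] := FT.
rewrite /root_valence eq_card0 // => y; rewrite !inE.
have -> : y = thead T.2 by apply: (fintype_le1P I1).
by have := rt (thead T.2); rewrite mem_tnth => /eqP/eqP ->.
Qed.

Definition insertion (I : finType) (i : I) (J : finType) : finType :=
  ({x : I | x != i} + J)%type.

Section Insertion.
Variables (I J : finType) (i : I).

(* Some (inl x) for x != i, and None for i. *)
Definition outside (x : I) : option (insertion i J) :=
  omap inl (insub x : option {x : I | x != i}).

(* The tree G on J is inserted at the vertex i of F; the new end of an edge of
   F incoming at i is given by c. *)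
Definition insert_raw k (F : raw_forest I k) (G : raw_forest J 1)
    (c : {ffun {x : I | F.1 x == Some i} -> J}) :
    raw_forest (insertion i J) k :=
  ([ffun z => match z with
     | inl x => if (insub (val x) : option {x : I | F.1 x == Some i}) is Some e
                then Some (inr (c e)) else obind outside (F.1 (val x))
     | inr j => if G.1 j is Some j' then Some (inr j')
                else obind outside (F.1 i)
     end],
   [tuple odflt (inr (thead G.2)) (outside (tnth F.2 l)) | l < k]).

Definition insert k (F : raw_forest I k) (G : raw_forest J 1) :
    tpow (insertion i J) k :=
  \sum_(c : {ffun {x : I | F.1 x == Some i} -> J}) bas (insert_raw G c).

(* The partial composition x o_i t of the right PreLie-module tpow k. *)
Definition pcomp k (t : tpow J 1) :
    'Hom(tpow I k, tpow (insertion i J) k) :=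
  tpow_ext (fun F => \sum_(G : forest J 1) t G *: insert F (val G)).

Lemma insert_swap k (a b : 'I_k) F G :
  insert (swap_raw a b F) G = swap a b (insert F G).
Proof.
rewrite /insert linear_sum; apply: eq_bigr => c _ /=.
rewrite swapE; congr (bas (_, _)).
by apply: eq_from_tnth => l; rewrite !tnth_mktuple.
Qed.

Lemma pcomp_asym k t : (pcomp k t @: asym I k <= asym (insertion i J) k)%VS.
Proof.
apply: asym_le => F a b iF ab; rewrite /pcomp !tpow_extE ?swap_forest //.
rewrite -big_split memv_suml //= => G _; rewrite -scalerDr memvZ //.
rewrite insert_swap /insert linear_sum -big_split memv_suml //= => c _.
by rewrite swapE swap_asym.
Qed.

Definition lcomp k (t : PreLie J) : 'Hom(Lam k I, Lam k (insertion i J)) :=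
  qmap (asym I k) (asym (insertion i J) k) (pcomp k t).

Lemma lcompE k t x :
  lcomp k t (qproj (asym I k) x) = qproj (asym (insertion i J) k) (pcomp k t x).
Proof. by rewrite /lcomp qmapE ?pcomp_asym. Qed.

End Insertion.

(* For one-vertex trees x, y, z, the class of x ^ (y <| z): the tree y <| z
   has root y and a single edge, from z to y. *)
Definition pair3 (I : finType) (x y z : I) : Lam 2 I :=
  qproj (asym I 2)
    (bas ([ffun u => if u == z then Some y else None], [tuple x; y])).

(* The sub-right-PreLie-module of Lam 2 generated by the relations
   <x, y <| z> = - <z, y <| x> and <x, y <| z> = <y, x <| z - z <| x>, taken on
   the vertex set {x, y, z}. *)
Inductive K_P : forall I : finType, Lam 2 I -> Prop :=
| K_rel1 (I : finType) (x y z : I) :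
    uniq [:: x; y; z] -> (forall w, w \in [:: x; y; z]) ->
    K_P (pair3 x y z + pair3 z y x)
| K_rel2 (I : finType) (x y z : I) :
    uniq [:: x; y; z] -> (forall w, w \in [:: x; y; z]) ->
    K_P (pair3 x y z - (pair3 y x z - pair3 y z x))
| K_zero (I : finType) : K_P (0 : Lam 2 I)
| K_lin (I : finType) (a : rat) (u v : Lam 2 I) :
    K_P u -> K_P v -> K_P (a *: u + v)
| K_act (I J : finType) (s : bij I J) (u : Lam 2 I) :
    K_P u -> K_P (sact (Lam 2) s u)
| K_comp (I J : finType) (i : I) (t : PreLie J) (u : Lam 2 I) :
    K_P u -> K_P (lcomp i 2 t u).

Definition K_P_sub I : {vspace Lam 2 I} := pspan (@K_P I).

Lemma K_P_subE I u : u \in K_P_sub I <-> K_P u.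
Proof.
split=> [|]; last exact: pspan_mem.
by apply: pspan_closed => [|a v w]; [apply: K_zero | apply: K_lin].
Qed.

Lemma K_P_stable : stable K_P_sub.
Proof.
move=> I J s; apply/subvP => _ /memv_imgP[u /K_P_subE uK ->].
by apply/K_P_subE; apply: K_act.
Qed.

Definition CycPreLie : smod := quo_smod K_P_stable.

(* The class <x> in CycPreLie of x in the tensor square of PreLie. *)
Definition cyc I (x : tpow I 2) : CycPreLie I :=
  qproj (K_P_sub I) (qproj (asym I 2) x).

(* a (x) s, for the one-vertex tree a and s in PreLie(I \ {a}). *)
Definition pt_raw (I : finType) (a : I) (T : raw_forest {x : I | x != a} 1) :
    raw_forest I 2 :=
  ([ffun x => obind (fun x' => omap val (T.1 x')) (insub x)],
   [tuple a; val (thead T.2)]).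

Definition pt (I : finType) (a : I) :
  'Hom(PreLie {x : I | x != a}, tpow I 2) := tpow_ext (fun T => bas (pt_raw T)).

Definition pairing (I : finType) (a : I) (s : PreLie {x : I | x != a}) :
  CycPreLie I := cyc (pt a s).

Definition Comm : smod :=
  @SMod (fun=> rat^o : vectType rat) (fun _ _ _ => \1%VF) (fun=> erefl)
    (fun I J K t s => esym (comp_lfun1l _)).

Definition point (I : finType) (i : I) : {ffun I -> rat^o} :=
  [ffun j => (j == i)%:R].

Lemma linext_point (I : finType) (V : vectType rat) (g : I -> V) i :
  linext g (point i) = g i.
Proof.
rewrite linextE (bigD1 i) //= big1 => [|j ji].
  by rewrite addr0 ffunE eqxx scale1r.
by rewrite ffunE (negPf ji) scale0r.
Qed.

Lemma point_dec (I : finType) (x : {ffun I -> rat^o}) :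
  x = \sum_i x i *: point i.
Proof.
apply/ffunP => j; rewrite sum_ffunE (bigD1 j) //= big1 => [|i ij].
  by rewrite !ffunE eqxx addr0 [RHS]mulr1.
by rewrite !ffunE eq_sym (negPf ij) [LHS]mulr0.
Qed.

Lemma point_hom_eq (I : finType) (V : vectType rat)
    (f g : 'Hom({ffun I -> rat^o}, V)) :
  (forall i, f (point i) = g (point i)) -> f = g.
Proof.
move=> fg; apply/lfunP => x; rewrite (point_dec x) !linear_sum.
by apply: eq_bigr => i _; rewrite !linearZ /= fg.
Qed.

Definition Perm_act I J (s : bij I J) :
    'Hom({ffun I -> rat^o}, {ffun J -> rat^o}) :=
  linext (fun i => point (s i)).

Lemma Perm_act_id I : Perm_act (bij_id I) = \1%VF.
Proof. by apply: point_hom_eq => i; rewrite /Perm_act linext_point id_lfunE. Qed.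

Lemma Perm_act_comp I J K (t : bij J K) (s : bij I J) :
  Perm_act (bij_comp t s) = (Perm_act t \o Perm_act s)%VF.
Proof.
by apply: point_hom_eq => i; rewrite /Perm_act comp_lfunE !linext_point.
Qed.

Definition Perm : smod :=
  @SMod (fun I => {ffun I -> rat^o} : vectType rat) Perm_act Perm_act_id
    Perm_act_comp.

Definition comm_perm_fun (I : finType) (c : rat^o) : {ffun I -> rat^o} :=
  c *: \sum_(i : I) point i.

Lemma comm_perm_fun_linear (I : finType) : linear (@comm_perm_fun I).
Proof. by move=> a x y; rewrite /comm_perm_fun scalerDl scalerA. Qed.

HB.instance Definition _ (I : finType) :=
  GRing.isLinear.Build rat rat^o {ffun I -> rat^o} _ (@comm_perm_fun I)
    (@comm_perm_fun_linear I).

Definition comm_perm : smap Comm Perm := fun I => linfun (@comm_perm_fun I).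

Lemma comm_perm_mor : is_mor comm_perm.
Proof.
move=> I J s; apply/lfunP => c.
rewrite !comp_lfunE id_lfunE ![comm_perm _ _]lfunE /= /comm_perm_fun.
rewrite (reindex (bfun s)) /=; last first.
  by exists (binv s) => x _; rewrite ?bfunK ?binvK.
rewrite [RHS]linearZ [in RHS]linear_sum /=. congr (_ *: _).
by apply: eq_bigr => i _; rewrite /Perm_act linext_point.
Qed.

Definition Refl : smod := quo_smod (limg_stable comm_perm_mor).

Definition perm_refl : smap Perm Refl := fun I => qproj (limg (comm_perm I)).

(* t |-> \sum_i i (x) t, that is comm_perm (.) CycPreLie with the source
   Comm (.) CycPreLie identified with CycPreLie. *)
Definition iota_cyc : smap CycPreLie (odot Perm CycPreLie) :=
  fun I => \sum_(i : I) linfun (tens (point i : Perm I)).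

Lemma iota_cycE I t : iota_cyc I t = tens (comm_perm I 1) t.
Proof.
rewrite /iota_cyc sum_lfunE lfunE /= /comm_perm_fun scale1r.
rewrite (eq_bigr (fun i => tens (point i : Perm I) t)) => [|i _]; last first.
  by rewrite lfunE.
elim/big_rec2: _ => [|i x y _ ->]; first by rewrite /tens linear0 trmx0 mul0mx.
by rewrite /tens !linearD /= mulmxDl.
Qed.

Definition proj_cyc : smap (odot Perm CycPreLie) (odot Refl CycPreLie) :=
  fun I => tmap (perm_refl I) \1%VF.

Definition Gamma_type :=
  forall (I : finType) (i : I), 'Hom(CycPreLie I, PreLie {x : I | x != i}).

(* Gamma I i t is the unique s such that t = <i, s>. *)
Definition Gamma_spec (Gamma : Gamma_type) : Prop :=
  forall (I : finType) (i : I) (t : CycPreLie I) (s : PreLie {x : I | x != i}),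
    t = pairing s <-> s = Gamma I i t.

(* The linear map a (x) t |-> a <| Gamma I a t on Perm(I) (x) CycPreLie(I). *)
Definition psi_PreLie (Gamma : Gamma_type) :
    smap (odot Perm CycPreLie) PreLie :=
  fun I => tlift (fun (v : Perm I) (t : CycPreLie I) =>
    \sum_(a : I) v a *: tri I (pt a (Gamma I a t))).

Definition psi (Gamma : Gamma_type) : smap (odot Perm CycPreLie) PreLie_v1 :=
  fun I => (linfun (vsproj (v1 I)) \o psi_PreLie Gamma I)%VF.

Lemma bas_v1 (I : finType) (T : raw_forest I 1) : root_valence T = 1%N -> bas T \in v1 I.
Proof.
move=> T1; have [iT|nT] := boolP (is_forest T); last by rewrite bas_out // mem0v.
have /subvP : (<[bas T]> <= v1 I)%VS.
  by apply: (sumv_sup (Sub T iT : forest I 1)) => //=; apply/eqP.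
by apply; rewrite memv_line.
Qed.

Lemma tri_pt_v1 (I : finType) (a : I) s : tri I (pt a s) \in v1 I.
Proof.
rewrite (tpow_dec s) !linear_sum memv_suml // => T _.
rewrite !linearZ /= memvZ //= /pt tpow_extE ?(valP T) //.
have [iF|nF] := boolP (is_forest (pt_raw (val T))); last first.
  by rewrite bas_out // linear0 mem0v.
rewrite /tri tpow_extE // /tri_at memv_suml // => v.
rewrite !(tnth_nth a) /= => /connectP[p pp pa].
have na x : (pt_raw (val T)).1 x != Some a.
  rewrite ffunE; case: insub => //= x'; case: ((val T).1 x') => [[y ya]|] //=.
have -> : v = a.
  case/lastP: p pp pa => // p b; rewrite rcons_path last_rcons /edge /=.
  by case/andP=> _ + ba; rewrite -ba (negPf (na _)).
apply: bas_v1; rewrite /root_valence /=.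
apply: etrans (cards1 (val (thead (val T).2))); apply: eq_card => x.
rewrite !inE ffunE; case: (x =P _) => // _.
  by apply/eqP.
by rewrite (negPf (na _)).
Qed.

Lemma psiE Gamma (I : finType) (a : I) t :
  vsval (psi Gamma I (tens (point a : Perm I) t)) = tri I (pt a (Gamma I a t)).
Proof.
have E : psi_PreLie Gamma I (tens (point a : Perm I) t) =
    tri I (pt a (Gamma I a t)).
  rewrite /psi_PreLie tliftE => [|t' b x y|v b x y].
  - rewrite (bigD1 a) //= big1 => [|j ja]; last first.
      by rewrite ffunE (negPf ja) scale0r.
    by rewrite ffunE eqxx scale1r addr0.
  - rewrite scaler_sumr -big_split /=; apply: eq_bigr => i _.
    by rewrite !ffunE scalerDl scalerA.
  - rewrite scaler_sumr -big_split /=; apply: eq_bigr => i _.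
    by rewrite !linearP.
by rewrite /psi comp_lfunE lfunE /= E vsprojK ?tri_pt_v1.
Qed.

(* Main.v *)
(* Chevalley-Eilenberg side.  Fix a vertex o.  Modulo brackets every tree is a
   combination of trees in which a chosen vertex is a leaf, so Rela is spanned by
   the classes of pairs (x, w) with o in x and the least vertex of w a leaf of w.
   Grafting w at the end of a chain of least descendants of o injects these pairs
   into the trees in which o is not a leaf.  Comparing with the rank of delta,
   delta is injective on Rela (PreLie is a free Lie algebra) and Indec(I) has as
   dimension the number of trees in which o is a leaf.

   Cyclic side.  The relations of CycPreLie say <y <| z, s> = <y, [z, s]> and
   <y <| z, s> = <z, y <| s>.  By induction on t they give elements x_i, i in t,
   with <t, s> = <i, x_i> and t <| s = sum_i i <| x_i modulo brackets.  Hence the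
   trees of root valence 1 whose root is not o span Indec, and by the dimension
   count they form a basis: a family (x_i)_i with sum_i i <| x_i a sum of brackets
   is determined by any x_o.  Attaching to <t, s> the family of its x_i is
   therefore compatible with the relations, which gives the existence and
   uniqueness of Gamma; that the family of a class is a sum of brackets, and that
   all such families arise, gives rho and mu. *)

Require Import Defs.
From mathcomp Require Import all_boot all_order all_fingroup all_algebra.
From mathcomp Require Import boolp ring zify.

Set Implicit Arguments.
Unset Strict Implicit.
Unset Printing Implicit Defensive.

Import GRing.Theory VectorInternalTheory.
Local Open Scope ring_scope.

(** * Parent functions and forests *)

(** No count is known as an equality beforehand: each comparison is proved in one direction only, by
    a spanning set or by an injection, and the inequalities close up. The same holds for the planted
    trees (root valence 1, root other than o): they span modulo brackets, and it is enough to know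
    that they are at most as many as the trees in which o is a leaf.

    On the cyclic side, K_P is generated under insertion, so a linear map cannot be tested on its
    three-vertex generators. It is replaced by [Krel], spanned by the antisymmetry and by the two
    relations for arbitrary trees x, y, z. Insertion carries these to relations of the same kind,
    and conversely each of them arises from a smaller one by inserting a contracted tree.

    A family (x_i) is handled as the single vector sum of the i <| x_i, and projections onto the
    trees with root in a set A read off its members. Such a projection does not send brackets to
    brackets. Hence antisymmetry and the two relations are checked by separate vanishing arguments,
    each using a vertex at which nothing is rooted to conclude that a bracket is zero. *)

Lemma lex_lt (N a b c d : nat) :
  (a < b)%N -> (c <= N)%N -> (a * N.+1 + c < b * N.+1 + d)%N.
Proof. by move=> ab cN; have := leq_mul ab (leqnn N.+1); lia. Qed.

Definition cut (I : finType) (f : {ffun I -> option I}) (s : I) :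
    {ffun I -> option I} :=
  [ffun x => if x == s then None else f x].

Section ParentFunctions.
Variable I : finType.
Implicit Types (f : {ffun I -> option I}) (r s u v w x y : I).

Lemma connect_from_root f r x : f r = None -> connect (edge f) r x -> x = r.
Proof.
by move=> fr /connectP[[|y p] //=]; rewrite {1}/edge /= fr.
Qed.

Lemma connect_step f x y : f x = Some y -> connect (edge f) x y.
Proof. by move=> fx; apply: connect1; rewrite /edge /= fx. Qed.

Lemma connect_first f x y : connect (edge f) x y ->
  x = y \/ exists2 z, f x = Some z & connect (edge f) z y.
Proof.
case/connectP=> -[|z p] /=; first by left.
case/andP=> /eqP xz pp ->; right; exists z => //.
by apply/connectP; exists p.
Qed.

Lemma connect_last f x y : connect (edge f) x y -> x != y ->
  exists2 z, f z = Some y & connect (edge f) x z.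
Proof.
case/connectP=> p; case/lastP: p => [|p z] /=; first by move=> _ ->; rewrite eqxx.
rewrite rcons_path last_rcons => /andP[pp /eqP e] -> _.
by exists (last x p) => //; apply/connectP; exists p.
Qed.

(** Each vertex has at most one outgoing edge, so its ancestors form a chain. *)
Lemma connect_total f x u v : connect (edge f) x u -> connect (edge f) x v ->
  connect (edge f) u v || connect (edge f) v u.
Proof.
case/connectP=> p; elim: p x => [|y p IHp] x /=.
  by move=> _ -> ->.
case/andP=> /eqP xy pp pu /connect_first[<-|[z]].
  apply/orP; right; rewrite pu; apply/connectP; exists (y :: p) => //=.
  by rewrite /edge /= xy eqxx.
by rewrite xy => -[<-]; apply: IHp.
Qed.

(** A path either stays in [f] or takes the new edge at [s] and continues from [v]. As [s] is a
    root, no old edge is overwritten. *)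
Lemma connect_graft f s v x m : f s = None ->
  connect (edge (graft f s v)) x m =
  connect (edge f) x m || connect (edge f) x s && connect (edge f) v m.
Proof.
move=> fs; apply/idP/idP => [/connectP[p]|].
  elim: p x => [|y p IHp] x /=; first by move=> _ ->; rewrite connect0.
  case/andP=> /eqP; rewrite ffunE; case: (x =P s) => [-> [<-]|_ xy] pp pm.
    rewrite connect0 /=; apply/orP; right.
    by case/orP: (IHp _ pp pm) => [|/andP[]].
  have xy' := connect_step xy.
  case/orP: (IHp _ pp pm) => [ym|/andP[ys vm]].
    by rewrite (connect_trans xy' ym).
  by rewrite (connect_trans xy' ys) vm orbT.
case/orP=> [|/andP[xs vm]]; first exact: graft_sub.
apply: connect_trans (graft_sub v fs xs) _.
by apply: connect_trans (graft_sub v fs vm); apply: connect_step; rewrite ffunE eqxx.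
Qed.

Lemma graft_cut f s v : f s = Some v -> graft (cut f s) s v = f.
Proof. by move=> fs; apply/ffunP => x; rewrite !ffunE; case: eqP => [->|]. Qed.

Lemma cut_graft f s v : f s = None -> cut (graft f s v) s = f.
Proof. by move=> fs; apply/ffunP => x; rewrite !ffunE; case: eqP => [->|]. Qed.

Lemma cut_root f s : cut f s s = None.
Proof. by rewrite ffunE eqxx. Qed.

End ParentFunctions.

Section ForestTheory.
Variables (I : finType) (k : nat).
Implicit Types (f : {ffun I -> option I}) (rs : k.-tuple I) (r s u v w x y : I).

Lemma is_forestP f rs :
  reflect [/\ uniq rs, forall x, (f x == None) = (x \in rs)
            & forall x, exists2 r, r \in rs & connect (edge f) x r]
    (is_forest (f, rs)).
Proof.
apply: (iffP and3P) => -[u n c]; split=> //.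
- by move=> x; exact: (eqP (forallP n x)).
- by move=> x; have /existsP[r /andP[? ?]] := forallP c x; exists r.
- by apply/forallP => x; rewrite n eqxx.
by apply/forallP => x; have [r ? ?] := c x; apply/existsP; exists r; apply/andP.
Qed.

Variables (f : {ffun I -> option I}) (rs : k.-tuple I).
Hypothesis fF : is_forest (f, rs).

Lemma forest_rootE x : (f x == None) = (x \in rs).
Proof. by case/is_forestP: fF. Qed.

Lemma forest_None x : x \in rs -> f x = None.
Proof. by rewrite -forest_rootE => /eqP. Qed.

Lemma forest_reach x : exists2 r, r \in rs & connect (edge f) x r.
Proof. by case/is_forestP: fF. Qed.

(** Every vertex reaches a root, so induction along the parent function is well founded; the
    acyclicity of a forest follows from it. *)
Lemma forest_ind (P : I -> Prop) :
  (forall x, (forall y, f x = Some y -> P y) -> P x) -> forall x, P x.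
Proof.
move=> IH x; have [r /forest_None fr /connectP[p pp pr]] := forest_reach x.
elim: p x pp pr => [|y p IHp] x /=.
  by move=> _ rx; apply: IH => y; rewrite -rx fr.
by case/andP=> /eqP xy pp pr; apply: IH => z; rewrite xy => -[<-]; apply: IHp.
Qed.

Lemma forest_irr x : f x <> Some x.
Proof. by elim/forest_ind: x => x IH /[dup] /IH. Qed.

Lemma forest_acyclic x y :
  connect (edge f) x y -> connect (edge f) y x -> x = y.
Proof.
elim/forest_ind: x y => x IH y /connect_first[//|[z xz zy] yx].
have zx := connect_trans zy yx.
by have := IH z xz x zx (connect_step xz) => zx'; move: xz; rewrite zx' => /forest_irr.
Qed.

Lemma forest_root_uniq x r s : r \in rs -> s \in rs ->
  connect (edge f) x r -> connect (edge f) x s -> r = s.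
Proof. by move=> /forest_None fr /forest_None fs; apply: root_uniq. Qed.

Lemma root_conn r s : r \in rs -> s \in rs -> connect (edge f) r s = (r == s).
Proof.
move=> /forest_None fr _; apply/idP/eqP => [/(connect_from_root fr)-> //|->].
exact: connect0.
Qed.

Lemma conn_up x y r : r \in rs -> connect (edge f) x y ->
  connect (edge f) x r = connect (edge f) y r.
Proof.
move=> rrs xy; apply/idP/idP => [xr|]; last exact: connect_trans.
have [u urs yu] := forest_reach y.
by rewrite (forest_root_uniq rrs urs xr (connect_trans xy yu)).
Qed.

Lemma child_not_below s v : f s = Some v -> ~~ connect (edge f) v s.
Proof.
move=> sv; apply/negP => vs; have := forest_acyclic (connect_step sv) vs.
by move=> e; move: sv; rewrite -e => /forest_irr.
Qed.

End ForestTheory.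

Lemma cut_forest (I : finType) k (f : {ffun I -> option I}) (r s v : I)
    (rest : k.-tuple I) :
  is_forest (f, [tuple of r :: rest]) -> f s = Some v ->
  is_forest (cut f s, [tuple of r :: s :: rest]).
Proof.
move=> fF fs; case/is_forestP: (fF) => /= /andP[rr ur] n c.
have sN : s \notin r :: rest by rewrite -n fs.
move: (sN); rewrite inE negb_or => /andP[sr srest].
apply/is_forestP; split=> /=.
- by rewrite inE negb_or eq_sym sr rr srest ur.
- move=> x; rewrite ffunE [in RHS]inE [in RHS]inE.
  case: (x =P s) => [->|/eqP xs]; first by rewrite eqxx !orbT.
  by rewrite n inE.
move=> x; elim/(forest_ind fF): x => x IH.
have [-> |xs] := eqVneq x s; first by exists s; rewrite ?inE ?eqxx ?orbT.
case fx: (f x) => [y|].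
  have [u uF yu] := IH y fx; exists u => //; apply: connect_trans yu.
  by apply: connect_step; rewrite ffunE (negPf xs).
exists x => //; have: x \in r :: rest by rewrite -n fx.
by rewrite !inE => /orP[->|->]; rewrite ?orbT.
Qed.

Lemma forest_swap2 (I : finType) k (f : {ffun I -> option I}) (a b : I)
    (rest : k.-tuple I) :
  is_forest (f, [tuple of a :: b :: rest]) ->
  is_forest (f, [tuple of b :: a :: rest]).
Proof.
move=> fF; apply: (is_forest_perm _ fF) => /=.
exact: permEl (perm_catCA [:: a] [:: b] rest).
Qed.

Lemma forest_root12 (I : finType) k (f : {ffun I -> option I}) (a b : I)
    (rest : k.-tuple I) x :
  is_forest (f, [tuple of a :: b :: rest]) ->
  connect (edge f) x a -> ~~ connect (edge f) x b.
Proof.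
move=> fF xa; apply/negP => xb; case/is_forestP: (fF) => /= /andP[+ _] _ _.
rewrite inE negb_or => /andP[/eqP ab _]; case: ab.
by apply: (forest_root_uniq fF) xa xb; rewrite !inE eqxx ?orbT.
Qed.

(** * Generators of the pre-Lie algebra as a Lie algebra *)

Section LeafSpan.
Variables (I : finType) (k : nat) (rest : k.-tuple I) (B : {set I}) (m : I).
Variable U : {vspace tpow I k.+1}.
Implicit Types (f : {ffun I -> option I}) (a b c s v x : I).

Hypothesis mB : m \in B.

Hypothesis leafU : forall f s, is_forest (f, [tuple of s :: rest]) ->
  (forall x, connect (edge f) x s = (x \in B)) ->
  (forall x, f x != Some m) -> bas (f, [tuple of s :: rest]) \in U.

Hypothesis lieU : forall f a b, is_forest (f, [tuple of a :: b :: rest]) ->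
  (forall x, connect (edge f) x a || connect (edge f) x b = (x \in B)) ->
  lie_at f a b rest \in U.

(** If c is a child of m, cutting it shows that the tree is [T_s, T_c] + T_c <| T_s minus the trees
    in which c hangs from a vertex other than m. In T_c <| T_s, m loses the descendant c; in the
    other trees it loses a child and gains no descendant. The factors in [rest] are spectators, so
    that the lemma serves for single trees and for pairs. *)
Lemma leaf_span f s : is_forest (f, [tuple of s :: rest]) ->
  (forall x, connect (edge f) x s = (x \in B)) ->
  bas (f, [tuple of s :: rest]) \in U.
Proof.
pose desc f := [set x | connect (edge f) x m].
pose child f := [set x | f x == Some m].
(* Lexicographic induction on the numbers of descendants and of children of m; the second is at most
   #|I|, hence the base #|I|.+1. *)
have [n] := ubnP (#|desc f| * #|I|.+1 + #|child f|).
elim: n f s => // n IHn f s; rewrite ltnS => fn fF fB.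
have [/existsP[c /eqP fc]|/existsPn noc] := boolP [exists c, f c == Some m]; last first.
  exact: leafU.
pose f0 := cut f c; have f0F : is_forest (f0, [tuple of s :: c :: rest]).
  exact: cut_forest fF fc.
have f0c : f0 c = None by apply: cut_root.
have fE : f = graft f0 c m by rewrite graft_cut.
have cs : s != c by case/is_forestP: f0F => /=; rewrite !inE negb_or -andbA => /andP[].
have ms : connect (edge f0) m s.
  have := fB m; rewrite mB fE connect_graft //.
  by case: (connect (edge f0) m s); rewrite ?andbF.
have compB x : connect (edge f0) x s || connect (edge f0) x c = (x \in B).
  by rewrite -fB fE connect_graft // ms andbT.
have mc : ~~ connect (edge f0) m c by exact: forest_root12 f0F ms.
have fdesc x : connect (edge f) x m = connect (edge f0) x m || connect (edge f0) x c.
  by rewrite [in LHS]fE connect_graft // connect0 andbT.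
have bE : bas (f, [tuple of s :: rest]) = lie_at f0 s c rest
    + tri_at f0 c s rest
    - \sum_(v | connect (edge f0) v s && (v != m))
        bas (graft f0 c v, [tuple of s :: rest]).
  rewrite /lie_at subrK [tri_at f0 s c rest](bigD1 m) //= -fE addrK //.
rewrite bE memvB //; first rewrite memvD //.
- exact: lieU.
- apply: memv_suml => v vc.
  have f0F' : is_forest (f0, [tuple of c :: s :: rest]).
    exact: forest_swap2 f0F.
  have f0s : f0 s = None by apply: (forest_None f0F); rewrite inE eqxx.
  apply: IHn; last 2 first.
  + exact: graft_forest f0F' _ vc.
  + by move=> x; rewrite connect_graft // vc andbT orbC compB.
  have vm : ~~ connect (edge f0) v m.
    by apply: contraL vc => vm; apply: forest_root12 f0F (connect_trans vm ms).
  have dlt : (#|desc (graft f0 s v)| < #|desc f|)%N.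
    apply: proper_card; apply/properP; split.
      apply/subsetP => x; rewrite !inE connect_graft // (negPf vm) andbF orbF.
      by rewrite fdesc => ->.
    exists c; rewrite !inE; first exact: connect_step.
    rewrite connect_graft // (negPf vm) andbF orbF.
    by apply: contra mc => /(connect_from_root f0c) ->.
  by apply: leq_trans fn; apply: lex_lt; rewrite ?max_card.
apply: memv_suml => v /andP[vs vm].
apply: IHn; last 2 first.
- exact: graft_forest f0F _ vs.
- by move=> x; rewrite connect_graft // vs andbT compB.
apply: leq_trans fn.
have dle : (#|desc (graft f0 c v)| <= #|desc f|)%N.
  apply: subset_leq_card; apply/subsetP => x; rewrite !inE connect_graft //.
  rewrite fdesc.
  by case/orP=> [->//|/andP[->]]; rewrite orbT.
have clt : (#|child (graft f0 c v)| < #|child f|)%N.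
  apply: proper_card; apply/properP; split; last first.
    exists c; rewrite !inE ?fc //= ffunE eqxx.
    by apply: contra vm => /eqP[->].
  apply/subsetP => x; rewrite !inE !ffunE; case: (x =P c) => // _.
  by move=> /eqP[vm']; rewrite vm' eqxx in vm.
by rewrite -addnS leq_add ?leq_mul.
Qed.

End LeafSpan.

(** * The count of special pairs *)

Section LeastElement.
Variable I : finType.
Implicit Types (B : {set I}) (x y : I).

Definition least B x : bool :=
  (x \in B) && [forall y in B, enum_rank x <= enum_rank y]%N.

Lemma leastP B x :
  reflect (x \in B /\ forall y, y \in B -> (enum_rank x <= enum_rank y)%N)
    (least B x).
Proof.
apply: (iffP andP) => -[xB h]; split=> //; first by move=> y /(forall_inP h).
by apply/forall_inP.
Qed.

Lemma least_uniq B x y : least B x -> least B y -> x = y.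
Proof.
move=> /leastP[xB xm] /leastP[yB ym]; apply/enum_rank_inj/val_inj/eqP.
by rewrite eqn_leq xm // ym.
Qed.

Lemma least_ex B x : x \in B -> exists y, least B y.
Proof.
move=> xB; have [y yB ym] := arg_minnP (fun z => enum_rank z : nat) xB.
by exists y; apply/leastP.
Qed.

Definition least_of B : option I := [pick x | least B x].

Lemma least_ofP B x : least B x -> least_of B = Some x.
Proof.
rewrite /least_of => Bx; case: pickP => [y By|/(_ x)]; last by rewrite Bx.
by rewrite (least_uniq Bx By).
Qed.

Lemma least_of_None B : (least_of B == None) = (B == set0).
Proof.
rewrite /least_of; case: pickP => [y /leastP[By _]|noB].
  by apply/esym/negP => /eqP B0; rewrite B0 inE in By.
rewrite eqxx; apply/esym/eqP/setP => x; rewrite inE; apply/negP => xB.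
by have [y] := least_ex xB; rewrite noB.
Qed.

End LeastElement.

Section LeafInjection.
Variable I : finType.
Implicit Types (f t : {ffun I -> option I}) (o p q r s v x y z : I).

Definition strict_below f v : {set I} := [set x | connect (edge f) x v & x != v].

Definition component f s : {set I} := [set x | connect (edge f) x s].

(* In both recursions n is fuel, bounding the number of strict descendants. *)
Fixpoint attach_point n f q v : I :=
  if n is n'.+1 then
    if least_of (strict_below f v) is Some y then
      if (enum_rank y < enum_rank q)%N then attach_point n' f q y else v
    else v
  else v.

Fixpoint chain_end n t v : I * I :=
  if n is n'.+1 then
    if least_of (strict_below t v) is Some y then
      if strict_below t y == set0 then (v, y) else chain_end n' t y
    else (v, v)
  else (v, v).

Section Attach.
Variables (f : {ffun I -> option I}) (s r q : I).
Hypothesis fF : is_forest (f, [tuple of s :: [tuple r]]).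
Hypothesis qs : least (component f s) q.
Hypothesis q_leaf : forall x, f x != Some q.

Let fs : f s = None.
Proof. by apply: (forest_None fF); rewrite inE eqxx. Qed.

(** The chain from [v] passes each time to the least strict descendant. [attach_point] stops as soon
    as this would not precede [q]; once the tree of [s] hangs there, the next least descendant is
    [q], and the chain ends because [q] is a leaf. Both the attaching point and [q] can thus be read
    off the grafted tree. *)
Lemma chain_end_attach n v : connect (edge f) v r ->
  (#|strict_below f v| < n)%N ->
  connect (edge f) (attach_point n f q v) v /\
  chain_end n (graft f s (attach_point n f q v)) v = (attach_point n f q v, q).
Proof.
have /leastP[] := qs; rewrite inE => qcs qmin.
elim: n v => // n IHn v vr; rewrite ltnS => vn.
have below p u : connect (edge f) p u -> connect (edge f) u r ->
    strict_below (graft f s p) u = strict_below f u :|: component f s.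
  move=> pu ur; apply/setP => x; rewrite !inE connect_graft // pu andbT.
  have [->|xu] := eqVneq x u; last by rewrite !andbT.
  by rewrite !andbF; apply/esym/negbTE/(forest_root12 (forest_swap2 fF)).
(* At a stopping vertex no strict descendant precedes q, so that q is the least one after grafting
   there. *)
suff stop : (forall y, y \in strict_below f v -> enum_rank q <= enum_rank y)%N ->
    chain_end n.+1 (graft f s v) v = (v, q).
  rewrite /attach_point -/attach_point.
  case yE: (least_of (strict_below f v)) => [y|]; last first.
    rewrite connect0 stop //; move/eqP: yE; rewrite least_of_None => /eqP->.
    by move=> y; rewrite inE.
  move: yE; rewrite {1}/least_of; case: pickP => // y' yl [yE]; move: yl.
  rewrite {}yE => /leastP[yv ymin].
  case: ltnP => [yq|qy]; last first.
    by rewrite connect0 stop // => z /ymin; apply: leq_trans.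
  move: (yv); rewrite inE => /andP[cyv yNv].
  have yr := connect_trans cyv vr.
  have dlt : (#|strict_below f y| < n)%N.
    apply: leq_trans vn; apply: proper_card; apply/properP; split.
      apply/subsetP => x; rewrite !inE => /andP[xy xNy].
      rewrite (connect_trans xy cyv); apply: contraNneq xNy => xv.
      by rewrite (forest_acyclic fF xy) // xv.
    by exists y => //; rewrite inE eqxx andbF.
  have [py pE] := IHn y yr dlt; have pv := connect_trans py cyv.
  split=> //; rewrite /chain_end -/chain_end below //.
  rewrite (least_ofP (x := y)); last first.
    apply/leastP; rewrite inE yv; split=> // z; rewrite !inE.
    case/orP=> [zv|zs]; first by apply: ymin; rewrite inE.
    by apply/ltnW/(leq_trans yq)/qmin; rewrite inE.
  rewrite below // ifN; first exact: pE.
  by apply/set0Pn; exists q; rewrite !inE qcs orbT.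
move=> qv; rewrite /chain_end -/chain_end below ?connect0 //.
rewrite (least_ofP (x := q)); last first.
  apply/leastP; rewrite !inE qcs orbT; split=> // z; rewrite !inE.
  case/orP=> [zv|zs]; first by apply: qv; rewrite inE.
  by apply: qmin; rewrite inE.
rewrite ifT //; apply/eqP/setP => x; rewrite !inE connect_graft //.
apply/negP => /andP[/orP[xq|/andP[_ vq]] xNq].
  by have [z zq] := connect_last xq xNq; have := q_leaf z; rewrite zq eqxx.
have := forest_root12 fF (connect_trans vq qcs).
by rewrite vr.
Qed.

End Attach.

Variable o : I.

(** The tree containing o is the second factor, the tree whose least vertex is a leaf the first
    one. *)
Definition special (F : raw_forest I 2) : bool :=
  connect (edge F.1) o (tnth F.2 1)
  && [forall q, least (component F.1 (tnth F.2 0)) q ==>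
       [forall x, F.1 x != Some q]].

Definition leaf_at (T : raw_forest I 1) : bool := [forall x, T.1 x != Some o].

Lemma pair_tuple (r : 2.-tuple I) : r = [tuple tnth r 0; tnth r 1].
Proof.
by apply: eq_from_tnth => -[[|[|//]] ?]; rewrite (tnth_nth o) [RHS](tnth_nth o) /=
  (tnth_nth o).
Qed.

(** The pair is recovered from the grafted tree: the chain from o ends at (p, q), the root s of the
    first tree is the only child of p from which q descends or which equals q, and cutting s
    restores both trees. *)
Lemma card_special :
  (#|[set F : forest I 2 | special (val F)]| <=
   #|[set T : forest I 1 | ~~ leaf_at (val T)]|)%N.
Proof.
pose lq (F : raw_forest I 2) : I := odflt o (least_of (component F.1 (tnth F.2 0))).
pose ap (F : raw_forest I 2) : I := attach_point #|I|.+1 F.1 (lq F) o.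
pose h (F : forest I 2) : option (forest I 1) :=
  insub (graft (val F).1 (tnth (val F).2 0) (ap (val F)), [tuple tnth (val F).2 1]).
have hP (F : forest I 2) : special (val F) -> let: (f, R) := val F in
    exists q, let: p := ap (val F) in let: s := tnth R 0 in let: r := tnth R 1 in
    [/\ is_forest (f, [tuple of s :: [tuple r]]), connect (edge f) q s,
        connect (edge f) p o, connect (edge f) o r
      & chain_end #|I|.+1 (graft f s p) o = (p, q)].
  case: F => -[f R] /= FF /andP[/= or /forallP qleaf].
  have [q ql] : exists q, least (component f (tnth R 0)) q.
    by apply: (@least_ex _ _ (tnth R 0)); rewrite inE connect0.
  have FF' : is_forest (f, [tuple of tnth R 0 :: [tuple tnth R 1]]).
    by rewrite (pair_tuple R) in FF.
  have lqE : lq (f, R) = q by rewrite /lq /= (least_ofP ql).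
  exists q; rewrite /ap lqE /=.
  have ql' x : f x != Some q by apply/(forallP (implyP (qleaf q) ql)).
  have dlt : (#|strict_below f o| < #|I|.+1)%N by rewrite ltnS max_card.

  have [po pE] := chain_end_attach FF' ql ql' or dlt.
  split=> //; by have /leastP[] := ql; rewrite inE.
have tF (F : forest I 2) : special (val F) -> is_forest (graft (val F).1 (tnth (val F).2 0)
    (ap (val F)), [tuple of tnth (val F).2 1 :: [tuple]]).
  move=> sF; have := hP F sF; case: F {sF} => -[f R] FF /= [q [FF' _ po or _]].
  apply: graft_forest (forest_swap2 FF') _ _.
  exact: connect_trans po or.
have hinj : {in [set F : forest I 2 | special (val F)] &, injective h}.
  move=> F G; rewrite !inE => sF sG; rewrite /h.
  rewrite (insubT _ (tF F sF)) (insubT _ (tF G sG)).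
  move=> [tE rE]; move: (hP _ sF) (hP _ sG) => {}hF {}hG.
  case: F sF hF tE rE => -[f R] /= FF sF [q [FF' qs _ _ cE]].
  case: G sG hG => -[g S] /= GF _ [q' [GF' qs' _ _ cE']] tE rE.
  have RS : tnth R 1 = tnth S 1 by [].
  move: cE cE'; rewrite -tE => -> [pp' qq'].
  have fsN : f (tnth R 0) = None by apply: (forest_None FF'); rewrite inE eqxx.
  have gsN : g (tnth S 0) = None by apply: (forest_None GF'); rewrite inE eqxx.
  have qs1 := graft_sub (ap (f, R)) fsN qs.
  have qs2 := graft_sub (ap (g, S)) gsN qs'.
  have ts1 : graft f (tnth R 0) (ap (f, R)) (tnth R 0) = Some (ap (f, R)).
    by rewrite ffunE eqxx.
  have ts2 : graft f (tnth R 0) (ap (f, R)) (tnth S 0) = Some (ap (f, R)).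
    by rewrite tE ffunE eqxx pp'.
  have TF : is_forest (graft f (tnth R 0) (ap (f, R)), [tuple of tnth R 1 :: [tuple]]).
    by apply: tF (exist _ (f, R) FF) sF.
  (* Both roots are children of p and ancestors of q, hence comparable; comparable children of one
     vertex coincide by acyclicity. *)
  have ss : tnth R 0 = tnth S 0.
    rewrite -tE -qq' in qs2.
    case/orP: (connect_total qs1 qs2) => /connect_first[//|[z]].
    - by rewrite ts1 => -[<-]; rewrite (negPf (child_not_below TF ts2)).
    - by rewrite ts2 => -[<-]; rewrite (negPf (child_not_below TF ts1)).
  apply: val_inj => /=; congr (_, _); last by rewrite (pair_tuple R) (pair_tuple S) ss RS.
  by rewrite -(cut_graft (ap (f, R)) fsN) tE ss cut_graft.
have sub : h @: [set F : forest I 2 | special (val F)]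
    \subset Some @: [set T : forest I 1 | ~~ leaf_at (val T)].
  apply/subsetP => y /imsetP[F]; rewrite inE => sF -> {y}.
  rewrite /h insubT; first exact: tF.
  move=> TF; apply: imset_f; rewrite inE SubK /leaf_at /=.
  apply/forallPn; have := hP F sF; case: F {sF TF} => -[f R] FF /= [q [FF' _ po or _]].
  have fsN : f (tnth R 0) = None by apply: (forest_None FF'); rewrite inE eqxx.
  have [poE|po'] := eqVneq (ap (f, R)) o.
    by exists (tnth R 0); rewrite negbK ffunE eqxx poE.
  have [z zo _] := connect_last po po'; exists z; rewrite negbK ffunE.
  by have [e|_] := eqVneq z (tnth R 0); [rewrite e fsN in zo | rewrite zo].
rewrite -(card_in_imset hinj); apply: leq_trans (subset_leq_card sub) _.
by rewrite card_imset //; apply: Some_inj.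
Qed.

End LeafInjection.

(** * Freeness of PreLie as a Lie algebra *)

Section BasisSpan.
Variables (I : finType) (k : nat).

Lemma dim_tpow : dim (tpow I k) = #|forest I k|.
Proof. exact: muln1. Qed.

Definition basis_span (P : pred (raw_forest I k)) : {vspace tpow I k} :=
  (\sum_(F : forest I k | P (val F)) <[bas (val F)]>)%VS.

Lemma basE (F : raw_forest I k) (G : forest I k) : bas F G = (val G == F)%:R.
Proof. by rewrite ffunE. Qed.

Lemma memv_basis_span P (v : tpow I k) :
  reflect (forall F : forest I k, ~~ P (val F) -> v F = 0) (v \in basis_span P).
Proof.
apply: (iffP idP) => [|v0].
  case/memv_sumP => vs vsP -> F PF; rewrite sum_ffunE big1 // => G PG.
  have /vlineP[a ->] := vsP G PG; rewrite ffunE basE.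
  case: eqP => [/val_inj FG|_]; first by rewrite -FG (negPf PF) in PG.
  by rewrite scaler0.
rewrite (tpow_dec v) memv_suml // => F _.
have [PF|/v0->] := boolP (P (val F)); last by rewrite scale0r mem0v.
by rewrite memvZ // (subvP (sumv_sup F _ (subvv _))) ?memv_line.
Qed.

Lemma bas_basis_span (P : pred (raw_forest I k)) F : is_forest F -> P F -> bas F \in basis_span P.
Proof.
move=> iF PF; apply/memv_basis_span => G; rewrite basE; case: eqP => [->|//].
by rewrite PF.
Qed.

Lemma dim_basis_span P :
  (\dim (basis_span P) <= #|[set F : forest I k | P (val F)]|)%N.
Proof.
apply: (leq_trans (dimv_leq_sum _ _ _)); rewrite -sum1dep_card.
by apply: leq_sum => F _; rewrite dim_vline leq_b1.
Qed.

End BasisSpan.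

(** A nonempty list of roots needs a vertex, so the space is zero over the empty set and a vertex
    may be assumed. *)
Lemma tpow_inhab (I : finType) k (x : tpow I k.+1) : (I -> x = 0) -> x = 0.
Proof.
move=> x0; apply/ffunP => -[[f r] iF]; rewrite x0 //.
exact: (thead r).
Qed.

Lemma asym_pair (I : finType) (f : {ffun I -> option I}) (a b : I) :
  bas (f, [tuple of a :: [tuple b]]) + bas (f, [tuple of b :: [tuple a]])
    \in asym I 2.
Proof.
have := @swap_asym I 2 0 1 (f, [tuple of b :: [tuple a]]) isT.
suff -> : swap_raw 0 1 (f, [tuple of b :: [tuple a]])
  = (f, [tuple of a :: [tuple b]]) by [].
congr (_, _); apply: eq_from_tnth => -[[|[|//]] ?];
  by rewrite tnth_mktuple !(tnth_nth a) permE.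
Qed.

Section RelaSpan.
Variables (I : finType) (o : I).

Definition special_span : {vspace tpow I 2} :=
  (asym I 2 + limg (d3 I) + basis_span (special o))%VS.

Let Z := special_span.

Let asymZ : (asym I 2 <= Z)%VS.
Proof. by rewrite /Z /special_span -addvA addvSl. Qed.

Let d3Z : (limg (d3 I) <= Z)%VS.
Proof. exact: subv_trans (addvSr _ _) (addvSl _ _). Qed.

Let specialZ : (basis_span (special o) <= Z)%VS.
Proof. exact: addvSr. Qed.

Lemma swapZ (f : {ffun I -> option I}) a b :
  bas (f, [tuple of a :: [tuple b]]) \in Z ->
  bas (f, [tuple of b :: [tuple a]]) \in Z.
Proof.
move=> abZ; rewrite -[bas _](addKr (bas (f, [tuple of a :: [tuple b]]))).
by rewrite memvD ?memvN // (subvP asymZ) ?asym_pair.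
Qed.

Lemma tnth_triple (a b c : I) :
  [/\ tnth [tuple of a :: [tuple of b :: [tuple c]]] 0 = a,
      tnth [tuple of a :: [tuple of b :: [tuple c]]] 1 = b &
      tnth [tuple of a :: [tuple of b :: [tuple c]]] 2%:R = c].
Proof. by rewrite !(tnth_nth a). Qed.

Lemma d3_bas (f : {ffun I -> option I}) (a b c : I) :
  is_forest (f, [tuple of a :: [tuple of b :: [tuple c]]]) ->
  d3 I (bas (f, [tuple of a :: [tuple of b :: [tuple c]]])) =
  lie_at f a b [tuple c] + lie_at f b c [tuple a] - lie_at f a c [tuple b].
Proof.
by move=> fF; rewrite /d3 tpow_extE //; have [-> -> ->] := tnth_triple a b c.
Qed.

(** Induction on the size of the first tree. [leaf_span], with T_r as spectator, leaves [T_a, T_b]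
    (x) T_r; modulo the image of d3 and antisymmetry this becomes pairs whose first tree is T_a or
    T_b, both smaller, and whose second factor is a bracket with T_r, hence still contains o. *)
Lemma special_span_pair n (f : {ffun I -> option I}) s r :
  is_forest (f, [tuple of s :: [tuple r]]) -> connect (edge f) o r ->
  (#|component f s| < n)%N -> bas (f, [tuple of s :: [tuple r]]) \in Z.
Proof.
elim: n f s r => // n IHn f s r fF or; rewrite ltnS => fn.
have [m ml] : exists m, least (component f s) m.
  by apply: (@least_ex _ _ s); rewrite inE connect0.
have oB : o \notin component f s.
  by rewrite inE; apply: forest_root12 (forest_swap2 fF) or.
apply: (@leaf_span _ _ [tuple r] (component f s) m Z) => //.
- by case/leastP: ml.
- move=> g t gF gB mleaf; apply: (subvP specialZ); apply: bas_basis_span => //.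
  have gE : component g t = component f s by apply/setP => x; rewrite inE.
  apply/andP; split; rewrite /= !(tnth_nth r) /=.
    have [u] := forest_reach gF o; rewrite !inE => /orP[/eqP->|/eqP-> //].
    by rewrite gB (negPf oB).
  by rewrite gE; apply/forallP => q; apply/implyP => /(least_uniq ml) <-; apply/forallP.
- move=> g a b gF gB.
  have gF' : is_forest (g, [tuple of a :: [tuple of b :: [tuple r]]]) by [].
  have gor : connect (edge g) o r.
    have := gB o; rewrite (negPf oB) => /negbT; rewrite negb_or => /andP[oa ob].
    have [u] := forest_reach gF o; rewrite !inE => /or3P[] /eqP -> //.
      by rewrite (negPf oa).
    by rewrite (negPf ob).
  (* In [T_x, T_r] (x) T_y the factors are exchanged, so that the small tree T_y comes first. *)
  have tri2 x y : is_forest (g, [tuple of x :: [tuple of y :: [tuple r]]]) ->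
     (#|component g y| < n)%N -> lie_at g x r [tuple y] \in Z.
    move=> xyF yn.
    have F1 : is_forest (g, [tuple of x :: [tuple of r :: [tuple y]]]).
      apply: is_forest_perm xyF => /=.
      by rewrite perm_cons; apply: permEl (perm_catC [:: y] [:: r]).
    have F2 := forest_swap2 F1.
    have gr : g r = None by apply: (forest_None F2); rewrite inE eqxx.
    have gx : g x = None by apply: (forest_None F1); rewrite inE eqxx.
    have yxr : (y != x) && (y != r).
      case/is_forestP: F1 => /=; rewrite !inE !negb_or => /and3P[/andP[_ xy] ry _] _ _.
      by rewrite eq_sym xy eq_sym.
    have [yx yr] := andP yxr.
    rewrite /lie_at memvB //; apply: memv_suml => v vx; apply: swapZ.
      apply: IHn; first exact: forest_swap2 (graft_forest F1 vx).
        by rewrite connect_graft // gor vx orbT.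
      apply: leq_trans yn; apply: subset_leq_card; apply/subsetP => z; rewrite !inE.
      by rewrite (graft_conn F1 vx) ?inE ?eqxx ?orbT // (negPf yx) orbF.
    apply: IHn; first exact: forest_swap2 (graft_forest F2 vx).
      by rewrite graft_sub.
    apply: leq_trans yn; apply: subset_leq_card; apply/subsetP => z; rewrite !inE.
    by rewrite (graft_conn F2 vx) ?inE ?eqxx ?orbT // (negPf yr) orbF.
  have small x y : is_forest (g, [tuple of x :: [tuple of y :: [tuple r]]]) ->
      (forall z, connect (edge g) z x || connect (edge g) z y = (z \in component f s)) ->
      (#|component g y| < n)%N.
    move=> xyF xyB; apply: leq_trans fn; apply: proper_card; apply/properP; split.
      by apply/subsetP => z; rewrite [z \in component g y]inE -xyB orbC => ->.
    exists x; first by rewrite -xyB connect0.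
    by rewrite inE; apply: forest_root12 xyF _; apply: connect0.
  have gBC x : connect (edge g) x b || connect (edge g) x a = (x \in component f s).
    by rewrite orbC.
  have gF2 : is_forest (g, [tuple of b :: [tuple of a :: [tuple r]]]).
    exact: forest_swap2 gF'.
  have -> : lie_at g a b [tuple r] =
      d3 I (bas (g, [tuple of a :: [tuple of b :: [tuple r]]]))
      - lie_at g b r [tuple a] + lie_at g a r [tuple b].
    by rewrite d3_bas // -addrA [X in _ + X]addrC addrA subrK addrK.
  apply: memvD; first apply: memvB.
  + by rewrite (subvP d3Z) // memv_img ?memvf.
  + by apply: tri2 => //; apply: small gF2 _.
  by apply: tri2 => //; apply: small gF' _.
by move=> x; rewrite inE.
Qed.

Lemma special_spanT : special_span = fullv.
Proof.
apply/vspaceP => v; rewrite memvf (tpow_dec v) memv_suml // => -[[f R] fF] _.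
rewrite memvZ //=; have := fF; rewrite (pair_tuple o R).
move: (tnth R 0) (tnth R 1) => s r {}fF.
have [u] := forest_reach fF o; rewrite !inE => /orP[] /eqP -> ou.
  by apply: swapZ; apply: special_span_pair (forest_swap2 fF) ou (ltnSn _).
exact: special_span_pair fF ou (ltnSn _).
Qed.

End RelaSpan.

Section DeltaInjective.
Variables (I : finType).

Lemma dim_Rela_le (o : I) :
  (\dim {: Rela I} <= #|[set F : forest I 2 | special o (val F)]|)%N.
Proof.
pose q : 'Hom(tpow I 2, Rela I) :=
  (qproj (limg (delta3 I)) \o qproj (asym I 2))%VF.
have qT : limg q = fullv.
  by rewrite /q limg_comp limg_qproj limg_qproj.
rewrite -qT -(special_spanT o) /special_span !limgD.
have -> : (q @: asym I 2 = 0)%VS.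
  apply/eqP; rewrite -lkerE; apply/subvP => v va.
  by rewrite memv_ker comp_lfunE (eqP (_ : qproj _ v == 0)) ?linear0 ?qproj_eq0.
have -> : (q @: limg (d3 I) = 0)%VS.
  apply/eqP; rewrite -lkerE; apply/subvP => _ /memv_imgP[v _ ->].
  by rewrite memv_ker comp_lfunE -delta3E qproj_eq0 memv_img ?memvf.
rewrite !add0v; apply: leq_trans (dim_basis_span _).
by have /= := limg_ker_dim q (basis_span (special o)); lia.
Qed.

Lemma limg_deltaR : limg (deltaR I) = limg (d2 I).
Proof.
apply/vspaceP => v; apply/memv_imgP/memv_imgP => -[x _ ->].
  exists (qsec _ (qsec _ x)); first exact: memvf.
  by rewrite -delta2E qsecK /deltaR comp_lfunE.
exists (qproj (limg (delta3 I)) (qproj (asym I 2) x)); first exact: memvf.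
by rewrite /deltaR qliftE ?delta2_limg // delta2E.
Qed.

(** By [leaf_span] for the whole vertex set and m = o, the trees in which o is a leaf span modulo
    brackets. *)
Lemma dim_limg_d2_ge (o : I) :
  (#|forest I 1| <=
   \dim (limg (d2 I)) + #|[set T : forest I 1 | leaf_at o (val T)]|)%N.
Proof.
have : (fullv <= limg (d2 I) + basis_span (leaf_at o))%VS.
  apply/subvP => v _; rewrite (tpow_dec v) memv_suml // => -[[f R] fF] _.
  rewrite memvZ //=; case/tupleP: R fF => s R; rewrite (tuple0 R) => fF.
  have allT g t : is_forest (g, [tuple of t :: [tuple]]) -> forall x, connect (edge g) x t.
    by move=> gF x; have [u] := forest_reach gF x; rewrite !inE => /eqP->.
  apply: (@leaf_span _ _ [tuple] setT o) => //.
  - move=> g t gF _ gleaf; apply: (subvP (addvSr _ _)).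
    by apply: bas_basis_span => //; apply/forallP.
  - move=> g a b gF _; apply: (subvP (addvSl _ _)).
    have -> : lie_at g a b [tuple] = d2 I (bas (g, [tuple of a :: [tuple b]])).
      by rewrite /d2 tpow_extE // !(tnth_nth a).
    by rewrite memv_img ?memvf.
  by move=> x; rewrite inE allT.
move/dimvS; rewrite dimvf dim_tpow => /leq_trans; apply.
have := dim_basis_span (leaf_at o); have := dimv_sum_cap (limg (d2 I)) (basis_span (leaf_at o)).
lia.
Qed.

(** dim Rela <= number of special pairs <= number of trees in which o is not a leaf <= rank of d2 =
    dim Rela - dim of the kernel. So the kernel is zero and all of these are equal. *)
Lemma deltaR_dims (o : I) : lker (deltaR I) = 0%VS /\
  (#|[set T : forest I 1 | leaf_at o (val T)]| + \dim (limg (d2 I)) =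
   #|forest I 1|)%N.
Proof.
have h1 := dim_Rela_le o; have h2 := card_special o.
have h3 := dim_limg_d2_ge o.
have h4 : (\dim (lker (deltaR I)) + \dim (limg (d2 I)) = \dim {: Rela I})%N.
  by rewrite -(limg_ker_dim (deltaR I) fullv) capfv limg_deltaR.
have h5 := cardsC [set T : forest I 1 | leaf_at o (val T)].
have h6 : ~: [set T : forest I 1 | leaf_at o (val T)]
    = [set T : forest I 1 | ~~ leaf_at o (val T)].
  by apply/setP => T; rewrite !inE.
rewrite h6 in h5.
have h7 : \dim (lker (deltaR I)) = 0%N by lia.
by split; [apply/eqP; rewrite -dimv_eq0 h7 | lia].
Qed.

Lemma deltaR_inj : lker (deltaR I) = 0%VS.
Proof.
have [I0|[o _]] := set_0Vmem [set: I]; last by case: (deltaR_dims o).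
have x0 (x : Rela I) : x = 0.
  rewrite -[x]qsecK -[qsec _ x]qsecK [qsec _ (qsec _ x)]tpow_inhab ?linear0 // => o.
  by move/setP/(_ o): I0; rewrite !inE.
by apply/vspaceP => x; rewrite memv_ker memv0 [x]x0 linear0 !eqxx.
Qed.

End DeltaInjective.

(** * Planted trees *)

Section ValenceOne.
Variables (I : finType) (o : I).

Definition planted (T : raw_forest I 1) : bool :=
  (root_valence T == 1%N) && (thead T.2 != o).

Definition tperm_bij (x y : I) : bij I I := Bij (tpermK x y) (tpermK x y).

Lemma tuple1E (r : 1.-tuple I) : r = [tuple of thead r :: [tuple]].
Proof. by case/tupleP: r => x r; rewrite (tuple0 r) theadE. Qed.

Lemma valence1P (f : {ffun I -> option I}) r :
  root_valence (f, [tuple of r :: [tuple]]) = 1%N ->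
  exists2 c, f c = Some r & forall x, f x = Some r -> x = c.
Proof.
move=> /eqP/cards1P[c cE]; have xc x : (f x == Some r) = (x == c).
  by have /setP/(_ x) := cE; rewrite !inE.
exists c => [|x fx]; first by apply/eqP; rewrite xc.
by apply/eqP; rewrite -xc fx.
Qed.

(* Swap the labels of the root and of o, cut the root o off its only branch and
   plant it as a leaf at the new place of the old root label. *)
Lemma card_planted :
  (#|[set T : forest I 1 | planted (val T)]| <=
   #|[set T : forest I 1 | leaf_at o (val T)]|)%N.
Proof.
pose g (T : raw_forest I 1) := (act_raw (tperm_bij (thead T.2) o) T).1.
pose ch (T : raw_forest I 1) := odflt o [pick x | g T x == Some o].
pose G (T : raw_forest I 1) : raw_forest I 1 :=
  (graft (cut (g T) (ch T)) o (thead T.2), [tuple ch T]).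
have gP (T : forest I 1) : planted (val T) ->
    [/\ act_raw (tperm_bij (thead (val T).2) o) (val T) =
          (g (val T), [tuple of o :: [tuple]]),
        g (val T) (ch (val T)) = Some o,
        forall x, cut (g (val T)) (ch (val T)) x != Some o,
        is_forest (G (val T)) & cut (g (val T)) (ch (val T)) o = None].
  case/andP=> v1T rT; set s := tperm_bij _ _.
  have aE : act_raw s (val T) = (g (val T), [tuple of o :: [tuple]]).
    rewrite [act_raw _ _]surjective_pairing /= -/s; congr (_, _).
    by apply: val_inj; rewrite /= (tuple1E (val T).2) /= tpermL.
  have aF : is_forest (g (val T), [tuple of o :: [tuple]]).
    by rewrite -aE; apply: is_forest_act (valP T).
  have aV : root_valence (g (val T), [tuple of o :: [tuple]]) = 1%N.
    by rewrite -aE root_valence_act; apply/eqP.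
  have [c gc cU] := valence1P aV.
  have chE : ch (val T) = c.
    rewrite /ch; case: pickP => [x /eqP/cU //|/(_ c)]; by rewrite gc eqxx.
  have noc x : cut (g (val T)) c x != Some o.
    rewrite ffunE; have [//|xc] := eqVneq x c.
    by apply/eqP => /cU e; rewrite e eqxx in xc.
  rewrite /G chE; split=> //.
    have cF := cut_forest aF gc; apply: (graft_forest (forest_swap2 cF)).
    have [u] := forest_reach cF (thead (val T).2); rewrite !inE => /orP[] /eqP-> //.
    move/connect_last/(_ rT) => [z zo _].
    by have := noc z; rewrite zo eqxx.
  rewrite ffunE; have [//|_] := eqVneq o c.
  by apply/eqP; rewrite (forest_rootE aF) inE.
pose h (T : forest I 1) : option (forest I 1) := insub (G (val T)).
(* The parent of o in the image is the old root label, and the new root is the child that was cut;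
   this is enough to undo the cut and the relabelling. *)
have hinj : {in [set T : forest I 1 | planted (val T)] &, injective h}.
  move=> S T; rewrite !inE => pS pT; rewrite /h.
  have [aS gS _ FS cS] := gP S pS; have [aT gT _ FT cT] := gP T pT.
  rewrite (insubT _ FS) (insubT _ FT) /= => -[tE cE]; apply: val_inj.
  have rE : thead (val S).2 = thead (val T).2.
    have := congr1 (fun u : {ffun I -> option I} => u o) tE.
    by rewrite !ffunE eqxx => -[].
  apply: (can_inj (@act_rawK _ _ (tperm_bij (thead (val S).2) o) 1)).
  rewrite aS rE aT; congr (_, _).
  rewrite -(graft_cut gS) -(graft_cut gT) cE; congr (graft _ _ _).
  by rewrite -cE -(cut_graft (thead (val S).2) cS) tE cut_graft ?cE.
have sub : h @: [set T : forest I 1 | planted (val T)]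
    \subset Some @: [set T : forest I 1 | leaf_at o (val T)].
  apply/subsetP => y /imsetP[T]; rewrite inE => pT -> {y}.
  have [_ _ noc FT _] := gP T pT.
  rewrite /h (insubT _ FT); apply: imset_f; rewrite inE SubK /leaf_at /=.
  apply/forallP => x; rewrite ffunE; have [_|//] := eqVneq x o.
  by have /andP[_] := pT; apply: contra => /eqP[->].
rewrite -(card_in_imset hinj); apply: leq_trans (subset_leq_card sub) _.
by rewrite card_imset //; apply: Some_inj.
Qed.

End ValenceOne.

Section Restriction.
Variables (I : finType) (P : pred I) (f : {ffun I -> option I}).
Implicit Types (x y : {x : I | P x}).

Definition restrict_fun : {ffun {x : I | P x} -> option {x : I | P x}} :=
  [ffun x => obind insub (f (val x))].

Hypothesis Pf : forall x y : I, P x -> f x = Some y -> P y.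

Lemma restrict_funE x : omap val (restrict_fun x) = f (val x).
Proof.
rewrite ffunE; case fx: (f (val x)) => [y|] //=.
by rewrite insubT //; apply: Pf fx; apply: valP.
Qed.

Lemma restrict_conn x y :
  connect (edge restrict_fun) x y = connect (edge f) (val x) (val y).
Proof.
have eE u v : edge restrict_fun u v = edge f (val u) (val v).
  rewrite /edge /= -restrict_funE; case: (restrict_fun u) => [w|] //=.
apply/idP/idP; first by apply: connect_homo => u v; rewrite eE.
case/connectP=> p; elim: p x => [|z p IHp] x /=.
  by move=> _ /val_inj->; apply: connect0.
case/andP=> xz pp py; have Pz : P z by apply: (Pf (valP x)); apply/eqP.
apply: (@connect_trans _ _ (Sub z Pz)); last by apply: IHp; rewrite ?SubK.
by apply: connect1; rewrite eE SubK.
Qed.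

Lemma restrict_forest k l (rs : k.-tuple I) (rs' : l.-tuple {x : I | P x}) :
  is_forest (f, rs) -> uniq rs' -> (forall x, (x \in rs') = (val x \in rs)) ->
  is_forest (restrict_fun, rs').
Proof.
move=> fF u rsE; apply/is_forestP; split=> // [x|x].
  by rewrite rsE -(forest_rootE fF) -restrict_funE; case: (restrict_fun x).
have [r rrs xr] := forest_reach fF (val x).
have Pr : P r.
  move: (val x) (valP x) xr => y Py /connectP[p pp ->].
  elim: p y Py pp => //= z p IHp y Py /andP[/eqP yz pp].
  by apply: IHp pp; apply: Pf yz.
by exists (Sub r Pr); rewrite ?rsE ?restrict_conn SubK.
Qed.

End Restriction.

Section PointTree.
Variables (I : finType) (i : I).
Local Notation Ii := {x : I | x != i}.

Lemma pt_raw_conn (T : raw_forest Ii 1) (x y : Ii) :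
  connect (edge T.1) x y -> connect (edge (pt_raw T).1) (val x) (val y).
Proof.
apply: connect_homo => u v /eqP uv; rewrite /edge /= ffunE valK /=.
by rewrite uv.
Qed.

Lemma pt_raw_forest (T : raw_forest Ii 1) : is_forest T ->
  is_forest ((pt_raw T).1, [tuple of i :: [tuple val (thead T.2)]]).
Proof.
case: T => f r fF; apply/is_forestP; split=> /=.
- by rewrite inE eq_sym (valP (thead r)).
- move=> x; rewrite ffunE !inE; case: insubP => [x' _ <-|] /=; last first.
    by rewrite negbK => ->.
  rewrite (negPf (valP x')) (inj_eq val_inj).
  have := forest_rootE fF x'; rewrite {1}(tuple1E r) inE => <-.
  by case: (f x').
move=> x; have [->|xi] := eqVneq x i; first by exists i; rewrite ?inE ?eqxx.
have [u] := forest_reach fF (Sub x xi); rewrite (tuple1E r) inE => /eqP-> xu.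
exists (val (thead r)); first by rewrite !inE eqxx orbT.
by have := @pt_raw_conn (f, r) _ _ xu; rewrite SubK.
Qed.

Definition plant (T : raw_forest Ii 1) : raw_forest I 1 :=
  (graft (pt_raw T).1 (val (thead T.2)) i, [tuple of i :: [tuple]]).

Lemma pt_bas (T : raw_forest Ii 1) : is_forest T -> pt i (bas T) = bas (pt_raw T).
Proof. by move=> FT; rewrite /pt tpow_extE. Qed.

Lemma pt_raw_noi (T : raw_forest Ii 1) x : (pt_raw T).1 x <> Some i.
Proof.
rewrite ffunE; case: insub => //= x'; case: (T.1 x') => [[y yi]|] //= -[e].
by rewrite e eqxx in yi.
Qed.

Lemma tri_bas (f : {ffun I -> option I}) a b :
  is_forest (f, [tuple of a :: [tuple b]]) ->
  tri I (bas (f, [tuple of a :: [tuple b]])) = tri_at f a b [tuple].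
Proof. by move=> fF; rewrite /tri tpow_extE // !(tnth_nth a). Qed.

Lemma isolated_conn (f : {ffun I -> option I}) v a :
  (forall x, f x <> Some a) -> connect (edge f) v a = (v == a).
Proof.
move=> na; apply/idP/eqP => [va|->]; last exact: connect0.
by apply/eqP; apply: contraPT isT => /(connect_last va)[z /na].
Qed.

Lemma tri_at_isolated k (f : {ffun I -> option I}) a b (rest : k.-tuple I) :
  (forall x, f x <> Some a) ->
  tri_at f a b rest = bas (graft f b a, [tuple of a :: rest]).
Proof.
move=> na; rewrite /tri_at (bigD1 a) ?connect0 //= big1 ?addr0 // => v.
by rewrite isolated_conn // => /andP[->].
Qed.

(** The tree of [i] is a single vertex, so the product i <| T has a single term. *)
Lemma tri_pt (T : raw_forest Ii 1) : is_forest T ->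
  tri I (pt i (bas T)) = bas (plant T).
Proof.
move=> FT; have pF := pt_raw_forest FT.
rewrite pt_bas // [pt_raw T]surjective_pairing.
rewrite (tri_bas pF) tri_at_isolated //; exact: pt_raw_noi.
Qed.

Lemma plant_forest (T : raw_forest Ii 1) : is_forest T -> is_forest (plant T).
Proof.
by move=> FT; apply: (graft_forest (pt_raw_forest FT)); apply: connect0.
Qed.

Lemma plant_inj : {in @is_forest Ii 1 &, injective plant}.
Proof.
case=> f r [g s] fF gF fgE.
have root_of (h : {ffun Ii -> option Ii}) (t : 1.-tuple Ii) : is_forest (h, t) ->
    forall x, ((plant (h, t)).1 (val x) == Some i) = (x == thead t).
  move=> hF x; rewrite ffunE (inj_eq val_inj) /=.
  have [_|_] := eqVneq x (thead t); first by rewrite eqxx.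
  exact/negbTE/eqP/(@pt_raw_noi (h, t) (val x)).
have rs : thead r = thead s.
  by apply/eqP; rewrite -(root_of _ _ gF) -fgE (root_of _ _ fF).
congr (_, _); last by rewrite (tuple1E r) (tuple1E s) rs.
have gN : g (thead s) = None by apply: (forest_None gF); apply: mem_tnth.
have fN : f (thead s) = None by rewrite -rs; apply: (forest_None fF); apply: mem_tnth.
apply/ffunP => x; have := congr1 (fun F : raw_forest I 1 => F.1 (val x)) fgE.
rewrite !ffunE /= rs valK /=; have [/val_inj xs|_] := eqVneq (val x) (val (thead s)).
  by rewrite xs gN fN.
by case: (f x) (g x) => [a|] [b|] //= [] /val_inj->.
Qed.

End PointTree.

Section Decompose.
Variable I : finType.

Lemma isolated_pt (f : {ffun I -> option I}) (t s : I) :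
  is_forest (f, [tuple of t :: [tuple s]]) ->
  (forall x, f x <> Some t) ->
  exists2 T : raw_forest {x : I | x != t} 1, is_forest T &
    (f, [tuple of t :: [tuple s]]) = pt_raw T.
Proof.
move=> fF nt; have st : s != t.
  by case/is_forestP: fF => /=; rewrite !inE eq_sym => /andP[].
have Pf x y : x != t -> f x = Some y -> y != t.
  by move=> _ fx; apply/eqP => yt; apply: (nt x); rewrite fx yt.
exists (restrict_fun (fun x => x != t) f, [tuple of Sub s st :: [tuple]]).
  apply: (restrict_forest Pf fF) => // x; rewrite !inE (negPf (valP x)).
  by rewrite -(inj_eq val_inj) SubK.
rewrite /pt_raw; congr (_, _) => /=.
  apply/ffunP => x; rewrite [RHS]ffunE; case: insubP => [x' _ <-|].
    by rewrite [LHS](esym (restrict_funE Pf x')).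
  by rewrite negbK => /eqP->; rewrite (forest_None fF) ?inE ?eqxx.
Qed.

(** Cutting the only child of the root isolates the root, and what remains is the tree T. *)
Lemma valence1_plant (f : {ffun I -> option I}) (r : I) :
  is_forest (f, [tuple of r :: [tuple]]) ->
  root_valence (f, [tuple of r :: [tuple]]) = 1%N ->
  exists2 T : raw_forest {x : I | x != r} 1, is_forest T &
    (f, [tuple of r :: [tuple]]) = plant T.
Proof.
move=> fF /valence1P[c fc cU].
have cF := cut_forest fF fc.
have nr x : cut f c x <> Some r.
  by rewrite ffunE; have [//|xc] := eqVneq x c => /cU /eqP; rewrite (negPf xc).
have [T FT TE] := isolated_pt cF nr; exists T => //.
rewrite /plant -TE /=; congr (_, _).
have -> : val (thead T.2) = c by have := congr1 (fun F => tnth F.2 1) TE; rewrite !(tnth_nth r).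
by rewrite graft_cut.
Qed.

End Decompose.

(** * Pre-Lie identity and the relations of CycPreLie *)

Section Graftings.
Variable I : finType.
Implicit Types (f : {ffun I -> option I}) (r s t v w x y z : I).

Definition exch : 'Hom(tpow I 2, tpow I 2) := swap 0 1.

Lemma exch_bas f a b :
  exch (bas (f, [tuple of a :: [tuple b]])) =
  bas (f, [tuple of b :: [tuple a]]).
Proof.
rewrite /exch swapE; congr (bas (_, _)).
by apply: eq_from_tnth => -[[|[|//]] ?]; rewrite tnth_mktuple !(tnth_nth a) permE.
Qed.

Lemma addr_exch_asym u : u + exch u \in asym I 2.
Proof.
rewrite (tpow_dec u) linear_sum -big_split memv_suml //= => -[[f R] fF] _.
rewrite linearZ -scalerDr memvZ //= (pair_tuple (thead R) R) exch_bas.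
exact: asym_pair.
Qed.

Lemma d2_tri u : d2 I u = tri I u - tri I (exch u).
Proof.
suff : d2 I - tri I + (tri I \o exch)%VF = 0.
  move/lfunP/(_ u); rewrite !add_lfunE opp_lfunE comp_lfunE zero_lfunE.
  by move/eqP; rewrite -addrA addr_eq0 opprD opprK => /eqP.
apply: tpow_hom_eq => -[f R] fF; rewrite zero_lfunE !add_lfunE opp_lfunE comp_lfunE.
rewrite (pair_tuple (thead R) R) in fF *.
move: (tnth R 0) (tnth R 1) fF => a b fF.
rewrite exch_bas !tri_bas //; last exact: forest_swap2 fF.
by rewrite /d2 tpow_extE // !(tnth_nth a) /lie_at addrAC subrK subrr.
Qed.

(** The terms of (r <| s) <| t in which both trees hang from T_r; they are symmetric in s and t. *)
Definition sibling_sum f r s t : tpow I 1 :=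
  \sum_(v | connect (edge f) v r) \sum_(w | connect (edge f) w r)
     bas (graft (graft f s v) t w, [tuple r]).

(** The terms of (r <| s) <| t in which T_t hangs from T_s; together they make r <| (s <| t). *)
Definition nested_sum f r s t : tpow I 1 :=
  \sum_(v | connect (edge f) v r) \sum_(w | connect (edge f) w s)
     bas (graft (graft f s v) t w, [tuple r]).

Lemma forest_neq3 f r s t :
  is_forest (f, [tuple of r :: [tuple of s :: [tuple t]]]) ->
  [/\ r != s, r != t & s != t].
Proof.
by case/is_forestP => /=; rewrite !inE negb_or => /and3P[/andP[-> ->] -> _].
Qed.

Lemma forest_perm3 f r s t :
  is_forest (f, [tuple of r :: [tuple of s :: [tuple t]]]) ->
  is_forest (f, [tuple of r :: [tuple of t :: [tuple s]]]).
Proof.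
move=> fF; apply: (is_forest_perm _ fF) => /=.
by rewrite perm_cons; apply: permEl (perm_catC [:: s] [:: t]).
Qed.

Lemma tri_tri_at f r s t :
  is_forest (f, [tuple of r :: [tuple of s :: [tuple t]]]) ->
  tri I (tri_at f r s [tuple t]) = sibling_sum f r s t + nested_sum f r s t.
Proof.
move=> fF; rewrite /tri_at linear_sum /sibling_sum /nested_sum -big_split.
apply: eq_bigr => v vr; rewrite /=. rewrite tri_bas; last exact: (graft_forest fF vr).
rewrite /tri_at (bigID (fun w => connect (edge f) w r)) /=; congr (_ + _).
  apply: eq_bigl => w; rewrite (graft_conn fF vr) ?inE ?eqxx //=.
  by case: (connect (edge f) w r); rewrite ?andbF.
apply: eq_bigl => w; rewrite (graft_conn fF vr) ?inE ?eqxx //=.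
have [wr|_] := boolP (connect (edge f) w r); last by rewrite andbT.
by rewrite andbF; apply/esym/negbTE; apply: forest_root12 fF wr.
Qed.

Lemma exch_tri_at f r s t : exch (tri_at f r s [tuple t]) =
  \sum_(v | connect (edge f) v r) bas (graft f s v, [tuple of t :: [tuple r]]).
Proof. by rewrite linear_sum; apply: eq_bigr => v _; rewrite /= exch_bas. Qed.

Lemma tri_exch_tri_at f r s t :
  is_forest (f, [tuple of r :: [tuple of s :: [tuple t]]]) ->
  tri I (exch (tri_at f r s [tuple t])) = nested_sum f t r s.
Proof.
move=> fF; have [rs rt st] := forest_neq3 fF.
rewrite exch_tri_at linear_sum /nested_sum exchange_big.
apply: eq_bigr => v vr; rewrite /= tri_bas; last first.
  exact: (forest_swap2 (graft_forest fF vr)).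
apply: eq_big => [w|w _].
  by rewrite (graft_conn fF vr) ?inE ?eqxx ?orbT // eq_sym (negPf rt) orbF.
by rewrite graftC // eq_sym.
Qed.

(** The pre-Lie identity in the form (y <| z) <| x = (y <| x) <| z + y <| [z, x]: the sibling sums
    agree by symmetry, and the nested sums are y <| (z <| x) and y <| (x <| z). *)
Lemma prelie_tri_at f x y z :
  is_forest (f, [tuple of y :: [tuple of z :: [tuple x]]]) ->
  tri I (tri_at f y z [tuple x]) =
  tri I (tri_at f y x [tuple z]) + tri I (exch (lie_at f z x [tuple y])).
Proof.
move=> fF; have [yz yx zx] := forest_neq3 fF.
have F1 := forest_perm3 fF; have F2 := forest_perm3 (forest_swap2 fF).
have F3 : is_forest (f, [tuple of x :: [tuple of z :: [tuple y]]]).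
  exact: forest_swap2 F2.
rewrite !linearB /= !tri_tri_at // !tri_exch_tri_at //.
have -> : sibling_sum f y z x = sibling_sum f y x z by apply: A_sym.
by rewrite -addrA; congr (_ + _); rewrite addrCA subrr addr0.
Qed.

End Graftings.

Arguments exch : clear implicits.

Section Relations.
Variable I : finType.
Implicit Types (f : {ffun I -> option I}) (x y z : I).

(* Modulo [asym], these are <z, y <| x> + <x, y <| z> up to sign, and
   <y, [x, z]> - <x, y <| z> up to sign. *)
Definition rel1 f x y z : tpow I 2 :=
  tri_at f y z [tuple x] + tri_at f y x [tuple z].

Definition rel2 f x y z : tpow I 2 :=
  lie_at f x z [tuple y] - tri_at f y z [tuple x].

Definition cyc_rel (u : tpow I 2) : Prop :=
  exists f x y z, is_forest (f, [tuple of x :: [tuple of y :: [tuple z]]]) /\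
    (u = rel1 f x y z \/ u = rel2 f x y z).

(** The preimage of K_P in the tensor square, as [cyc_eq0] shows, but given by explicit
    generators. *)
Definition Krel : {vspace tpow I 2} := (asym I 2 + pspan cyc_rel)%VS.

Lemma asym_Krel u : u \in asym I 2 -> u \in Krel.
Proof. exact/subvP/addvSl. Qed.

Lemma rel1_Krel f x y z :
  is_forest (f, [tuple of x :: [tuple of y :: [tuple z]]]) ->
  rel1 f x y z \in Krel.
Proof.
move=> fF; apply: (subvP (addvSr _ _)); apply: pspan_mem.
by exists f, x, y, z; split=> //; left.
Qed.

Lemma rel2_Krel f x y z :
  is_forest (f, [tuple of x :: [tuple of y :: [tuple z]]]) ->
  rel2 f x y z \in Krel.
Proof.
move=> fF; apply: (subvP (addvSr _ _)); apply: pspan_mem.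
by exists f, x, y, z; split=> //; right.
Qed.

Lemma Krel_le (U : {vspace tpow I 2}) : (asym I 2 <= U)%VS ->
  (forall f x y z, is_forest (f, [tuple of x :: [tuple of y :: [tuple z]]]) ->
    rel1 f x y z \in U /\ rel2 f x y z \in U) ->
  (Krel <= U)%VS.
Proof.
move=> aU rU; rewrite subv_add aU; apply: pspan_min => v [f [x [y [z [fF]]]]].
by have [? ?] := rU _ _ _ _ fF; case=> ->.
Qed.

(* <y <| z, s> = <y, [z, s]> *)
Lemma Krel_left f y z s :
  is_forest (f, [tuple of y :: [tuple of z :: [tuple s]]]) ->
  tri_at f y z [tuple s] - exch I (lie_at f z s [tuple y]) \in Krel.
Proof.
move=> fF; set l := lie_at _ _ _ _.
have F2 : is_forest (f, [tuple of s :: [tuple of y :: [tuple z]]]).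
  exact: forest_swap2 (forest_perm3 fF).
have -> : tri_at f y z [tuple s] - exch I l = - rel2 f s y z - (l + exch I l).
  by rewrite /rel2 opprB (lie_atC f s z) -/l opprK opprD addrA addrK.
by rewrite memvB ?memvN ?rel2_Krel // asym_Krel // addr_exch_asym.
Qed.

(* <y <| z, s> = <z, y <| s> *)
Lemma Krel_right f y z s :
  is_forest (f, [tuple of y :: [tuple of z :: [tuple s]]]) ->
  tri_at f y z [tuple s] - exch I (tri_at f y s [tuple z]) \in Krel.
Proof.
move=> fF; set l := tri_at f y s _.
have F2 : is_forest (f, [tuple of s :: [tuple of y :: [tuple z]]]).
  exact: forest_swap2 (forest_perm3 fF).
have -> : tri_at f y z [tuple s] - exch I l = rel1 f s y z - (l + exch I l).
  by rewrite /rel1 -/l opprD addrA addrK.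
by rewrite memvB ?rel1_Krel // asym_Krel // addr_exch_asym.
Qed.

End Relations.

(** * Representatives of classes at a given vertex *)

(* a |-> i <| a *)
Definition planting (I : finType) (i : I) :
  'Hom(tpow {x : I | x != i} 1, tpow I 1) := (tri I \o pt i)%VF.

Section Planting.
Variable I : finType.
Implicit Types (i j o : I) (A : {set I}).
Local Notation family := (forall i : I, tpow {x : I | x != i} 1).

Lemma planting_bas i (T : raw_forest {x : I | x != i} 1) : is_forest T ->
  planting i (bas T) = bas (plant T).
Proof. by move=> FT; rewrite /planting comp_lfunE tri_pt. Qed.

Lemma planting_root i x (G : forest I 1) :
  thead (val G).2 != i -> planting i x G = 0.
Proof.
move=> Gi; rewrite (tpow_dec x) linear_sum sum_ffunE big1 // => T _.
rewrite linearZ /= planting_bas ?(valP T) // ffunE basE.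
case: eqP => [GE|_]; last by rewrite [LHS]mulr0.
by rewrite GE /= theadE eqxx in Gi.
Qed.

Lemma planting_plant i x (T : forest {x : I | x != i} 1) :
  planting i x (Sub (plant (val T)) (plant_forest (valP T))) = x T.
Proof.
rewrite {1}(tpow_dec x) linear_sum sum_ffunE (bigD1 T) //= big1 => [|S ST].
  rewrite linearZ /= planting_bas ?(valP T) // ffunE basE SubK eqxx addr0.
  by rewrite [LHS]mulr1.
rewrite linearZ /= planting_bas ?(valP S) // ffunE basE SubK.
case: eqP => [/(plant_inj (valP T) (valP S))/val_inj TS|_].
  by rewrite TS eqxx in ST.
by rewrite [LHS]mulr0.
Qed.

Lemma planting_inj i x : planting i x = 0 -> x = 0.
Proof.
by move=> x0; apply/ffunP => T; rewrite -planting_plant x0 !ffunE.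
Qed.

Lemma planting_v1 i x : planting i x \in v1 I.
Proof. by rewrite /planting comp_lfunE tri_pt_v1. Qed.

Lemma v1E : v1 I = basis_span (fun T : raw_forest I 1 => root_valence T == 1%N).
Proof. by []. Qed.

Lemma planting_planted o i x : i != o -> planting i x \in basis_span (planted o).
Proof.
move=> io; apply/memv_basis_span => G; rewrite /planted negb_and negbK.
case/orP=> [v|/eqP go].
  by have := planting_v1 x; rewrite v1E => /memv_basis_span/(_ G v).
by rewrite planting_root // go eq_sym.
Qed.

Lemma v1_planting z : z \in v1 I ->
  exists x : family, z = \sum_i planting i (x i).
Proof.
pose P z := exists x : family, z = \sum_i planting i (x i).
have P0 : P 0 by exists (fun=> 0); rewrite big1 // => i _; rewrite linear0.
have PL a u w : P u -> P w -> P (a *: u + w).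
  case=> x -> [y ->]; exists (fun i => a *: x i + y i).
  by rewrite scaler_sumr -big_split; apply: eq_bigr => i _; rewrite linearP.
move=> zv; rewrite -/(P z) (tpow_dec z); apply: big_ind => //.
  by move=> u w Pu Pw; rewrite -[u]scale1r; apply: PL.
move=> [[f r] fF] _; have [v|nv] := boolP (root_valence (f, r) == 1%N); last first.
  move: zv; rewrite v1E => /memv_basis_span/(_ (Sub (f, r) fF) nv)->.
  by rewrite scale0r.
rewrite -[_ *: _]addr0; apply: PL => //=.
rewrite (tuple1E r) in fF v *; have [T FT ->] := valence1_plant fF (eqP v).
rewrite -planting_bas //.
exists (dfwith (fun i : I => 0 : tpow {x : I | x != i} 1) (bas T)).
rewrite (bigD1 (thead r)) //= dfwith_in big1 ?addr0 // => j jr.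
by rewrite dfwith_out ?linear0 // eq_sym.
Qed.

End Planting.

Section Representatives.
Variable I : finType.
Implicit Types (f : {ffun I -> option I}) (i o s t v x y z : I) (A : {set I}).
Local Notation family := (forall i : I, tpow {x : I | x != i} 1).

(* The class of u is <i, x_i> for each i in A, and the product of the two
   factors of u is the sum of the i <| x_i modulo brackets. *)
Definition represented A (u : tpow I 2) : Prop :=
  exists x : family,
    tri I u - \sum_(i in A) planting i (x i) \in limg (d2 I) /\
    forall i, i \in A -> u - pt i (x i) \in Krel I.

Lemma represented_lin A a (u v : tpow I 2) :
  represented A u -> represented A v -> represented A (a *: u + v).
Proof.
case=> x [ux Kx] [y [vy Ky]]; exists (fun i => a *: x i + y i); split=> [|i iA].
  have -> : \sum_(i in A) planting i (a *: x i + y i) =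
      a *: (\sum_(i in A) planting i (x i)) + \sum_(i in A) planting i (y i).
    by rewrite scaler_sumr -big_split; apply: eq_bigr => i _; rewrite linearP.
  by rewrite linearP opprD addrACA -scalerBr memvD ?memvZ.
by rewrite linearP opprD addrACA -scalerBr memvD ?memvZ ?Kx ?Ky.
Qed.

Lemma represented0 A : represented A 0.
Proof.
exists (fun=> 0); rewrite linear0 sub0r big1 => [|i _]; last exact: linear0.
by rewrite oppr0 mem0v; split=> // i _; rewrite linear0 subr0 mem0v.
Qed.

Lemma represented_sum A (J : finType) (P : pred J) (u : J -> tpow I 2) :
  (forall j, P j -> represented A (u j)) -> represented A (\sum_(j | P j) u j).
Proof.
move=> Au; apply: big_ind => //; first exact: represented0.
by move=> v w Av Aw; rewrite -[v]scale1r; apply: represented_lin.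
Qed.

Lemma representedB A (u v : tpow I 2) :
  represented A u -> represented A v -> represented A (u - v).
Proof. by rewrite addrC -scaleN1r => Au Av; apply: represented_lin. Qed.

Lemma component_disjoint k f (rs : k.-tuple I) y z : is_forest (f, rs) ->
  y \in rs -> z \in rs -> y != z -> [disjoint component f y & component f z].
Proof.
move=> fF yrs zrs yz; rewrite disjoint_subset; apply/subsetP => v.
rewrite !inE => vy; apply: contra yz => vz; apply/eqP.
exact: (forest_root_uniq fF yrs zrs vy vz).
Qed.

(** [Krel_left] and [Krel_right] give the class of (y <| z) (x) s at the vertices of y through y (x)
    [z, s], and at those of z through z (x) (y <| s). The sums match because (y <| z) <| s = y <|
    [z, s] + (y <| s) <| z, where the last term is z <| (y <| s) modulo a bracket. *)
Lemma represented_tri_at f y z s :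
  is_forest (f, [tuple of y :: [tuple of z :: [tuple s]]]) ->
  represented (component f y) (exch I (lie_at f z s [tuple y])) ->
  represented (component f z) (exch I (tri_at f y s [tuple z])) ->
  represented (component f y :|: component f z) (tri_at f y z [tuple s]).
Proof.
move=> fF [a [ua Ka]] [b [ub Kb]].
have [yz _ _] := forest_neq3 fF.
have dYZ : [disjoint component f y & component f z].
  by apply: (component_disjoint fF); rewrite ?inE ?eqxx ?orbT.
exists (fun i => if i \in component f y then a i else b i); split; last first.
  move=> i; rewrite inE; have [iy _|_ /= iz] := boolP (i \in component f y).
    by have := memvD (Krel_left fF) (Ka i iy); rewrite addrA subrK.
  by have := memvD (Krel_right fF) (Kb i iz); rewrite addrA subrK.
rewrite (eq_bigl [predU component f y & component f z]) => [|i]; last by rewrite !inE.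
rewrite bigU //=; set SY := \sum_(i in _) _; set SZ := \sum_(i in _) _.
have -> : SY = \sum_(i in component f y) planting i (a i).
  by apply: eq_bigr => i ->.
have -> : SZ = \sum_(i in component f z) planting i (b i).
  by apply: eq_bigr => i iz; rewrite (disjointFl dYZ).
rewrite prelie_tri_at //.
(* The last summand is the bracket [y <| s, z]. *)
have := memvD (memvD ua ub) (memv_img (d2 I) (memvf (tri_at f y s [tuple z]))).
rewrite d2_tri; set X := tri I (exch I (lie_at _ _ _ _)).
set Y := tri I (exch I _); set Z := tri I _.
set S := \sum_(i in _) _; set S' := \sum_(i in _) _.
suff -> : Z + X - (S + S') = X - S + (Y - S') + (Z - Y) by [].
by apply/ffunP => T; rewrite !ffunE; ring.
Qed.

(** The induction is on the first tree alone, as the second one grows. A single vertex t has x_t =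
    s. Otherwise the first tree is t_0 <| c minus trees whose root has fewer children, and
    [represented_tri_at] reduces (t_0 <| c) (x) s to pairs with first tree t_0 or c. *)
Lemma represented_bas f t s : is_forest (f, [tuple of t :: [tuple s]]) ->
  represented (component f t) (bas (f, [tuple of t :: [tuple s]])).
Proof.
pose child f t := [set x | f x == Some t].
(* Lexicographic in the size of the first tree and the number of children of its root. *)
have [n] := ubnP (#|component f t| * #|I|.+1 + #|child f t|).
elim: n f t s => // n IHn f t s; rewrite ltnS => fn fF.
have ch_le g u : (#|child g u| <= #|I|)%N by apply: max_card.
have [/existsP[c /eqP fc]|/existsPn noc] := boolP [exists c, f c == Some t]; last first.
  have nt x : f x <> Some t by apply/eqP.
  have -> : component f t = [set t].
    by apply/setP => x; rewrite !inE isolated_conn.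
  have [T FT TE] := isolated_pt fF nt.
  exists (dfwith (fun i : I => 0 : tpow {x : I | x != i} 1) (bas T)).
  rewrite big_set1 dfwith_in TE -pt_bas // /planting comp_lfunE subrr mem0v.
  by split=> // i; rewrite inE => /eqP->; rewrite dfwith_in subrr mem0v.
pose f0 := cut f c; have f0F : is_forest (f0, [tuple of t :: [tuple of c :: [tuple s]]]).
  exact: cut_forest fF fc.
have f0c : f0 c = None by apply: cut_root.
have fE : f = graft f0 c t by rewrite graft_cut.
have f0s : f0 s = None by apply: (forest_None f0F); rewrite !inE eqxx !orbT.
have [tc ts cs] := forest_neq3 f0F.
have AE : component f t = component f0 t :|: component f0 c.
  by apply/setP => x; rewrite !inE [in LHS]fE connect_graft // connect0 andbT.
have dTC : [disjoint component f0 t & component f0 c].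
  by apply: (component_disjoint f0F); rewrite ?inE ?eqxx ?orbT.
have cardA : #|component f t| = (#|component f0 t| + #|component f0 c|)%N.
  by rewrite AE cardsU (eqP (_ : _ :&: _ == set0)) ?cards0 ?subn0 ?setI_eq0.
have t_gt0 : (0 < #|component f0 t|)%N by apply/card_gt0P; exists t; rewrite inE.
have c_gt0 : (0 < #|component f0 c|)%N by apply/card_gt0P; exists c; rewrite inE.
have smaller g u : (#|component g u| < #|component f t|)%N ->
    (#|component g u| * #|I|.+1 + #|child g u| < n)%N.
  by move=> lt; apply: leq_trans fn; apply: lex_lt; rewrite ?ch_le.
have ltT : (#|component f0 t| < #|component f t|)%N by rewrite cardA -addn1 leq_add2l.
have ltC : (#|component f0 c| < #|component f t|)%N by rewrite cardA -add1n leq_add2r.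
have F2 := forest_perm3 f0F.
have F3 : is_forest (f0, [tuple of c :: [tuple of s :: [tuple t]]]).
  exact: forest_perm3 (forest_swap2 f0F).
have F4 := forest_swap2 F3.
have u1 : represented (component f t) (tri_at f0 t c [tuple s]).
  rewrite AE; apply: represented_tri_at => //.
    rewrite linearB /= !exch_tri_at; apply: representedB; apply: represented_sum => v vc.
      have gF := forest_swap2 (graft_forest F3 vc).
      have cE : component (graft f0 s v) t = component f0 t.
        apply/setP => x; rewrite !inE (graft_conn F3 vc) ?inE ?eqxx ?orbT //.
        by rewrite (negPf tc) orbF.
      by rewrite -cE; apply: IHn gF; apply: smaller; rewrite cE.
    have gF := forest_swap2 (graft_forest F4 vc).
    have cE : component (graft f0 c v) t = component f0 t.
      apply/setP => x; rewrite !inE (graft_conn F4 vc) ?inE ?eqxx ?orbT //.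
      by rewrite (negPf ts) orbF.
    by rewrite -cE; apply: IHn gF; apply: smaller; rewrite cE.
  rewrite exch_tri_at; apply: represented_sum => v vt.
  have gF := forest_swap2 (graft_forest F2 vt).
  have cE : component (graft f0 s v) c = component f0 c.
    apply/setP => x; rewrite !inE (graft_conn F2 vt) ?inE ?eqxx ?orbT //.
    by rewrite [c == t]eq_sym (negPf tc) orbF.
  by rewrite -cE; apply: IHn gF; apply: smaller; rewrite cE.
have -> : bas (f, [tuple of t :: [tuple s]]) = tri_at f0 t c [tuple s]
    - \sum_(v | connect (edge f0) v t && (v != t))
        bas (graft f0 c v, [tuple of t :: [tuple s]]).
  by rewrite /tri_at (bigD1 t) ?connect0 //= -fE addrK.
apply: representedB => //; apply: represented_sum => v /andP[vt vNt].
have gF := graft_forest f0F vt.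
have cE : component (graft f0 c v) t = component f t.
  by rewrite AE; apply/setP => x; rewrite !inE connect_graft // vt andbT.
rewrite -cE; apply: IHn gF; rewrite cE; apply: leq_trans fn; rewrite ltn_add2l.
apply: proper_card; apply/properP; split; last first.
  exists c; rewrite !inE ?fc //= ffunE eqxx.
  by apply: contra vNt => /eqP[->].
apply/subsetP => x; rewrite !inE !ffunE; have [_|//] := eqVneq x c.
by move=> /eqP[vt']; rewrite vt' eqxx in vNt.
Qed.

End Representatives.

(** * Planted trees form a basis modulo brackets *)

Section PlantedBasis.
Variables (I : finType) (o : I).
Implicit Types (f : {ffun I -> option I}) (a b r s t v : I).

Let V := (limg (d2 I) + basis_span (planted o))%VS.

Lemma component_other f a b : is_forest (f, [tuple of a :: [tuple b]]) ->
  component f b = ~: component f a.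
Proof.
move=> fF; apply/setP => x; rewrite !inE.
have [xa|xa] := boolP (connect (edge f) x a).
  by apply/negbTE; apply: forest_root12 fF xa.
have [u] := forest_reach fF x; rewrite !inE => /orP[] /eqP-> //.
by rewrite (negPf xa).
Qed.

(** If o is not in the first tree, [represented_bas] uses only roots of that tree, hence other than
    o. If it is, a bracket exchanges the factors. *)
Lemma tri_planted_span f t s : is_forest (f, [tuple of t :: [tuple s]]) ->
  tri I (bas (f, [tuple of t :: [tuple s]])) \in V.
Proof.
move=> fF.
have other a b : is_forest (f, [tuple of a :: [tuple b]]) ->
    o \notin component f a -> tri I (bas (f, [tuple of a :: [tuple b]])) \in V.
  move=> abF oa; have [x [ux _]] := represented_bas abF.
  rewrite -[tri I _](subrK (\sum_(i in component f a) planting i (x i))).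
  apply: memv_add => //; apply: memv_suml => i ia; apply: planting_planted.
  by apply: contraNneq oa => <-.
have [ot|] := boolP (o \in component f t); last exact: other.
have os : o \notin component f s by rewrite (component_other fF) inE ot.
set u := bas _; have -> : tri I u = d2 I u + tri I (exch I u).
  by rewrite d2_tri subrK.
rewrite exch_bas memvD //.
  by rewrite (subvP (addvSl _ _)) // memv_img ?memvf.
exact: other (forest_swap2 fF) os.
Qed.

(** A tree with root r and child c of r is T_r <| T_c minus trees whose root has fewer children; a
    second vertex ensures that r has a child. *)
Lemma planted_span : (1 < #|I|)%N -> V = fullv.
Proof.
move=> I2; apply/vspaceP => z; rewrite memvf (tpow_dec z) memv_suml // => -[[f R] fF] _.
rewrite memvZ //=; rewrite (tuple1E R) in fF *; move: (thead R) fF => r {R}.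
pose child f := [set x | f x == Some r].
have [n] := ubnP #|child f|; elim: n f => // n IHn f; rewrite ltnS => fn fF.
have [c fc] : exists c, f c = Some r.
  have [x xr] : exists x, x != r.
    move: I2; rewrite (cardD1 r) inE ltnS => /card_gt0P[x]; rewrite !inE => /andP[xr _].
    by exists x.
  have [u] := forest_reach fF x; rewrite inE => /eqP-> xu.
  by have [c] := connect_last xu xr; exists c.
pose f0 := cut f c; have f0F : is_forest (f0, [tuple of r :: [tuple c]]).
  exact: cut_forest fF fc.
have fE : f = graft f0 c r by rewrite graft_cut.
have -> : bas (f, [tuple of r :: [tuple]]) = tri I (bas (f0, [tuple of r :: [tuple c]]))
    - \sum_(v | connect (edge f0) v r && (v != r))
        bas (graft f0 c v, [tuple of r :: [tuple]]).
  by rewrite tri_bas // /tri_at (bigD1 r) ?connect0 //= -fE addrK.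
rewrite memvB ?tri_planted_span //; apply: memv_suml => v /andP[vr vNr].
apply: IHn (graft_forest f0F vr); apply: leq_trans fn.
apply: proper_card; apply/properP; split; last first.
  exists c; rewrite !inE ?fc //= ffunE eqxx.
  by apply: contra vNr => /eqP[->].
apply/subsetP => x; rewrite !inE !ffunE; have [_|//] := eqVneq x c.
by move=> /eqP[vr']; rewrite vr' eqxx in vNr.
Qed.

(** The planted trees are at most as many as the codimension of the brackets, by [card_planted] and
    [deltaR_dims], and they span modulo brackets; so the sum is direct. *)
Lemma planted_indep z :
  z \in basis_span (planted o) -> z \in limg (d2 I) -> z = 0.
Proof.
(* With one vertex the only root is o, and no tree is planted. *)
have [I1|I2] := leqP #|I| 1.
  move=> /memv_basis_span zP _; apply/ffunP => G; rewrite zP ?ffunE //.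
  by rewrite negb_and negbK (fintype_le1P I1 (thead (val G).2) o) eqxx orbT.
move=> zP zd; have zc : z \in (limg (d2 I) :&: basis_span (planted o))%VS.
  by rewrite memv_cap zd.
have h1 := dimv_sum_cap (limg (d2 I)) (basis_span (planted o)).
have := planted_span I2; rewrite /V => VE; rewrite VE dimvf dim_tpow in h1.
have [_ h2] := deltaR_dims o; have h3 := card_planted o.
have h4 := dim_basis_span (planted o).
have h5 : \dim (limg (d2 I) :&: basis_span (planted o)) = 0%N by lia.
by move/eqP: h5; rewrite dimv_eq0 => /eqP c0; move: zc; rewrite c0 memv0 => /eqP.
Qed.

End PlantedBasis.

(** * Vanishing criteria for combinations of planted trees that are brackets *)

Section RootProjection.
Variable I : finType.
Implicit Types (A B : {set I}) (i o : I) (z w : tpow I 1).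

Definition root_proj A : 'Hom(tpow I 1, tpow I 1) :=
  tpow_ext (fun F : raw_forest I 1 => if thead F.2 \in A then bas F else 0).

Lemma root_projE A z (G : forest I 1) :
  root_proj A z G = if thead (val G).2 \in A then z G else 0.
Proof.
rewrite {1}(tpow_dec z) linear_sum sum_ffunE (bigD1 G) //= big1 => [|H HG].
  rewrite linearZ /= /root_proj tpow_extE ?(valP G) //; case: ifP => _.
    by rewrite ffunE basE eqxx addr0 [LHS]mulr1.
  by rewrite scaler0 ffunE addr0.
rewrite linearZ /= /root_proj tpow_extE ?(valP H) // ffunE; case: ifP => _.
  rewrite basE; case: eqP => [/val_inj GH|_]; last by rewrite [LHS]mulr0.
  by rewrite GH eqxx in HG.
by rewrite ffunE [LHS]mulr0.
Qed.

Lemma root_proj_planting A i x :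
  root_proj A (planting i x) = if i \in A then planting i x else 0.
Proof.
apply/ffunP => G; rewrite root_projE.
have [->|Gi] := eqVneq (thead (val G).2) i; first by case: ifP => // _; rewrite ffunE.
by rewrite (planting_root x Gi) if_same; case: ifP => _; rewrite ?ffunE ?planting_root.
Qed.

Lemma root_projI A B z : root_proj A (root_proj B z) = root_proj (A :&: B) z.
Proof.
by apply/ffunP => G; rewrite !root_projE inE; case: (_ \in A) (_ \in B) => [] [].
Qed.

Lemma root_proj0 z : root_proj set0 z = 0.
Proof. by apply/ffunP => G; rewrite root_projE inE ffunE. Qed.

Lemma root_proj_split A B w1 w2 w3 : [disjoint A & B] ->
  root_proj (A :|: B) w1 - root_proj A w2 - root_proj B w3 = 0 ->
  root_proj A (w1 - w2) = 0 /\ root_proj B (w1 - w3) = 0.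
Proof.
move=> dAB /ffunP e; split; apply/ffunP => G; have := e G;
  rewrite !ffunE !root_projE !inE !ffunE; set t := thead _.
  by case tA: (t \in A) => //=; rewrite (disjointFr dAB tA) subr0.
by case tB: (t \in B) => //=; rewrite orbT (disjointFl dAB tB) subr0.
Qed.

Lemma root_proj_outside A B o w1 w2 w3 : o \notin A -> o \notin B ->
  root_proj [set o] (root_proj (A :|: B) w1 - root_proj A w2 - root_proj B w3) = 0.
Proof.
move=> oA oB; apply/ffunP => G; rewrite root_projE !ffunE !root_projE !inE.
by case: eqP => // ->; rewrite (negPf oA) (negPf oB) !subr0.
Qed.

Lemma root_proj_v1 A z : z \in v1 I -> root_proj A z \in v1 I.
Proof.
rewrite v1E => /memv_basis_span zv; apply/memv_basis_span => G /zv z0.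
by rewrite root_projE z0 if_same.
Qed.

(** Without trees rooted at o, z is a combination of planted trees, and these are independent modulo
    brackets. So a family whose sum is a bracket is determined by its member at o. *)
Lemma v1_indep o z :
  z \in v1 I -> root_proj [set o] z = 0 -> z \in limg (d2 I) -> z = 0.
Proof.
rewrite v1E => /memv_basis_span zv zo; apply: planted_indep (o) _ _; apply/memv_basis_span => G.
rewrite negb_and negbK => /orP[v|/eqP Go].
  exact: zv.
by have := root_projE [set o] z G; rewrite zo Go inE eqxx ffunE.
Qed.

(** The part of z over A has no tree rooted at o', hence is zero; so z has no tree rooted at o, and
    is zero as well. *)
Lemma v1_indep_proj A o o' z : o \in A -> o' \notin A ->
  z \in v1 I -> z \in limg (d2 I) -> root_proj A z \in limg (d2 I) -> z = 0.
Proof.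
move=> oA o'A zv zd Az; apply: (@v1_indep o) => //.
have A0 : root_proj A z = 0.
  apply: (@v1_indep o') => //; first exact: root_proj_v1.
  rewrite root_projI (_ : _ :&: _ = set0) ?root_proj0 //.
  by apply/eqP; rewrite setI_eq0 disjoints1.
have := root_projI [set o] A z; rewrite A0 linear0.
by rewrite (setIidPl _) ?sub1set.
Qed.

Lemma v1_indep_component A a z : a \in A ->
  z \in v1 I -> z \in limg (d2 I) -> root_proj A z = 0 -> z = 0.
Proof.
move=> aA zv zd Az; apply: (@v1_indep a) => //.
by have := root_projI [set a] A z; rewrite Az linear0 (setIidPl _) ?sub1set.
Qed.

(** Meant for w1 and w2 attached to a pair of trees and to the exchanged pair, A being the vertices
    of the first tree, and T1, T2 the two products, which differ by a bracket. The part of w1 + w2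
    over A is then a bracket too. *)
Lemma v1_antisym A a o w1 w2 T1 T2 : a \in A -> o \notin A ->
  w1 \in v1 I -> w1 \in limg (d2 I) -> w2 \in v1 I -> w2 \in limg (d2 I) ->
  root_proj A w1 - T1 \in limg (d2 I) ->
  root_proj (~: A) w2 - T2 \in limg (d2 I) ->
  T1 - T2 \in limg (d2 I) -> w1 + w2 = 0.
Proof.
move=> aA oA v1w d1w v2w d2w p1 p2 TT.
apply: (v1_indep_proj aA oA (memvD v1w v2w) (memvD d1w d2w)).
have -> : root_proj A (w1 + w2) =
    w2 + (T1 - T2 + (root_proj A w1 - T1 - (root_proj (~: A) w2 - T2))).
  by apply/ffunP => G; rewrite !ffunE !root_projE !inE !ffunE; case: ifP => _ /=; ring.
exact: memvD d2w (memvD TT (memvB p1 p2)).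
Qed.

(** Meant for w1, w2, w3 attached to (y <| z) (x) s, y (x) [z, s] and z (x) (y <| s), with A and B
    the vertices of y and z, and o in s. The difference of their parts over A and B is a bracket
    without trees rooted at o, hence zero; then w1 - w2 vanishes over A and w1 - w3 over B, which
    suffices. *)
Lemma v1_glue A B a b o w1 w2 w3 T T2 T3 :
  [disjoint A & B] -> a \in A -> b \in B -> o \notin A -> o \notin B ->
  w1 \in v1 I -> w1 \in limg (d2 I) -> w2 \in v1 I -> w2 \in limg (d2 I) ->
  w3 \in v1 I -> w3 \in limg (d2 I) ->
  root_proj (A :|: B) w1 - (T + T2) \in limg (d2 I) ->
  root_proj A w2 - T2 \in limg (d2 I) ->
  root_proj B w3 - T3 \in limg (d2 I) ->
  T - T3 \in limg (d2 I) -> w1 = w2 /\ w1 = w3.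
Proof.
move=> dAB aA bB oA oB v1w d1w v2w d2w v3w d3w p1 p2 p3 TT.
have q0 : root_proj (A :|: B) w1 - root_proj A w2 - root_proj B w3 = 0.
  apply: (@v1_indep o); first by rewrite !memvB ?root_proj_v1.
    exact: root_proj_outside.
  have -> : root_proj (A :|: B) w1 - root_proj A w2 - root_proj B w3 =
      root_proj (A :|: B) w1 - (T + T2) - (root_proj A w2 - T2)
      - (root_proj B w3 - T3) + (T - T3).
    by apply/ffunP => G; rewrite !ffunE; ring.
  exact: memvD (memvB (memvB p1 p2) p3) TT.
have [A0 B0] := root_proj_split dAB q0.
split; apply/eqP; rewrite -subr_eq0; apply/eqP.
  by apply: v1_indep_component aA _ _ A0; rewrite memvB.
by apply: v1_indep_component bB _ _ B0; rewrite memvB.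
Qed.

End RootProjection.

(** * Uniqueness of representatives *)

Section Transfer.
Variable I : finType.
Implicit Types (f : {ffun I -> option I}) (a b s v x y z : I) (A : {set I}).

Lemma root_proj_sum_planting A (P : pred I)
    (x : forall i : I, tpow {x : I | x != i} 1) :
  root_proj A (\sum_(i | P i) planting i (x i)) =
  \sum_(i | P i && (i \in A)) planting i (x i).
Proof.
rewrite linear_sum (bigID [in A]) /= [X in _ + X]big1 ?addr0.
  by apply: eq_bigr => i /andP[_ iA]; rewrite root_proj_planting iA.
by move=> i /andP[_ /negPf iA]; rewrite root_proj_planting iA.
Qed.

(** The members at vertices of the first tree come from the pair itself, the others, with a minus
    sign, from the exchanged pair, as <t, s> = - <s, t>. The total is congruent to t <| s - s <| t,
    hence a bracket. *)
Lemma transfer_bas_ex (F : forest I 2) : exists z : tpow I 1,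
  [/\ z \in v1 I, z \in limg (d2 I) &
      root_proj (component (val F).1 (tnth (val F).2 0)) z - tri I (bas (val F))
        \in limg (d2 I)].
Proof.
case: F => -[f R] /= fF; rewrite (pair_tuple (thead R) R) in fF *.
rewrite [tnth _ 0]/=; move: (tnth R 0) (tnth R 1) fF => a b fF.
have [x [ux _]] := represented_bas fF.
have [y [uy _]] := represented_bas (forest_swap2 fF).
exists (\sum_(i in component f a) planting i (x i)
        - \sum_(i in component f b) planting i (y i)).
split.
- by rewrite memvB // memv_suml // => i _; apply: planting_v1.
- have := memvB (memv_img (d2 I) (memvf (bas (f, [tuple of a :: [tuple b]]))))
    (memvB ux uy).
  rewrite d2_tri exch_bas; set T := tri I _; set T' := tri I _.
  set SA := \sum_(i in _) _; set SB := \sum_(i in _) _.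
  suff -> : T - T' - (T - SA - (T' - SB)) = SA - SB by [].
  by apply/ffunP => G; rewrite !ffunE; ring.
rewrite linearB /= !root_proj_sum_planting [X in _ - X - _]big1 ?subr0.
  rewrite (eq_bigl [in component f a]) => [|i]; last by rewrite andbb.
  by rewrite -memvN opprB.
by move=> i; rewrite (component_other fF) inE andNb.
Qed.

(* A family (x_i) determined by a class of CycPreLie is encoded by the sum of
   the i <| x_i, which is a bracket; root_proj A keeps the x_i with i in A. *)
Lemma transfer_ex : exists Phi : 'Hom(tpow I 2, tpow I 1),
  [/\ forall u, Phi u \in v1 I, forall u, Phi u \in limg (d2 I) &
      forall f a b, is_forest (f, [tuple of a :: [tuple b]]) ->
        root_proj (component f a) (Phi (bas (f, [tuple of a :: [tuple b]])))
        - tri I (bas (f, [tuple of a :: [tuple b]])) \in limg (d2 I)].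
Proof.
have [phi phiP] := choice transfer_bas_ex.
exists (linext phi); split=> [u|u|f a b fF].
- by rewrite linextE memv_suml // => F _; rewrite memvZ //; case: (phiP F).
- by rewrite linextE memv_suml // => F _; rewrite memvZ //; case: (phiP F).
have -> : linext phi (bas (f, [tuple of a :: [tuple b]])) = phi (Sub _ fF).
  rewrite linextE (bigD1 (Sub _ fF)) //= big1 => [|G GF].
    by rewrite basE SubK eqxx scale1r addr0.
  rewrite basE -[_ == _]negbK; case: eqP => [GE|_]; last by rewrite scale0r.
  by rewrite -(inj_eq val_inj) SubK GE eqxx in GF.
by have [_ _] := phiP (Sub _ fF); rewrite SubK.
Qed.

Section Kernel.
Variable Phi : 'Hom(tpow I 2, tpow I 1).
Hypothesis Phi_v1 : forall u, Phi u \in v1 I.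
Hypothesis Phi_d2 : forall u, Phi u \in limg (d2 I).
Hypothesis Phi_bas : forall f a b, is_forest (f, [tuple of a :: [tuple b]]) ->
  root_proj (component f a) (Phi (bas (f, [tuple of a :: [tuple b]])))
  - tri I (bas (f, [tuple of a :: [tuple b]])) \in limg (d2 I).

(** The counterpart for [Phi] of the first condition in [represented]. *)
Let fits A u := root_proj A (Phi u) - tri I u \in limg (d2 I).

Let fits_sum A (J : finType) (P : pred J) (u : J -> tpow I 2) :
  (forall j, P j -> fits A (u j)) -> fits A (\sum_(j | P j) u j).
Proof.
move=> Au; rewrite /fits.
rewrite (linear_sum Phi) (linear_sum (root_proj A)) (linear_sum (tri I)) -sumrB.
by rewrite memv_suml // => j /Au.
Qed.

Let fitsB A u w : fits A u -> fits A w -> fits A (u - w).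
Proof.
move=> Au Aw; rewrite /fits (linearB Phi) (linearB (root_proj A)) (linearB (tri I)).
by rewrite opprD addrACA -opprD memvB.
Qed.

Let fitsZ A (c : rat) u : fits A u -> fits A (c *: u).
Proof.
move=> Au; rewrite /fits (linearZ_LR Phi) (linearZ_LR (root_proj A)) (linearZ_LR (tri I)).
by rewrite -scalerBr memvZ.
Qed.

Let fits_exch_tri_at f r s t :
  is_forest (f, [tuple of r :: [tuple of s :: [tuple t]]]) ->
  fits (component f t) (exch I (tri_at f r s [tuple t])).
Proof.
move=> fF; have [rs rt st] := forest_neq3 fF; rewrite exch_tri_at.
apply: fits_sum => v vr; have gF := graft_forest fF vr.
have <- : component (graft f s v) t = component f t.
  apply/setP => x; rewrite !inE (graft_conn fF vr) ?inE ?eqxx ?orbT //.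
  by rewrite [t == r]eq_sym (negPf rt) orbF.
exact: Phi_bas (forest_swap2 gF).
Qed.

Let fits_tri_at f r s t :
  is_forest (f, [tuple of r :: [tuple of s :: [tuple t]]]) ->
  fits (component f r :|: component f s) (tri_at f r s [tuple t]).
Proof.
move=> fF; apply: fits_sum => v vr; have gF := graft_forest fF vr.
have <- : component (graft f s v) r = component f r :|: component f s.
  apply/setP => x; rewrite !inE connect_graft ?vr ?andbT //.
  by apply: (forest_None fF); rewrite !inE eqxx orbT.
exact: Phi_bas gF.
Qed.

Lemma transfer_exch u : Phi (exch I u) = - Phi u.
Proof.
suff : (Phi \o exch I + Phi)%R%VF = 0.
  by move/lfunP/(_ u)/eqP; rewrite add_lfunE comp_lfunE zero_lfunE addr_eq0 => /eqP.
apply: tpow_hom_eq => -[f R] fF; rewrite zero_lfunE add_lfunE comp_lfunE.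
rewrite (pair_tuple (thead R) R) in fF *.
move: (tnth R 0) (tnth R 1) fF => a b fF.
rewrite exch_bas; apply: (@v1_antisym _ (component f b) b a) => //.
- by rewrite inE connect0.
- by rewrite inE; apply: forest_root12 fF _; apply: connect0.
- exact: Phi_bas (forest_swap2 fF).
- by rewrite -(component_other (forest_swap2 fF)); apply: Phi_bas fF.
by rewrite -memvN opprB -(exch_bas f a b) -d2_tri memv_img ?memvf.
Qed.

Lemma transfer_tri_at f y z s :
  is_forest (f, [tuple of y :: [tuple of z :: [tuple s]]]) ->
  Phi (tri_at f y z [tuple s]) = - Phi (lie_at f z s [tuple y]) /\
  Phi (tri_at f y z [tuple s]) = - Phi (tri_at f y s [tuple z]).
Proof.
move=> fF; rewrite -!transfer_exch.
have [yz ys zs] := forest_neq3 fF.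
have F1 := forest_perm3 fF.
have F2 : is_forest (f, [tuple of z :: [tuple of s :: [tuple y]]]).
  exact: forest_perm3 (forest_swap2 fF).
have f1 := fits_tri_at fF; have f3 := fits_exch_tri_at F1.
have f2 : fits (component f y) (exch I (lie_at f z s [tuple y])).
  rewrite linearB; apply: fitsB; first exact: fits_exch_tri_at F2.
  exact: fits_exch_tri_at (forest_swap2 F2).
(* Here T = (y <| s) <| z, T2 = y <| [z, s] and T3 = z <| (y <| s): the pre-Lie identity gives T +
   T2, and T - T3 is a bracket. *)
apply: (@v1_glue _ (component f y) (component f z) y z s _ _ _
  (tri I (tri_at f y s [tuple z])) (tri I (exch I (lie_at f z s [tuple y])))
  (tri I (exch I (tri_at f y s [tuple z])))) => //.
- by apply: (component_disjoint fF); rewrite ?inE ?eqxx ?orbT.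
- by rewrite inE connect0.
- by rewrite inE connect0.
- by rewrite inE; apply: forest_root12 (forest_swap2 F1) (connect0 _ _).
- by rewrite inE; apply: forest_root12 (forest_swap2 F2) (connect0 _ _).
- by rewrite -prelie_tri_at.
by rewrite -d2_tri memv_img ?memvf.
Qed.

Lemma transfer_Krel u : u \in Krel I -> Phi u = 0.
Proof.
move=> uK; apply/eqP; rewrite -memv_ker; apply: (subvP _ _ uK); apply: Krel_le.
  rewrite lkerE -subv0; apply: asym_le => F i j iF ij; rewrite memv0.
  suff -> : swap_raw i j F = swap_raw 0 1 F.
    by rewrite -swapE -/(exch I) transfer_exch addNr.
  suff e : tperm i j = tperm 0 1 by rewrite /swap_raw e.
  case: i j ij => [[|[|//]] ?] [[|[|//]] ?] // _; last rewrite tpermC;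
    by congr (tperm _ _); apply: val_inj.
move=> f x y z fF; rewrite !memv_ker /rel1 /rel2.
have fF' : is_forest (f, [tuple of y :: [tuple of z :: [tuple x]]]).
  exact: forest_perm3 (forest_swap2 fF).
have [h1 h2] := transfer_tri_at fF'; split.
  by rewrite linearD /= h2 addNr.
by rewrite linearB /= h1 (lie_atC f x z) linearN /= opprK addNr.
Qed.

(** As [Phi] kills the relation, i <| x is a bracket; for a vertex o other than i it is also a
    combination of planted trees, hence zero. Without such an o, x lives over the empty set. *)
Lemma transfer_pt_inj i (x : tpow {x : I | x != i} 1) : pt i x \in Krel I -> x = 0.
Proof.
move=> xK; apply: tpow_inhab => -[o]; rewrite eq_sym => oi.
have fx : fits [set i] (pt i x).
  rewrite (tpow_dec x) linear_sum; apply: fits_sum => T _.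
  have FT := valP T; have pF := pt_raw_forest FT.
  have -> : [set i] = component (pt_raw (val T)).1 i.
    by apply/setP => y; rewrite !inE isolated_conn // => z; apply: pt_raw_noi.
  rewrite linearZ /= pt_bas //; apply: fitsZ; exact: Phi_bas pF.
move: fx; rewrite /fits transfer_Krel // linear0 sub0r memvN => xd.
have : planting i x \in limg (d2 I) by rewrite /planting comp_lfunE.
by move/(planted_indep (planting_planted x oi))/planting_inj.
Qed.

End Kernel.

Lemma pt_Krel_inj i (x : tpow {x : I | x != i} 1) : pt i x \in Krel I -> x = 0.
Proof. by have [Phi [Pv Pd Pb]] := transfer_ex; apply: (transfer_pt_inj Pv Pd Pb). Qed.

End Transfer.

(** * Insertion *)

Section InsertionTheory.
Variables (I J : finType) (i : I).
Local Notation K := (insertion i J).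
Local Notation Ii := {x : I | x != i}.
Implicit Types (f : {ffun I -> option I}) (g : {ffun J -> option J}).
Implicit Types (d : {ffun I -> option J}) (j : J) (x y r s v : I) (z : K).

(* [d] gives the new ends, in J, of the edges incoming at i. *)
Definition redirects f d : bool := [forall x, isSome (d x) == (f x == Some i)].

(** The parent function of [insert_raw], with [d] defined on all of I, so that its type does not
    depend on [f]; this matters when [f] is grafted. *)
Definition ins_fun f g d : {ffun K -> option K} :=
  [ffun z => match z with
     | inl x => if d (val x) is Some j then Some (inr j)
                else obind (outside J i) (f (val x))
     | inr j => if g j is Some j' then Some (inr j')
                else obind (outside J i) (f i)
     end].

Definition ins_root j0 x : K := odflt (inr j0) (outside J i x).

Definition ins_origin z : I := if z is inl x then val x else i.

Lemma outsideP x : if x == i then outside J i x = None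
  else exists2 x' : Ii, outside J i x = Some (inl x') & val x' = x.
Proof.
rewrite /outside; case: insubP => [x' xi <-|].
  by rewrite (negPf (valP x')); exists x'.
by rewrite negbK => ->.
Qed.

Lemma outside_val (x : Ii) : outside J i (val x) = Some (inl x).
Proof. by rewrite /outside valK. Qed.

Lemma ins_rootE j0 x z : (z == ins_root j0 x) =
  match z with inl x' => val x' == x | inr j => (x == i) && (j == j0) end.
Proof.
rewrite /ins_root; have := outsideP x; case: eqVneq => [->|xi].
  by move=> ->; case: z => [x'|j] //=; rewrite (negPf (valP x')).
by case=> x' -> <-; case: z.
Qed.

Lemma insertE k (F : raw_forest I k) (G : raw_forest J 1) :
  insert i F G = \sum_(d | redirects F.1 d)
    bas (ins_fun F.1 G.1 d, map_tuple (ins_root (thead G.2)) F.2).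
Proof.
pose h (c : {ffun {x : I | F.1 x == Some i} -> J}) : {ffun I -> option J} :=
  [ffun x => omap c (insub x)].
pose h' (d : {ffun I -> option J}) : {ffun {x : I | F.1 x == Some i} -> J} :=
  [ffun e => odflt (thead G.2) (d (val e))].
rewrite (reindex_onto h h') => [|d /forallP dF].
  rewrite /insert; apply: eq_big => [c|c _].
    apply/esym/andP; split.
      by apply/forallP => x; rewrite ffunE; case: insubP => [e -> //|/negPf->].
    by apply/eqP/ffunP => e; rewrite !ffunE valK.
  congr (bas (_, _)).
    apply/ffunP => -[x|j]; rewrite !ffunE //.
    by case: insubP => [e _ <-|].
  by apply: eq_from_tnth => l; rewrite tnth_mktuple tnth_map.
apply/ffunP => x; rewrite ffunE; have := dF x.
case: insubP => [e -> <-|/negPf->] /=; first by rewrite ffunE; case: (d _).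
by case: (d x).
Qed.

Section Forest.
Variables (k : nat) (f : {ffun I -> option I}) (rs : k.-tuple I).
Variables (g : {ffun J -> option J}) (j0 : J) (d : {ffun I -> option J}).
Hypothesis fF : is_forest (f, rs).
Hypothesis gF : is_forest (g, [tuple of j0 :: [tuple]]).
Hypothesis dF : redirects f d.

Lemma redirectsE x : isSome (d x) = (f x == Some i).
Proof. exact: eqP (forallP dF x). Qed.

Lemma tree_rootE j : (g j == None) = (j == j0).
Proof. by rewrite (forest_rootE gF) inE. Qed.

Lemma ins_reach x z : ins_origin z = x ->
  exists r, [/\ r \in rs, connect (edge f) x r
    & connect (edge (ins_fun f g d)) z (ins_root j0 r)].
Proof.
elim/(forest_ind fF): x z => x IH.
have out z : ins_fun f g d z = obind (outside J i) (f x) -> f x != Some i ->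
    (f x = None -> exists2 r, r \in rs & z = ins_root j0 r /\ x = r) ->
    exists r, [/\ r \in rs, connect (edge f) x r
      & connect (edge (ins_fun f g d)) z (ins_root j0 r)].
  move=> zE fxi base; case fx: (f x) => [y|].
    have := outsideP y; case: eqP => [yi|_ [y' yE yy']].
      by rewrite fx yi eqxx in fxi.
    have [r [rrs yr zr]] := IH y fx (inl y') yy'.
    exists r; split=> //; first exact: connect_trans (connect_step fx) yr.
    by apply: connect_trans (connect_step _) zr; rewrite zE fx.
  by have [r rrs [-> ->]] := base fx; exists r; rewrite !connect0.
case=> [x'|j] /= xE.
  case dx: (d x) => [j|].
    have fx : f x = Some i by apply/eqP; rewrite -redirectsE dx.
    have [r [rrs ir zr]] := IH i fx (inr j) erefl.
    exists r; split=> //; first exact: connect_trans (connect_step fx) ir.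
    by apply: connect_trans (connect_step _) zr; rewrite ffunE /= xE dx.
  apply: out; first by rewrite ffunE /= xE dx.
    by rewrite -redirectsE dx.
  move=> fx; exists x; first by rewrite -(forest_rootE fF) fx.
  by split=> //; apply/eqP; rewrite ins_rootE; apply/eqP.
have [u] := forest_reach gF j; rewrite inE => /eqP-> jj0.
have jz : connect (edge (ins_fun f g d)) (inr j) (inr j0).
  apply: connect_homo jj0 => a b /eqP ab.
  by rewrite /edge /= ffunE ab.
have g0 : g j0 = None by apply/eqP; rewrite tree_rootE.
have [|||r [rrs xr zr]] := out (inr j0); first by rewrite ffunE g0 -xE.
- by apply/eqP; rewrite -xE => /(forest_irr fF).
- move=> fx; exists x; first by rewrite -(forest_rootE fF) fx.
  by split=> //; apply/eqP; rewrite ins_rootE -xE !eqxx.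
by exists r; split=> //; apply: connect_trans jz zr.
Qed.

Lemma ins_conn_origin z z' :
  connect (edge (ins_fun f g d)) z z' -> connect (edge f) (ins_origin z) (ins_origin z').
Proof.
case/connectP=> p; elim: p z => [|z1 p IHp] z /=; first by move=> _ ->.
case/andP=> zz1 pp /(IHp _ pp); apply: connect_trans.
move: zz1; rewrite /edge /= ffunE; case: z => [x|j] /=.
  case dx: (d (sval x)) => [j|] /eqP.
    by case=> <-; apply: connect_step; apply/eqP; rewrite -redirectsE dx.
  case fx: (f (sval x)) => [y|] //=; have := outsideP y.
  case: eqP => [_ -> //|_ [y' -> yy']] [<-].
  by apply: connect_step; rewrite fx -yy'.
case: (g j) => [j'|] /eqP.
  by case=> <-; apply: connect0.
case fx: (f i) => [y|] //=; have := outsideP y.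
case: eqP => [_ -> //|_ [y' -> yy']] [<-].
by apply: connect_step; rewrite fx -yy'.
Qed.

Lemma ins_origin_root r : ins_origin (ins_root j0 r) = r.
Proof.
rewrite /ins_root; have := outsideP r; case: eqP => [-> -> //|_ [x' -> /=]].
by [].
Qed.

Lemma ins_root_inj : injective (ins_root j0).
Proof. by move=> x y /(congr1 ins_origin); rewrite !ins_origin_root. Qed.

Lemma ins_conn z r : r \in rs ->
  connect (edge (ins_fun f g d)) z (ins_root j0 r) = connect (edge f) (ins_origin z) r.
Proof.
move=> rrs; apply/idP/idP => [/ins_conn_origin|zr]; first by rewrite ins_origin_root.
have [r' [r'rs zr' zz]] := ins_reach (erefl (ins_origin z)).
by rewrite (forest_root_uniq fF rrs r'rs zr zr').
Qed.

Lemma ins_forest : is_forest (ins_fun f g d, map_tuple (ins_root j0) rs).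
Proof.
apply/is_forestP; split.
- by rewrite map_inj_uniq; [case/is_forestP: fF | apply: ins_root_inj].
- have out x : f x != Some i -> (obind (outside J i) (f x) == None) = (x \in rs).
    rewrite -(forest_rootE fF); case: (f x) => [y|] //= yi.
    have := outsideP y; rewrite ifN; last by apply: contra yi => /eqP->.
    by case=> x' ->.
  case=> [x|j]; rewrite ffunE.
    have -> : (inl x \in map (ins_root j0) rs) = (val x \in rs).
      have -> : inl x = ins_root j0 (val x) by apply/eqP; rewrite ins_rootE.
      exact: mem_map ins_root_inj _ _.
    have := redirectsE (val x); case: (d _) => [j|] /=.
      by move/esym/eqP => fx; rewrite -(forest_rootE fF) fx.
    by move/esym/negbT/out.
  have gj := tree_rootE j; case gj': (g j) gj => [j'|] /esym /= jj0.
    apply/esym/mapP => -[r _ /eqP]; rewrite ins_rootE jj0 andbF //.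
  rewrite out; last by apply/eqP => /(forest_irr fF).
  have -> : inr j = ins_root j0 i by apply/eqP; rewrite ins_rootE eqxx jj0.
  by apply/esym; apply: mem_map ins_root_inj _ _.
move=> z; have [r [rrs _ zr]] := ins_reach (erefl (ins_origin z)).
by exists (ins_root j0 r) => //; apply: map_f.
Qed.

End Forest.
End InsertionTheory.

Section InsertGraft.
Variables (I J : finType) (i : I) (k : nat).
Local Notation K := (insertion i J).
Variables (f : {ffun I -> option I}) (r s : I) (rest : k.-tuple I).
Variables (g : {ffun J -> option J}) (j0 : J).
Hypothesis fF : is_forest (f, [tuple of r :: s :: rest]).
Hypothesis gF : is_forest (g, [tuple of j0 :: [tuple]]).
Implicit Types (d : {ffun I -> option J}) (z : K) (v x : I).

Let fs : f s = None.
Proof. by apply: (forest_None fF); rewrite !inE eqxx orbT. Qed.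

(** A vertex z of the inserted forest amounts to v = [ins_origin z] and, if v = i, to the vertex of
    J at which the new edge from s ends. *)
Definition redirect_graft d z : {ffun I -> option J} :=
  [ffun x => if x == s then (if z is inr j then Some j else None) else d x].

Definition redirect_cut d : {ffun I -> option J} :=
  [ffun x => if x == s then None else d x].

Lemma redirects_root d : redirects i f d -> d s = None.
Proof. by move/redirectsE => /(_ s); rewrite fs; case: (d s). Qed.

Lemma redirects_graft d z : redirects i f d ->
  redirects i (graft f s (ins_origin z)) (redirect_graft d z).
Proof.
move=> dF; apply/forallP => x; rewrite !ffunE.
have [_|_] := eqVneq x s; last by rewrite (redirectsE dF).
case: z => [v|j] /=; last by rewrite eqxx.
by rewrite (inj_eq Some_inj) (negPf (valP v)).
Qed.

Lemma ins_graft d z : redirects i f d -> connect (edge f) (ins_origin z) r ->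
  graft (ins_fun i f g d) (ins_root i j0 s) z =
  ins_fun i (graft f s (ins_origin z)) g (redirect_graft d z).
Proof.
move=> dF zr; apply/ffunP => y; rewrite [LHS]ffunE ins_rootE [RHS]ffunE.
have zout : s = i -> exists z' : {x : I | x != i}, z = inl z'.
  move=> si; case: z zr => [z' _|j]; first by exists z'.
  by rewrite /= -si => /(forest_root12 fF); rewrite connect0.
case: y => [y|j].
  rewrite !ffunE; have [ys|ys] := eqVneq (val y) s.
    by case: z {zr zout} => [z'|j] //=; rewrite outside_val.
  by [].
rewrite !ffunE; have [si|//] := eqVneq s i => /=.
have [->|jj0] := eqVneq j j0; last first.
  by move: jj0; rewrite -(tree_rootE gF); case: (g j).
have -> : g j0 = None by apply/eqP; rewrite (tree_rootE gF).
by have [z' ->] := zout si; rewrite /= outside_val.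
Qed.

(** Insertion commutes with grafting: grafting at v and then choosing new ends is the same as
    choosing the ends of the old edges and then grafting at a vertex z of the inserted tree. The
    bijection sends (d, z) to ([ins_origin z], [redirect_graft d z]). *)
Lemma insert_graft_sum :
  \sum_(v | connect (edge f) v r) \sum_(d | redirects i (graft f s v) d)
    bas (ins_fun i (graft f s v) g d, map_tuple (@ins_root I J i j0) [tuple of r :: rest]) =
  \sum_(d | redirects i f d)
    tri_at (ins_fun i f g d) (ins_root i j0 r) (ins_root i j0 s)
      (map_tuple (@ins_root I J i j0) rest).
Proof.
rewrite /tri_at !pair_big_dep /=.
pose h (q : {ffun I -> option J} * K) := (ins_origin q.2, redirect_graft q.1 q.2).
pose h' (p : I * {ffun I -> option J}) : {ffun I -> option J} * K :=
  (redirect_cut p.2, if p.2 s is Some j then inr j else ins_root i j0 p.1).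
have rF : r \in [tuple of r :: s :: rest] by rewrite inE eqxx.
have hE d z : (connect (edge f) (ins_origin z) r
     && redirects i (graft f s (ins_origin z)) (redirect_graft d z))
     && (h' (h (d, z)) == (d, z))
   = redirects i f d && connect (edge f) (ins_origin z) r.
  apply/andP/andP => [[/andP[zr dF] /eqP[dE _]]|[dF zr]].
    split=> //; apply/forallP => x; have := forallP dF x; rewrite -dE !ffunE.
    by have [->|_] := eqVneq x s; rewrite ?fs.
  rewrite zr redirects_graft //; split=> //; apply/eqP.
  rewrite /h' /h /= ffunE eqxx; congr (_, _).
    apply/ffunP => x; rewrite !ffunE; have [->|//] := eqVneq x s.
    by rewrite redirects_root.
  by case: z {zr} => // z; apply/esym/eqP; rewrite ins_rootE.
rewrite (reindex_onto h h') => [|[v d] /= /andP[vr dF]].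
  apply: eq_big => [[d z]|[d z]] /=; rewrite hE.
    have [dF|//] := boolP (redirects i f d).
    by rewrite (ins_conn fF gF dF).
  case/andP=> dF zr; rewrite ins_graft //; congr (bas (_, _)).
have ds : isSome (d s) = (v == i).
  by rewrite (redirectsE dF) ffunE eqxx.
have vE : ins_origin (if d s is Some j then inr j else ins_root i j0 v) = v.
  by case: (d s) ds => [j /= /esym/eqP //|_]; apply: ins_origin_root.
rewrite /h /= vE; congr (_, _); apply/ffunP => x; rewrite !ffunE.
have [->|//] := eqVneq x s.
case: (d s) ds => [j //|] /= /esym/negbT vi.
have := ins_rootE (i := i) j0 v (ins_root i j0 v); rewrite eqxx.
by case: (ins_root i j0 v) => // j /esym/andP[/eqP e _]; rewrite e eqxx in vi.
Qed.

End InsertGraft.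

Section WeightedSum.
Variables (B D : finType) (V : lmodType rat).
Implicit Types (t : {ffun B -> rat^o}) (P : pred D) (h : B -> D -> V).

(** The form of a partial composition with t: G runs over the inserted trees and d over the choices
    of new ends. *)
Definition wsum t P h : V := \sum_G t G *: \sum_(d | P d) h G d.

Lemma wsumD t P h h' : wsum t P h + wsum t P h' = wsum t P (fun G d => h G d + h' G d).
Proof.
rewrite /wsum -big_split; apply: eq_bigr => G _.
by rewrite /= -scalerDr -big_split.
Qed.

Lemma wsumB t P h h' : wsum t P h - wsum t P h' = wsum t P (fun G d => h G d - h' G d).
Proof. by rewrite /wsum -sumrB; apply: eq_bigr => G _; rewrite -scalerBr -sumrB. Qed.

Lemma eq_wsum t P h h' : (forall G d, h G d = h' G d) -> wsum t P h = wsum t P h'.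
Proof.
by move=> hh'; apply: eq_bigr => G _; congr (_ *: _); apply: eq_bigr => d _.
Qed.

End WeightedSum.

Lemma memv_wsum (B D : finType) (V : vectType rat) (U : {vspace V})
    (t : {ffun B -> rat^o}) (P : pred D) (h : B -> D -> V) :
  (forall G d, P d -> h G d \in U) -> wsum t P h \in U.
Proof. by move=> hU; apply: memv_suml => G _; apply/memvZ/memv_suml => d; apply: hU. Qed.

Lemma wsum_bas (J D : finType) (V : lmodType rat) (F : raw_forest J 1)
    (iF : is_forest F) (P : pred D) (d0 : D) (h : forest J 1 -> D -> V) :
  (forall d, P d = (d == d0)) -> wsum (bas F) P h = h (Sub F iF) d0.
Proof.
move=> Pd; rewrite /wsum (bigD1 (Sub F iF)) //= [X in _ + X]big1 => [|G GF].
  by rewrite basE SubK eqxx scale1r addr0 (eq_bigl (pred1 d0)) ?big_pred1_eq.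
rewrite basE; case: eqP => [GE|_]; last by rewrite scale0r.
by case/eqP: GF; apply: val_inj; rewrite SubK.
Qed.

Lemma pcomp_sum (I J : finType) (i : I) k (t : tpow J 1) (A : finType) (Q : pred A)
    (F : A -> raw_forest I k) :
  (forall v, Q v -> is_forest (F v)) ->
  Defs.pcomp i k t (\sum_(v | Q v) bas (F v)) =
  \sum_(G : forest J 1) t G *: \sum_(v | Q v) insert i (F v) (val G).
Proof.
move=> FF; rewrite linear_sum.
under [RHS]eq_bigr do rewrite scaler_sumr.
rewrite [RHS]exchange_big; apply: eq_bigr => v Qv.
exact: tpow_extE (FF v Qv).
Qed.

Lemma pcomp_tri_at (I J : finType) (i : I) k (t : tpow J 1)
    (f : {ffun I -> option I}) (r s : I) (rest : k.-tuple I) :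
  is_forest (f, [tuple of r :: s :: rest]) ->
  Defs.pcomp i k.+1 t (tri_at f r s rest) = wsum t (redirects i f) (fun G d =>
    tri_at (ins_fun i f (val G).1 d) (ins_root i (thead (val G).2) r)
      (ins_root i (thead (val G).2) s)
      (map_tuple (@ins_root I J i (thead (val G).2)) rest)).
Proof.
move=> fF; rewrite /tri_at pcomp_sum => [|v vr]; last exact: graft_forest fF _ vr.
rewrite /wsum; apply: eq_bigr => G _; congr (_ *: _).
have gF : is_forest ((val G).1, [tuple of thead (val G).2 :: [tuple]]).
  by case: G => -[g R] /= gF; rewrite -tuple1E.
apply: etrans (insert_graft_sum i fF gF).
by apply: eq_bigr => v _; rewrite insertE.
Qed.

(** * Stability of the relations under relabelling and insertion *)

Section RelationsAct.
Variables (I J : finType) (s : bij I J).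
Implicit Types (f : {ffun I -> option I}) (x y z : I).

Definition act_fun f : {ffun J -> option J} := [ffun y => omap s (f (binv s y))].

Lemma tri_at_act1 f x y z :
  tact 2 s (tri_at f x y [tuple z]) = tri_at (act_fun f) (s x) (s y) [tuple s z].
Proof. by rewrite tri_at_act; congr tri_at; apply: val_inj. Qed.

Lemma tact_rel f x y z :
  tact 2 s (rel1 f x y z) = rel1 (act_fun f) (s x) (s y) (s z) /\
  tact 2 s (rel2 f x y z) = rel2 (act_fun f) (s x) (s y) (s z).
Proof.
split; first by rewrite /rel1 linearD /= !tri_at_act1.
by rewrite /rel2 /lie_at !linearB /= !tri_at_act1.
Qed.

End RelationsAct.

Section RelationsComp.
Variables (I J : finType) (i : I) (t : tpow J 1).
Implicit Types (f : {ffun I -> option I}) (x y z : I).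

Let ins_rel (rel : {ffun insertion i J -> option (insertion i J)} ->
    insertion i J -> insertion i J -> insertion i J -> tpow (insertion i J) 2)
    f x y z (G : forest J 1) (d : {ffun I -> option J}) : tpow (insertion i J) 2 :=
  rel (ins_fun i f (val G).1 d) (ins_root i (thead (val G).2) x)
    (ins_root i (thead (val G).2) y) (ins_root i (thead (val G).2) z).

Lemma pcomp_tri_at1 f a b c : is_forest (f, [tuple of a :: b :: [tuple c]]) ->
  Defs.pcomp i 2 t (tri_at f a b [tuple c]) =
  wsum t (redirects i f) (ins_rel (fun h u v w => tri_at h u v [tuple w]) f a b c).
Proof.
move=> abcF; rewrite pcomp_tri_at //; apply: eq_wsum => G d.
Qed.

Lemma pcomp_rel f x y z :
  is_forest (f, [tuple of x :: [tuple of y :: [tuple z]]]) ->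
  Defs.pcomp i 2 t (rel1 f x y z) =
    wsum t (redirects i f) (ins_rel (@rel1 _) f x y z) /\
  Defs.pcomp i 2 t (rel2 f x y z) =
    wsum t (redirects i f) (ins_rel (@rel2 _) f x y z).
Proof.
move=> fF.
have F1 : is_forest (f, [tuple of y :: x :: [tuple z]]) by apply: forest_swap2 fF.
have F2 : is_forest (f, [tuple of x :: z :: [tuple y]]) by apply: forest_perm3 fF.
have F3 : is_forest (f, [tuple of y :: z :: [tuple x]]) by apply: forest_perm3 F1.
have F4 : is_forest (f, [tuple of z :: x :: [tuple y]]) by apply: forest_swap2 F2.
have pD u v : Defs.pcomp i 2 t (u + v) = Defs.pcomp i 2 t u + Defs.pcomp i 2 t v.
  exact: linearD.
have pB u v : Defs.pcomp i 2 t (u - v) = Defs.pcomp i 2 t u - Defs.pcomp i 2 t v.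
  exact: linearB.
split; first by rewrite /rel1 pD !pcomp_tri_at1 // wsumD.
by rewrite /rel2 /lie_at !pB !pcomp_tri_at1 // !wsumB.
Qed.

(** As insertion commutes with grafting, a relation composed with t is a combination of relations of
    the same kind on the inserted forests. *)
Lemma pcomp_Krel u : u \in Krel I -> Defs.pcomp i 2 t u \in Krel (insertion i J).
Proof.
move=> uK; rewrite memv_preim; apply: (subvP _ _ uK); apply: Krel_le.
  apply/subvP => v va; rewrite -memv_preim asym_Krel //.
  exact: (subvP (pcomp_asym i 2 t)) (memv_img _ va).
move=> f x y z fF; rewrite -!memv_preim; have [-> ->] := pcomp_rel fF.
have ins3 (G : forest J 1) d : redirects i f d -> let j := thead (val G).2 in
    is_forest (ins_fun i f (val G).1 d,
      [tuple of ins_root i j x :: [tuple of ins_root i j y :: [tuple ins_root i j z]]]).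
  case: G => -[g R] /= gF dF; rewrite (tuple1E R) in gF.
  have := ins_forest fF gF dF; congr is_forest; congr (_, _); exact: val_inj.
split; apply: memv_wsum => G d dF.
  exact: rel1_Krel (ins3 G d dF).
exact: rel2_Krel (ins3 G d dF).
Qed.

End RelationsComp.

(** * Comparison with the generators of K_P *)

Section GeneratingRelations.
Variable I : finType.

Lemma exch_Krel u : u \in Krel I -> exch I u \in Krel I.
Proof.
move=> uK; rewrite -[exch I u](addKr u) memvD ?memvN //.
by apply: asym_Krel; apply: addr_exch_asym.
Qed.

Lemma qproj_exch u : qproj (asym I 2) (exch I u) = - qproj (asym I 2) u.
Proof.
apply/eqP; rewrite -addr_eq0 addrC -linearD qproj_eq0; exact: addr_exch_asym.
Qed.

Lemma pair3E (x y z : I) : pair3 x y z =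
  qproj (asym I 2) (bas (graft [ffun=> None] z y, [tuple of x :: [tuple y]])).
Proof.
rewrite /pair3; congr (qproj _ (bas (_, _))).
by apply/ffunP => u; rewrite !ffunE.
Qed.

Lemma tri_at_nil (x y z : I) :
  qproj (asym I 2) (exch I (tri_at [ffun=> None] y z [tuple x])) = pair3 x y z.
Proof.
rewrite pair3E tri_at_isolated; last by move=> u; rewrite ffunE.
by rewrite exch_bas.
Qed.

Lemma rel_nil (x y z : I) :
  qproj (asym I 2) (exch I (rel1 [ffun=> None] x y z)) =
    pair3 x y z + pair3 z y x /\
  qproj (asym I 2) (exch I (rel2 [ffun=> None] x y z)) =
    - (pair3 x y z - (pair3 y x z - pair3 y z x)).
Proof.
rewrite /rel1 /rel2 /lie_at.
rewrite (linearD (exch I)) (linearB (exch I)) (linearB (exch I)) /=.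
rewrite (linearD (qproj _)) (linearB (qproj _)) (linearB (qproj _)) /=.
by rewrite !tri_at_nil opprB.
Qed.

Lemma nil_forest (x y z : I) : uniq [:: x; y; z] ->
  (forall w, w \in [:: x; y; z]) ->
  is_forest ([ffun=> None], [tuple of x :: [tuple of y :: [tuple z]]]).
Proof.
move=> u w; apply/is_forestP; split=> // [v|v]; first by rewrite ffunE eqxx w.
by exists v; [apply: w | apply: connect0].
Qed.

End GeneratingRelations.

Lemma Lam_actE (I J : finType) (s : bij I J) v :
  sact (Lam 2) s (qproj (asym I 2) v) = qproj (asym J 2) (tact 2 s v).
Proof. exact: (quo_actE (@asym_stable 2)). Qed.

Lemma K_P_Krel (I : finType) (u : Lam 2 I) : K_P u ->
  exists2 v, v \in Krel I & u = qproj (asym I 2) v.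
Proof.
elim=> {I u}.
- move=> I x y z u w; exists (exch I (rel1 [ffun=> None] x y z)).
    by apply: exch_Krel; apply: rel1_Krel; apply: nil_forest.
  by have [-> _] := rel_nil x y z.
- move=> I x y z u w; exists (- exch I (rel2 [ffun=> None] x y z)).
    by rewrite memvN; apply: exch_Krel; apply: rel2_Krel; apply: nil_forest.
  by rewrite linearN /=; have [_ ->] := rel_nil x y z; rewrite opprK.
- by move=> I; exists 0; rewrite ?mem0v ?linear0.
- move=> I a _ _ _ [v vK ->] _ [w wK ->]; exists (a *: v + w).
    by rewrite memvD ?memvZ.
  by rewrite linearP.
- move=> I J s _ _ [v vK ->]; exists (tact 2 s v); last exact: Lam_actE.
  rewrite memv_preim; apply: (subvP _ _ vK); apply: Krel_le.
    apply/subvP => w wa; rewrite -memv_preim asym_Krel //.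
    exact: (subvP (@asym_stable 2 I J s)) (memv_img _ wa).
  move=> f x y z fF; rewrite -!memv_preim; have [-> ->] := tact_rel s f x y z.
  have gF : is_forest (act_fun s f, [tuple of s x :: [tuple of s y :: [tuple s z]]]).
    by have := is_forest_act s fF; congr is_forest; congr (_, _); apply: val_inj.
  by rewrite rel1_Krel ?rel2_Krel.
move=> I J i t _ _ [v vK ->]; exists (Defs.pcomp i 2 t v); last by rewrite lcompE.
exact: pcomp_Krel.
Qed.

(** * Contraction of a component *)

(* The component of the root a is contracted to the single vertex a; inserting
   it back recovers the forest. *)
Section Contraction.
Variables (I : finType) (k : nat) (f : {ffun I -> option I}) (rs : k.-tuple I) (a : I).
Hypothesis fF : is_forest (f, rs).
Hypothesis ars : a \in rs.

Definition below x := connect (edge f) x a.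
Definition kept x := (x == a) || ~~ below x.

Local Notation Ib := {x : I | below x}.
Local Notation Ik := {x : I | kept x}.

Let fa : f a = None. Proof. exact: (forest_None fF ars). Qed.

Lemma below_parent x y : below x -> f x = Some y -> below y.
Proof. by rewrite /below => xa fx; rewrite -(conn_up fF ars (connect_step fx)). Qed.

Lemma kept_parent x y : kept x -> f x = Some y -> kept y.
Proof.
rewrite /kept => /orP[/eqP->|xa] fx; first by rewrite fa in fx.
by rewrite /below -(conn_up fF ars (connect_step fx)) xa orbT.
Qed.

Lemma below_a : below a. Proof. exact: connect0. Qed.
Lemma kept_a : kept a. Proof. by rewrite /kept eqxx. Qed.

Definition ab : Ib := Sub a below_a.
Definition ak : Ik := Sub a kept_a.

Local Notation K := (insertion ak Ib).

Definition expand (z : K) : I :=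
  match z with inl x => val (val x) | inr j => val j end.

Definition collapse (x : I) : K :=
  if insub x is Some j then inr j
  else odflt (inr ab) (obind (outside Ib ak) (insub x)).

Lemma expandK : cancel expand collapse.
Proof.
case=> [x|j] /=; last by rewrite /collapse valK.
have xa : val (val x) != a.
  by apply: contraNneq (valP x) => e; apply/eqP/val_inj.
have xb : ~~ below (val (val x)).
  by have := valP (val x); rewrite /kept (negPf xa).
by rewrite /collapse insubN // valK /= outside_val.
Qed.

Lemma collapseK : cancel collapse expand.
Proof.
move=> x; rewrite /collapse; case: insubP => [j _ //|xb].
have xk : kept x by rewrite /kept xb orbT.
rewrite insubT /=; have := outsideP Ib ak (Sub x xk).
case: eqP => [e|_ [x' -> /= ->]]; last by rewrite SubK.
by case/negP: xb; rewrite (_ : x = a) ?below_a //; apply: (congr1 val e).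
Qed.

Definition expand_bij : bij K I := Bij expandK collapseK.

Definition f_kept := restrict_fun kept f.
Definition f_below := restrict_fun below f.

Lemma f_below_forest : is_forest (f_below, [tuple of ab :: [tuple]]).
Proof.
apply: (restrict_forest below_parent fF) => // x; rewrite inE.
apply/eqP/idP => [->|xrs]; first exact: ars.
apply: val_inj => /=; apply: (forest_root_uniq fF xrs ars); first exact: connect0.
exact: valP x.
Qed.

(** An edge ending at a starts in the component of a, so the contracted vertex has no incoming edge:
    inserting the component back involves no choice and gives a single term. *)
Lemma ak_isolated x : f_kept x <> Some ak.
Proof.
move=> fx; have := restrict_funE kept_parent x; rewrite -/f_kept fx /= => /esym fxa.
have := valP x; rewrite /kept /below (connect_step fxa) orbF => /eqP xa.
by rewrite xa fa in fxa.
Qed.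

Lemma expand_fun d : redirects ak f_kept d ->
  act_fun expand_bij (ins_fun ak f_kept f_below d) = f.
Proof.
move=> dF; have d0 x : d x = None.
  have := redirectsE dF x; case: (d x) => // j /esym/eqP.
  by move/ak_isolated.
apply/ffunP => x; rewrite -[x](binvK expand_bij) ffunE bfunK.
move: (binv expand_bij x) => {x} [x|j]; rewrite ffunE.
  rewrite d0 /= -(restrict_funE kept_parent (val x)) -/f_kept.
  case fx: (f_kept (val x)) => [y|] //=.
  have := outsideP Ib ak y; case: eqP => [ya|_ [y' -> /= ->]] //.
  by rewrite ya in fx; case: (ak_isolated fx).
rewrite [RHS](esym (restrict_funE below_parent j)) -/f_below.
case gj: (f_below j) => [j'|] //=.
have -> : f_kept ak = None; last by [].
by have := restrict_funE kept_parent ak; rewrite -/f_kept /= fa; case: (f_kept _).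
Qed.

Lemma expand_root (x : Ik) : expand_bij (ins_root ak ab x) = val x.
Proof.
rewrite /ins_root; have := outsideP Ib ak x.
by case: eqP => [-> -> //|_ [x' -> /= ->]].
Qed.

Lemma redirects_noneP (d : {ffun Ik -> option Ib}) :
  redirects ak f_kept d = (d == [ffun=> None]).
Proof.
apply/idP/eqP => [dF|->]; last first.
  apply/forallP => x; rewrite ffunE /=; apply/eqP/esym/negbTE/eqP.
  exact: ak_isolated.
apply/ffunP => x; rewrite ffunE.
have := redirectsE dF x; case: (d x) => // j /esym/eqP.
by move/ak_isolated.
Qed.

End Contraction.

(** Induction on the number of vertices. If all vertices are among x, y, z, these are the generators
    of K_P up to sign. Otherwise a tree with more than one vertex is contracted to its root; the
    smaller relation lies in K_P, and composing it with the contracted tree, then relabelling,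
    restores the given one. *)
Lemma rel_K_P n (I : finType) (f : {ffun I -> option I}) (x y z : I) :
  (#|I| < n)%N -> is_forest (f, [tuple of x :: [tuple of y :: [tuple z]]]) ->
  K_P (qproj (asym I 2) (rel1 f x y z)) /\ K_P (qproj (asym I 2) (rel2 f x y z)).
Proof.
elim: n I f x y z => // n IHn I f x y z; rewrite ltnS => In fF.
have K_PN (u : Lam 2 I) : K_P u -> K_P (- u).
  by move=> Ku; rewrite -[- u]addr0 -scaleN1r; apply: K_lin => //; apply: K_zero.
have [/forallP allr|/forallPn[v vr]] := boolP [forall v, v \in [:: x; y; z]].
  have u : uniq [:: x; y; z] by case/is_forestP: fF.
  have f0 : f = [ffun=> None].
    by apply/ffunP => v; rewrite ffunE; apply: (forest_None fF); apply: allr.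
  have [e1 e2] := rel_nil x y z.
  split; rewrite f0 -[qproj _ _]opprK -qproj_exch; apply/K_PN.
    by rewrite e1; apply: K_rel1.
  by rewrite e2; apply: K_PN; apply: K_rel2.
have [a ars va] := forest_reach fF v.
set rs := [tuple of x :: _] in fF ars.
have ka u : u \in rs -> kept f a u.
  move=> urs; rewrite /kept /below; have [//|ua] := eqVneq u a.
  by rewrite (root_conn fF urs ars) (negPf ua).
have [xrs yrs zrs] : [/\ x \in rs, y \in rs & z \in rs].
  by rewrite !inE !eqxx !orbT.
pose x1 : {u | kept f a u} := Sub x (ka x xrs).
pose y1 : {u | kept f a u} := Sub y (ka y yrs).
pose z1 : {u | kept f a u} := Sub z (ka z zrs).
have F1 : is_forest (f_kept f a, [tuple of x1 :: [tuple of y1 :: [tuple z1]]]).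
  apply: (restrict_forest (kept_parent fF ars) fF) => /=.
    by rewrite !inE -!(inj_eq val_inj) /=; case/is_forestP: fF => /=; rewrite !inE.
  by move=> u; rewrite !inE -!(inj_eq val_inj).
have I1n : (#|{: {u | kept f a u}}| < n)%N.
  apply: leq_trans In; rewrite card_sig; apply: proper_card.
  apply/properP; split; first exact/subsetP.
  exists v => //; rewrite inE /kept /below va orbF.
  by apply: contra vr => /eqP->.
have [K1 K2] := IHn _ _ _ _ _ I1n F1.
have gF := f_below_forest fF ars.
pose t : PreLie {u | below f a u} := bas (f_below f a, [tuple of ab f a :: [tuple]]).
have [c1 c2] := pcomp_rel (ak f a) t F1.
have none := redirects_noneP fF ars.
rewrite (wsum_bas gF _ none) in c1; rewrite (wsum_bas gF _ none) in c2.
have act1 := tact_rel (expand_bij f a) (ins_fun (ak f a) (f_kept f a) (f_below f a) [ffun=> None])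
  (ins_root (ak f a) (ab f a) x1) (ins_root (ak f a) (ab f a) y1)
  (ins_root (ak f a) (ab f a) z1).
rewrite !expand_root (expand_fun fF ars) ?none // in act1; case: act1 => a1 a2.
by rewrite -a1 -a2 -!Lam_actE -c1 -c2 -!lcompE; split; apply/K_act/K_comp.
Qed.

Lemma Krel_K_P (I : finType) u : u \in Krel I -> K_P (qproj (asym I 2) u).
Proof.
move=> uK; apply/K_P_subE; rewrite memv_preim; apply: (subvP _ _ uK); apply: Krel_le.
  apply/subvP => v va; rewrite -memv_preim (eqP (_ : qproj _ v == 0)) ?mem0v //.
  by rewrite qproj_eq0.
move=> f x y z fF; rewrite -!memv_preim.
by have [/K_P_subE -> /K_P_subE ->] := rel_K_P (ltnSn #|I|) fF.
Qed.

Lemma cyc_eq0 (I : finType) (u : tpow I 2) : (cyc u == 0) = (u \in Krel I).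
Proof.
rewrite /cyc qproj_eq0; apply/idP/idP => [/K_P_subE/K_P_Krel[v vK e]|uK]; last first.
  exact/K_P_subE/Krel_K_P.
rewrite -[u](subrK v) memvD //; apply: asym_Krel.
by rewrite -qproj_eq0 linearB /= e subrr.
Qed.

(** * The map Gamma and the vertical maps *)

Section Pairing.
Variable I : finType.
Implicit Types (i a : I).

Definition cyc_hom : 'Hom(tpow I 2, CycPreLie I) :=
  (qproj (K_P_sub I) \o qproj (asym I 2))%VF.

Lemma cyc_homE u : cyc_hom u = cyc u.
Proof. by rewrite /cyc_hom comp_lfunE. Qed.

Lemma cyc_sec (t : CycPreLie I) : exists u, t = cyc u.
Proof. by exists (qsec _ (qsec _ t)); rewrite /cyc !qsecK. Qed.

Lemma cyc_eqP u v : (cyc u = cyc v) <-> (u - v \in Krel I).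
Proof.
rewrite -cyc_eq0 -!cyc_homE linearB /= subr_eq0.
by split=> [->|/eqP].
Qed.

Lemma cyc_exch u : cyc (exch I u) = - cyc u.
Proof. by rewrite /cyc qproj_exch linearN. Qed.

Definition pairing_hom i : 'Hom(PreLie {x : I | x != i}, CycPreLie I) :=
  (cyc_hom \o pt i)%VF.

Lemma pairing_homE i s : pairing_hom i s = pairing s.
Proof. by rewrite /pairing_hom comp_lfunE cyc_homE. Qed.

Lemma lker_pairing i : lker (pairing_hom i) == 0%VS.
Proof.
rewrite -subv0; apply/subvP => s; rewrite memv_ker memv0 pairing_homE => /eqP s0.
apply/eqP/pt_Krel_inj; rewrite -cyc_eq0; exact/eqP.
Qed.

(** Representatives of the pair serve at the vertices of T_a, those of the exchanged pair, negated,
    at the vertices of T_b. So the class is represented at every vertex, and the sum is a bracket as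
    it is congruent to [T_a, T_b]. *)
Lemma cyc_bas_pairing (f : {ffun I -> option I}) a b :
  is_forest (f, [tuple of a :: [tuple b]]) ->
  exists x : forall i, tpow {x : I | x != i} 1,
    (forall i, cyc (bas (f, [tuple of a :: [tuple b]])) = pairing (x i)) /\
    \sum_i planting i (x i) \in limg (d2 I).
Proof.
move=> fF; set u := bas _.
have [x [ux Kx]] := represented_bas fF.
have [y [uy Ky]] := represented_bas (forest_swap2 fF).
exists (fun i => if i \in component f a then x i else - y i); split.
  move=> i; rewrite -pairing_homE; case: ifP => ia.
    by rewrite pairing_homE; apply/cyc_eqP/Kx.
  rewrite linearN /= pairing_homE -[cyc u]opprK -cyc_exch; congr (- _).
  rewrite exch_bas; apply/cyc_eqP/Ky.
  by rewrite (component_other fF) inE ia.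
rewrite (bigID [in component f a]) /=.
rewrite [X in X + _](eq_bigr (fun i => planting i (x i))) => [|i ->] //.
rewrite [X in _ + X](eq_bigr (fun i => - planting i (y i))) => [|i /negPf->]; last first.
  by rewrite linearN.
rewrite sumrN [X in _ - X](eq_bigl [in component f b]) => [|i]; last first.
  by rewrite /= (component_other fF) [in RHS]inE.
have := memvB (memv_img (d2 I) (memvf u)) (memvB ux uy).
rewrite d2_tri exch_bas -/u; set T := tri I _; set T' := tri I _.
set SA := \sum_(i in _) _; set SB := \sum_(i in _) _.
suff -> : T - T' - (T - SA - (T' - SB)) = SA - SB by [].
by apply/ffunP => G; rewrite !ffunE; ring.
Qed.

Lemma limg_pairing i : limg (pairing_hom i) = fullv.
Proof.
apply/vspaceP => t; rewrite memvf; have [u ->] := cyc_sec t.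
rewrite -cyc_homE (tpow_dec u) linear_sum memv_suml //= => -[[f R] fF] _.
rewrite linearZ memvZ //=; rewrite (pair_tuple i R) in fF *.
have [x [xE _]] := cyc_bas_pairing fF.
by rewrite cyc_homE (xE i) -pairing_homE memv_img ?memvf.
Qed.

End Pairing.

(** A two-sided inverse, since [pairing_hom i] has zero kernel and full image. *)
Definition Gamma : Gamma_type := fun I i => ((pairing_hom i)^-1)%VF.

Lemma pairingK (I : finType) (i : I) s : Gamma i (pairing s) = s.
Proof. by rewrite /Gamma -pairing_homE lker0_lfunK // lker_pairing. Qed.

Lemma GammaK (I : finType) (i : I) t : pairing (Gamma i t) = t.
Proof. by rewrite -pairing_homE /Gamma limg_lfunVK // limg_pairing memvf. Qed.

Lemma GammaP : Gamma_spec Gamma.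
Proof. by move=> I i t s; split=> ->; rewrite ?pairingK ?GammaK. Qed.

Lemma Gamma_eq0 (I : finType) (i : I) t : Gamma i t = 0 -> t = 0.
Proof. by move=> t0; rewrite -(GammaK i t) t0 -pairing_homE linear0. Qed.

Section Columns.
Variables (I : finType) (C : vectType rat).

(** Such sums form a subspace U that contains the pure tensors, so the projection modulo U is
    zero. *)
Lemma tens_dec (w : tensor {ffun I -> rat^o} C) :
  exists t : I -> C, w = \sum_a tens (point a : {ffun I -> rat^o}) (t a).
Proof.
pose U := (\sum_(a : I) limg (linfun (tens (W := C) (point a))))%VS.
have UT : qproj U = 0.
  apply: tens_span => v t; rewrite zero_lfunE; apply/eqP; rewrite qproj_eq0.
  have -> : tens v t = \sum_a v a *: tens (point a) t.
    rewrite {1}(point_dec v) /tens linear_sum linear_sum mulmx_suml.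
    by apply: eq_bigr => a _; rewrite linearZ linearZ /= scalemxAl.
  apply: memv_suml => a _; rewrite memvZ // (subvP (sumv_sup a _ (subvv _))) //.
  by apply/memv_imgP; exists t; rewrite ?memvf ?lfunE.
have: w \in U by rewrite -qproj_eq0 UT zero_lfunE.
case/memv_sumP => ws wsP ->.
have ex a : exists t, ws a = tens (point a) t.
  by have /memv_imgP[t _ ->] := wsP a isT; exists t; rewrite lfunE.
by have [t tP] := choice ex; exists t; apply: eq_bigr => a _.
Qed.

Lemma tens_point_eq (V : vectType rat)
    (f g : 'Hom(tensor {ffun I -> rat^o} C, V)) :
  (forall a t, f (tens (point a) t) = g (tens (point a) t)) -> f = g.
Proof.
move=> fg; apply/lfunP => w; have [t ->] := tens_dec w.
by rewrite !linear_sum; apply: eq_bigr => a _; apply: fg.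
Qed.

End Columns.

Section Psi.
Variable I : finType.
Local Notation psi := (psi Gamma).

Lemma psi_sum (t : I -> CycPreLie I) :
  vsval (psi I (\sum_a tens (point a : Defs.Perm I) (t a))) =
  \sum_a planting a (Gamma a (t a)).
Proof.
rewrite linear_sum linear_sum; apply: eq_bigr => a _.
by rewrite /= psiE /planting comp_lfunE.
Qed.

Lemma iota_sum t : iota_cyc I t = \sum_a tens (point a : Defs.Perm I) t.
Proof. by rewrite /iota_cyc sum_lfunE; apply: eq_bigr => a _; rewrite lfunE. Qed.

Lemma planting_sum_eq0 (x : forall i : I, tpow {x : I | x != i} 1) i :
  root_proj [set i] (\sum_j planting j (x j)) = 0 -> x i = 0.
Proof.
rewrite root_proj_sum_planting (big_pred1 i) => [|j]; last by rewrite inE.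
exact: planting_inj.
Qed.

Lemma lker_psi : lker (psi I) == 0%VS.
Proof.
rewrite -subv0; apply/subvP => w; rewrite memv_ker memv0 => /eqP w0.
have [t wE] := tens_dec w; apply/eqP; rewrite wE big1 // => a _.
have : vsval (psi I w) = 0 by rewrite w0 linear0.
rewrite wE psi_sum => s0.
have /Gamma_eq0-> : Gamma a (t a) = 0.
  by apply: (planting_sum_eq0 (x := fun a => Gamma a (t a))); rewrite s0 linear0.
by rewrite linear0.
Qed.

Lemma psi_surj z : exists w, psi I w = z.
Proof.
have [x zE] := v1_planting (subvsP z).
exists (\sum_a tens (point a : Defs.Perm I) (pairing (x a))).
apply: subvs_inj; rewrite psi_sum [RHS]zE.
by apply: eq_bigr => a _; rewrite pairingK.
Qed.

Lemma psi_bij : bijective (psi I).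
Proof.
exists ((psi I)^-1)%VF; first exact/lker0_lfunK/lker_psi.
move=> z; have [w <-] := psi_surj z.
by rewrite lker0_lfunK ?lker_psi.
Qed.

(** By linearity t is the class of a basis pair, where [cyc_bas_pairing] applies. This makes rho
    exist and mu well defined. *)
Lemma psi_iota_d2 t : vsval (psi I (iota_cyc I t)) \in limg (d2 I).
Proof.
rewrite iota_sum psi_sum.
have [u ->] := cyc_sec t; rewrite -cyc_homE (tpow_dec u).
pose h := (\sum_a (planting a \o Gamma a))%VF : 'Hom(CycPreLie I, tpow I 1).
have hE v : h v = \sum_a planting a (Gamma a v).
  by rewrite sum_lfunE; apply: eq_bigr => a _; rewrite comp_lfunE.
rewrite -hE !linear_sum memv_suml // => -[[f R] fF] _ /=.
rewrite !linearZ memvZ //= hE; rewrite (pair_tuple (thead R) R) in fF *.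
have [x [xE xd]] := cyc_bas_pairing fF.
rewrite (eq_bigr (fun i => planting i (x i))) // => i _.
by rewrite cyc_homE (xE i) pairingK.
Qed.

(* A family of plantings that is a sum of brackets is determined by any one of
   its members. *)
Lemma psi_d2_iota w : vsval (psi I w) \in limg (d2 I) -> exists t, w = iota_cyc I t.
Proof.
move=> wd; have [t wE] := tens_dec w.
have [I0|[o _]] := set_0Vmem [set: I].
  exists 0; rewrite linear0 wE big1 // => a _.
  by move/setP/(_ a): I0; rewrite !inE.
exists (t o); apply/eqP; rewrite -subr_eq0 -memv0 -(eqP lker_psi) memv_ker; apply/eqP.
have dE : w - iota_cyc I (t o) = \sum_a tens (point a : Defs.Perm I) (t a - t o).
  rewrite wE iota_sum -sumrB; apply: eq_bigr => a _; by rewrite linearB.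
apply: subvs_inj; rewrite linear0; apply: (@v1_indep _ o).
- exact: subvsP.
- rewrite dE psi_sum root_proj_sum_planting (big_pred1 o) => [|j]; last by rewrite inE.
  by rewrite subrr !linear0.
by rewrite linearB linearB memvB // psi_iota_d2.
Qed.

End Psi.

(** * The two rows *)

Lemma sub_actE (P : smod) (U : forall I, {vspace P I}) (Us : stable U)
    I J (s : bij I J) (x : sub_smod Us I) :
  vsval (sact (sub_smod Us) s x) = sact P s (vsval x).
Proof. by rewrite /= /sub_act restrE ?Us. Qed.

Section BottomRow.

Lemma delta_v1_mor : is_mor delta_v1.
Proof.
move=> I J s; apply/lfunP => x; rewrite [LHS]comp_lfunE [RHS]comp_lfunE.
apply: subvs_inj.
rewrite delta_v1E [in LHS]sub_actE [in RHS]sub_actE delta_v1E.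
by rewrite -!comp_lfunE deltaR_mor.
Qed.

Lemma pi_indec_mor : is_mor pi_indec.
Proof.
move=> I J s; apply/lfunP => x; rewrite [LHS]comp_lfunE [RHS]comp_lfunE.
exact/esym/(quo_actE (limg_stable delta2_mor)).
Qed.

Lemma pi_v1_mor : is_mor pi_v1.
Proof.
move=> I J s; apply/lfunP => x; rewrite [LHS]comp_lfunE [RHS]comp_lfunE.
apply: subvs_inj.
rewrite pi_v1E [in LHS]sub_actE [in RHS]sub_actE pi_v1E.
by rewrite -!comp_lfunE pi_indec_mor.
Qed.

Variable I : finType.

Lemma lker_delta_v1 : lker (delta_v1 I) == 0%VS.
Proof.
rewrite -subv0; apply/subvP => x; rewrite memv_ker memv0 => /eqP x0.
have : vsval x \in lker (deltaR I) by rewrite memv_ker -delta_v1E x0 linear0.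
by rewrite deltaR_inj memv0 => /eqP x0'; apply/eqP/subvs_inj; rewrite x0' linear0.
Qed.

Lemma pi_v1_eq0 (z : PreLie_v1 I) : (pi_v1 I z == 0) = (vsval z \in limg (d2 I)).
Proof.
have -> : limg (d2 I) = limg (delta2 I).
  apply/vspaceP => v; apply/memv_imgP/memv_imgP => -[x _ ->].
    by exists (qproj (asym I 2) x); rewrite ?memvf // delta2E.
  by exists (qsec _ x); rewrite ?memvf // -delta2E qsecK.
rewrite -qproj_eq0 -[qproj _ _]pi_v1E -(inj_eq (@subvs_inj _ _ _)).
by rewrite linear0.
Qed.

Lemma limg_delta_v1 : limg (delta_v1 I) = lker (pi_v1 I).
Proof.
apply/vspaceP => z; rewrite memv_ker pi_v1_eq0 -limg_deltaR.
apply/memv_imgP/memv_imgP => -[x _ zx].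
  by exists (vsval x); rewrite ?memvf // zx delta_v1E.
have xv : x \in (deltaR I @^-1: v1 I)%VS by rewrite -memv_preim -zx subvsP.
exists (vsproj _ x); first exact: memvf.
by apply: subvs_inj; rewrite delta_v1E vsprojK.
Qed.

(** Planted trees have root valence 1 and span modulo brackets once there are two vertices; with
    fewer, the target is zero. *)
Lemma limg_pi_v1 : limg (pi_v1 I) = fullv.
Proof.
apply/vspaceP => y; rewrite memvf; apply/memv_imgP.
have [I2|I1] := leqP 2 #|I|; last first.
  exists 0; first exact: mem0v.
  rewrite linear0; apply: subvs_inj; apply/eqP; rewrite linear0 -memv0.
  have e : Indec_ge2_sub I = 0%VS by rewrite /Indec_ge2_sub leqNgt I1.
  by move: (vsval y) (subvsP y) => v; rewrite e.
have /card_gt0P[o _] : (0 < #|I|)%N by apply: ltnW.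
have : qsec _ (vsval y) \in (limg (d2 I) + basis_span (planted o))%VS.
  by rewrite planted_span ?memvf.
case/memv_addP => b bd [z zp yE].
have zv : z \in v1 I.
  rewrite v1E; apply/memv_basis_span => G Gv.
  by apply: (memv_basis_span _ _ zp); rewrite negb_and Gv.
exists (vsproj _ z); first exact: memvf.
apply: subvs_inj; rewrite pi_v1E vsprojK //.
have -> : pi_indec I z = pi_indec I (b + z).
  rewrite linearD /= (eqP (_ : pi_indec I b == 0)) ?add0r // qproj_eq0.
  have /memv_imgP[x _ ->] := bd.
  by rewrite -delta2E memv_img ?memvf.
by rewrite -yE [RHS]qsecK.
Qed.

End BottomRow.

Section TopRow.

Lemma odot_actE (P Q : smod) I J (s : bij I J) (v : P I) (w : Q I) :
  sact (odot P Q) s (tens v w) = tens (sact P s v) (sact Q s w).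
Proof. exact: tmapE. Qed.

Lemma proj_cycE I (v : Defs.Perm I) (t : CycPreLie I) :
  proj_cyc I (tens v t) = tens (Defs.perm_refl I v) t.
Proof. by rewrite /proj_cyc tmapE id_lfunE. Qed.

Lemma proj_cyc_mor : is_mor proj_cyc.
Proof.
move=> I J s; apply: tens_span => v t; rewrite !comp_lfunE odot_actE !proj_cycE.
rewrite odot_actE; congr tens; exact/esym/(quo_actE (limg_stable comm_perm_mor)).
Qed.

Lemma iota_cyc_mor : is_mor iota_cyc.
Proof.
move=> I J s; apply/lfunP => t; rewrite [LHS]comp_lfunE [RHS]comp_lfunE !iota_sum linear_sum.
rewrite (reindex (bfun s)); last first.
  by exists (binv s) => x _; rewrite ?bfunK ?binvK.
apply: eq_bigr => a _.
transitivity (tens (sact Defs.Perm s (point a)) (sact CycPreLie s t)).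
  by congr tens; apply/esym/linext_point.
exact/esym/(@odot_actE Defs.Perm CycPreLie).
Qed.

Variable I : finType.

Lemma lker_iota : lker (iota_cyc I) = 0%VS.
Proof.
apply/eqP; rewrite -subv0; apply/subvP => t; rewrite memv_ker memv0 => /eqP t0.
apply/eqP; have [I0|[o _]] := set_0Vmem [set: I].
  have [u ->] := cyc_sec t; rewrite [u]tpow_inhab; first by rewrite -cyc_homE linear0.
  by move=> o; move/setP/(_ o): I0; rewrite !inE.
apply: (@Gamma_eq0 _ o); apply: (planting_sum_eq0 (x := fun a => Gamma a t)).
by rewrite -(psi_sum (fun=> t)) -iota_sum t0 !linear0.
Qed.

Lemma proj_iota t : proj_cyc I (iota_cyc I t) = 0.
Proof.
rewrite iota_cycE proj_cycE (eqP (_ : Defs.perm_refl I _ == 0)); last first.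
  by rewrite qproj_eq0 memv_img ?memvf.
by rewrite /tens linear0 trmx0 mul0mx.
Qed.

Lemma limg_proj_cyc : limg (proj_cyc I) = fullv.
Proof.
apply/vspaceP => z; rewrite memvf -qproj_eq0.
suff -> : qproj (limg (proj_cyc I)) = 0 by rewrite zero_lfunE eqxx.
apply: tens_span => v t; rewrite zero_lfunE; apply/eqP; rewrite qproj_eq0.
by rewrite -[v]qsecK -[qproj _ _]/(Defs.perm_refl I _) -proj_cycE memv_img ?memvf.
Qed.

(* The functional v |-> v a - v o on Perm vanishes on the sum of the points. *)
Lemma difference_hom (C : vectType rat) (a o : I) :
  exists h : 'Hom(tensor (Refl I) C, C), forall b t,
    h (tens (Defs.perm_refl I (point b)) t) = ((b == a)%:R - (b == o)%:R) *: t.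
Proof.
pose l : 'Hom({ffun I -> rat^o}, rat^o) := linext (fun b : I => (b == a)%:R - (b == o)%:R : rat^o).
have l0 : (l @: limg (comm_perm I) <= 0)%VS.
  apply/subvP => _ /memv_imgP[_ /memv_imgP[c _ ->] ->].
  have -> : comm_perm I c = c *: \sum_(b : I) point b by rewrite /comm_perm lfunE.
  rewrite memv0 linearZ linear_sum /=.
  rewrite (eq_bigr (fun b : I => (b == a)%:R - (b == o)%:R : rat^o)) => [|b _]; last first.
    by rewrite /l linext_point.
  rewrite sumrB (bigD1 a) //= (bigD1 (P := xpredT) o) //= !eqxx !big1 ?subrr ?scaler0 //.
    by move=> b /negPf->.
  by move=> b /negPf->.
exists (tlift (fun r t => (qlift (limg (comm_perm I)) l r : rat) *: t)) => b t.
rewrite tliftE => [|t' c x y|r c x y].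
- by rewrite qliftE // /l linext_point.
- by rewrite linearP scalerDl scalerA.
- by rewrite scalerDr !scalerA mulrC.
Qed.

Lemma limg_iota : limg (iota_cyc I) = lker (proj_cyc I).
Proof.
apply/vspaceP => w; rewrite memv_ker; apply/memv_imgP/eqP => [[t _ ->]|w0].
  exact: proj_iota.
have [t wE] := tens_dec w.
have [I0|[o _]] := set_0Vmem [set: I].
  exists 0; first exact: mem0v.
  by rewrite linear0 wE big1 // => a _; move/setP/(_ a): I0; rewrite !inE.
(* Any member of the family serves: functionals comparing a with o show that t is constant. *)
exists (t o); first exact: memvf.
rewrite wE iota_sum; apply: eq_bigr => a _; congr tens.
have [h hE] := difference_hom (CycPreLie I) a o.
have : h (proj_cyc I w) = t a - t o.
  rewrite wE !linear_sum /= (eq_bigr (fun b => ((b == a)%:R - (b == o)%:R) *: t b)).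
    rewrite (eq_bigr (fun b => (b == a)%:R *: t b - (b == o)%:R *: t b)) => [|b _].
      rewrite sumrB (bigD1 a) //= [X in _ - X](bigD1 o) //= !eqxx !scale1r.
      by rewrite !big1 ?addr0 // => b /negPf->; rewrite scale0r.
    by rewrite scalerBl.
  by move=> b _; rewrite /= proj_cycE hE.
by rewrite w0 linear0 => /esym/eqP; rewrite subr_eq0 => /eqP.
Qed.

End TopRow.

(** * Equivariance and conclusion *)

Section PsiMorphism.
Variables (I J : finType) (s : bij I J) (a : I).

Lemma bij_away_fun (x : {x : I | x != a}) : s (val x) != s a.
Proof. by rewrite (inj_eq (@Defs.bij_inj _ _ s)) (valP x). Qed.

Lemma bij_away_inv (y : {y : J | y != s a}) : binv s (val y) != a.
Proof.
by apply: contra (valP y) => /eqP e; apply/eqP; rewrite -[LHS](binvK s) e.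
Qed.

Definition away_fun (x : {x : I | x != a}) : {y : J | y != s a} :=
  Sub (s (val x)) (bij_away_fun x).

Definition away_inv (y : {y : J | y != s a}) : {x : I | x != a} :=
  Sub (binv s (val y)) (bij_away_inv y).

Lemma away_funK : cancel away_fun away_inv.
Proof. by move=> x; apply: val_inj; rewrite /= bfunK. Qed.

Lemma away_invK : cancel away_inv away_fun.
Proof. by move=> y; apply: val_inj; rewrite /= binvK. Qed.

Definition bij_away : bij {x : I | x != a} {y : J | y != s a} :=
  Bij away_funK away_invK.

Lemma tact_pt x : tact 2 s (pt a x) = pt (s a) (tact 1 bij_away x).
Proof.
rewrite -!comp_lfunE; move: x; apply/lfunP; apply: tpow_hom_eq => T FT.
rewrite !comp_lfunE pt_bas // !tactE pt_bas ?is_forest_act //.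
congr (bas (_, _)); last first.
  by apply: val_inj; rewrite /= /thead tnth_map.
apply/ffunP => y; rewrite -[y](binvK s) !ffunE bfunK.
move: (binv s y) => {}y.
case: insubP => [y' _ <-|]; last first.
  by rewrite negbK => /eqP->; rewrite insubN ?eqxx.
have -> : insub (s (val y')) = Some (bij_away y') :> option {z : J | z != s a}.
  by rewrite -[s (val y')]/(val (bij_away y')) valK.
by rewrite /= ffunE /= away_funK; case: (T.1 y').
Qed.

Lemma sact_pairing x :
  sact CycPreLie s (pairing x) = pairing (tact 1 bij_away x).
Proof.
rewrite /pairing -tact_pt /cyc.
rewrite -Lam_actE.
exact: (quo_actE K_P_stable).
Qed.

Lemma tact_planting x :
  tact 1 s (planting a x) = planting (s a) (tact 1 bij_away x).
Proof.
rewrite /planting !comp_lfunE -tact_pt.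
by have /lfunP/(_ (pt a x)) := tri_mor s; rewrite !comp_lfunE => ->.
Qed.

End PsiMorphism.

Lemma psi_mor : is_mor (psi Gamma).
Proof.
move=> I J s; apply: tens_point_eq => a t.
rewrite [LHS]comp_lfunE [RHS]comp_lfunE; apply: subvs_inj.
rewrite [RHS]sub_actE psiE.
have -> : sact (odot Defs.Perm CycPreLie) s (tens (point a) t)
    = tens (point (s a) : Defs.Perm J) (sact CycPreLie s t).
  rewrite (@odot_actE Defs.Perm CycPreLie); congr tens; exact: linext_point.
rewrite psiE -{1}(GammaK a t) sact_pairing pairingK.
have := tact_planting s (Gamma a t); rewrite /planting !comp_lfunE => ->.
by [].
Qed.

(** The vector g^-1 (g w) differs from w by an element of the kernel of g, which h kills. *)
Lemma lfun_inv_ker (V W U : vectType rat) (g : 'Hom(V, W)) (h : 'Hom(V, U)) w :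
  (lker g <= lker h)%VS -> h (g^-1%VF (g w)) = h w.
Proof.
move/subvP => gh; apply/eqP; rewrite -subr_eq0 -linearB -memv_ker gh //.
by rewrite memv_ker linearB /= limg_lfunVK ?memv_img ?memvf // subrr.
Qed.

Definition rho : smap CycPreLie Rela_v1 :=
  fun I => ((delta_v1 I)^-1 \o psi Gamma I \o iota_cyc I)%VF.

(** [(proj_cyc I)^-1] is only a section of the projection; [mu_proj] shows that its choice does not
    matter. *)
Definition mu : smap (odot Refl CycPreLie) Indec_ge2 :=
  fun I => (pi_v1 I \o psi Gamma I \o (proj_cyc I)^-1)%VF.

Lemma delta_rho I t : delta_v1 I (rho I t) = psi Gamma I (iota_cyc I t).
Proof.
have -> : rho I t = (delta_v1 I)^-1%VF (psi Gamma I (iota_cyc I t)).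
  exact: etrans (comp_lfunE _ _ _) (comp_lfunE _ _ _).
rewrite limg_lfunVK // limg_delta_v1 memv_ker pi_v1_eq0.
exact: psi_iota_d2.
Qed.

Lemma mu_proj I w : mu I (proj_cyc I w) = pi_v1 I (psi Gamma I w).
Proof.
have -> : mu I (proj_cyc I w) =
    pi_v1 I (psi Gamma I ((proj_cyc I)^-1%VF (proj_cyc I w))).
  exact: etrans (comp_lfunE _ _ _) (comp_lfunE _ _ _).
have := @lfun_inv_ker _ _ _ (proj_cyc I) (pi_v1 I \o psi Gamma I)%VF w.
rewrite [X in X = _]comp_lfunE [X in _ = X]comp_lfunE; apply.
rewrite -limg_iota; apply/subvP => _ /memv_imgP[t _ ->].
by rewrite memv_ker comp_lfunE pi_v1_eq0 psi_iota_d2.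
Qed.

Lemma delta_v1_inj I : injective (delta_v1 I).
Proof. by apply/lker0P; apply: lker_delta_v1. Qed.

Lemma proj_cyc_surj I z : exists w, z = proj_cyc I w.
Proof.
have : z \in limg (proj_cyc I) by rewrite limg_proj_cyc memvf.
by case/memv_imgP => w _ ->; exists w.
Qed.

Lemma rho_mor : is_mor rho.
Proof.
move=> I J s; apply/lfunP => t; rewrite [LHS]comp_lfunE [RHS]comp_lfunE.
apply: delta_v1_inj; rewrite delta_rho.
have /lfunP/(_ t) := iota_cyc_mor s; rewrite [LHS]comp_lfunE [RHS]comp_lfunE => ->.
have /lfunP/(_ (iota_cyc I t)) := psi_mor s.
rewrite [LHS]comp_lfunE [RHS]comp_lfunE => ->.
have /lfunP/(_ (rho I t)) := delta_v1_mor s.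
by rewrite [LHS]comp_lfunE [RHS]comp_lfunE delta_rho => ->.
Qed.

Lemma mu_mor : is_mor mu.
Proof.
move=> I J s; apply/lfunP => z; rewrite [LHS]comp_lfunE [RHS]comp_lfunE.
have [w ->] := proj_cyc_surj z; rewrite mu_proj.
have /lfunP/(_ w) := proj_cyc_mor s; rewrite [LHS]comp_lfunE [RHS]comp_lfunE => <-.
rewrite mu_proj.
have /lfunP/(_ w) := psi_mor s; rewrite [LHS]comp_lfunE [RHS]comp_lfunE => ->.
have /lfunP/(_ (psi Gamma I w)) := pi_v1_mor s.
by rewrite [LHS]comp_lfunE [RHS]comp_lfunE => ->.
Qed.

Lemma hom_bij (V W : vectType rat) (f : 'Hom(V, W)) :
  lker f = 0%VS -> limg f = fullv -> bijective f.
Proof.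
move=> /eqP k0 fT; exists (f^-1)%VF; first exact: lker0_lfunK.
by move=> w; rewrite limg_lfunVK // fT memvf.
Qed.

(** For surjectivity, the preimage under psi of an element of the image of delta maps to a bracket,
    hence comes from iota by [psi_d2_iota]. *)
Lemma rho_bij I : bijective (rho I).
Proof.
apply: hom_bij; apply/vspaceP => x.
  rewrite memv_ker memv0 -(inj_eq (@delta_v1_inj I)) delta_rho linear0.
  rewrite -memv_ker (eqP (lker_psi I)) memv0 -memv_ker lker_iota memv0 //.
rewrite memvf; apply/memv_imgP.
have [w wx] := psi_surj (delta_v1 I x).
have [|t wt] := @psi_d2_iota I w.
  by rewrite wx -pi_v1_eq0 -memv_ker -limg_delta_v1 memv_img ?memvf.
by exists t; rewrite ?memvf //; apply: delta_v1_inj; rewrite delta_rho -wt wx.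
Qed.

Lemma mu_bij I : bijective (mu I).
Proof.
apply: hom_bij; apply/vspaceP => z.
  rewrite memv_ker memv0; have [w ->] := proj_cyc_surj z.
  apply/eqP/eqP => [|->]; last exact: linear0.
  rewrite mu_proj => /eqP; rewrite pi_v1_eq0 => /psi_d2_iota[t ->].
  exact: proj_iota.
rewrite memvf; have : z \in limg (pi_v1 I) by rewrite limg_pi_v1 memvf.
case/memv_imgP => y _ ->; have [w <-] := psi_surj y.
by rewrite -mu_proj memv_img ?memvf.
Qed.

Theorem proposition7p6 :
  exists (Gamma : Gamma_type)
         (rho : smap CycPreLie Rela_v1)
         (mu : smap (odot Refl CycPreLie) Indec_ge2),
  [/\ Gamma_spec Gamma,
      forall rho' : smap CycPreLie Rela_v1,
        (is_mor rho' /\ square iota_cyc delta_v1 rho' (psi Gamma)) <->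
        (forall I, rho' I = rho I),
      forall mu' : smap (odot Refl CycPreLie) Indec_ge2,
        (is_mor mu' /\ square proj_cyc pi_v1 (psi Gamma) mu') <->
        (forall I, mu' I = mu I)
    & short_exact_iso iota_cyc proj_cyc delta_v1 pi_v1 rho (psi Gamma) mu].
Proof.
have rho_sq : square iota_cyc delta_v1 rho (psi Gamma).
  by move=> I; apply/lfunP => t; rewrite [LHS]comp_lfunE [RHS]comp_lfunE delta_rho.
have mu_sq : square proj_cyc pi_v1 (psi Gamma) mu.
  by move=> I; apply/lfunP => w; rewrite [LHS]comp_lfunE [RHS]comp_lfunE mu_proj.
exists Gamma, rho, mu; split.
- exact: GammaP.
- move=> rho'; split=> [[_ sq] I|rhoE].
    apply/lfunP => t; apply: delta_v1_inj; rewrite delta_rho.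
    by have /lfunP/(_ t) := sq I; rewrite [LHS]comp_lfunE [RHS]comp_lfunE.
  split=> [I J s|I]; rewrite !rhoE; [exact: rho_mor | exact: rho_sq].
- move=> mu'; split=> [[_ sq] I|muE].
    apply/lfunP => z; have [w ->] := proj_cyc_surj z; rewrite mu_proj.
    by have /lfunP/(_ w) := sq I; rewrite [LHS]comp_lfunE [RHS]comp_lfunE.
  split=> [I J s|I]; rewrite !muE; [exact: mu_mor | exact: mu_sq].
split=> //.
- split; [exact: iota_cyc_mor | exact: proj_cyc_mor | move=> I].
  by rewrite lker_iota limg_iota limg_proj_cyc.
- split; [exact: delta_v1_mor | exact: pi_v1_mor | move=> I].
  by rewrite limg_delta_v1 limg_pi_v1 (eqP (lker_delta_v1 I)).
split; split; [exact: rho_mor | exact: rho_bij | exact: psi_mor | exact: psi_bij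
  | exact: mu_mor | exact: mu_bij].
Qed.
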